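(* Let $b\ge 2$, $\beta\ge 0$, $h\in\mathbb{R}$, and let $\tau\in\{\pm1\}^{\mathbb{T}^b}$ be a boundary condition. Suppose that at least one of the following holds: (i) $\tau$ is arbitrary, and either $\beta<\beta_1$ (with $h$ arbitrary), or $|h|>h_c(\beta)$ (with $\beta$ arbitrary); (ii) $\tau$ is the $(+)$-boundary condition, i.e. $\tau\equiv +1$, and $\beta,h$ are arbitrary. Then the Glauber dynamics mixes, in a very strong sense (namely in $L^2(\mu)$, uniformly over the starting configuration), in time $O(\log n)$: there exists a constant $C$, independent of $T$, such that, for every finite complete subtree $T$ of $\mathbb{T}^b$ with $n\ge2$ vertices, the $L^2$ mixing time $T_2$ of the Glauber dynamics on $T$ with boundary condition $\tau$ satisfies $T_2\le C\log n$. In particular the (ordinary, $L^1$) mixing time satisfies $T_1\le T_2\le C\log n$.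
   Context: Setting. Fix an integer $b\ge2$, $\beta\ge0$ (inverse temperature) and $h\in\mathbb{R}$ (external field). $\mathbb{T}^b$ is the infinite rooted tree in which every vertex has $b$ children. $T$ denotes a finite complete subtree: for some vertex $r$ (the root of $T$) and some $m\ge0$, $T$ consists of $r$ and all its descendants at distance at most $m$ from $r$; $n=|T|=(b^{m+1}-1)/(b-1)$. $\partial T$ is the set of children in $\mathbb{T}^b$ of the leaves of $T$ (so $|\partial T|=b^{m+1}$); only edges inside $T\cup\partial T$ are considered. For $A\subseteq T$, $\partial A$ is the set of vertices of $(T\cup\partial T)\setminus A$ adjacent to $A$, and $E(A\cup\partial A)$ is the set of edges with both endpoints in $A\cup\partial A$. A boundary condition is a configuration $\tau\in\{\pm1\}^{\mathbb{T}^b}$; $\Omega=\Omega_T^\tau$ is the set of $\sigma\in\{\pm1\}^{T\cup\partial T}$ agreeing with $\tau$ on $\partial T$. For $\eta\in\Omega$ and $A\subseteq T$, $\mu_A^\eta$ is the probability measure on $\Omega$ with $\mu_A^\eta(\sigma)\propto\exp[\beta(\sum_{xy\in E(A\cup\partial A)}\sigma_x\sigma_y+h\sum_{x\in A}\sigma_x)]$ if $\sigma$ agrees with $\eta$ outside $A$, and $\mu_A^\eta(\sigma)=0$ otherwise. $\mu=\mu_T^\tau$ is the case $A=T$. Glauber dynamics and mixing times. The (heat-bath) Glauber dynamics is the continuous-time Markov chain on $\Omega$ with generator $(\mathcal{L}f)(\sigma)=\sum_{x\in T}\mu^\sigma_{\{x\}}(\sigma^x)[f(\sigma^x)-f(\sigma)]$,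 where $\sigma^x$ is $\sigma$ with the spin at $x$ flipped. Let $P_t=e^{t\mathcal{L}}$ and $h_t^\sigma(\eta)=P_t(\sigma,\eta)/\mu(\eta)$. For $1\le p\le\infty$, $T_p=\min\{t>0:\ \sup_\sigma\|h_t^\sigma-1\|_p\le 1/e\}$, where $\|\cdot\|_p$ is the $L^p(\Omega,\mu)$ norm. $T_1$ is usually called simply the mixing time. Critical values. $\beta_0=\frac12\log\frac{b+1}{b-1}$ and $\beta_1=\frac12\log\frac{\sqrt b+1}{\sqrt b-1}$. For $\beta>\beta_0$, $h_c(\beta)>0$ is the critical field such that the infinite-volume Ising Gibbs measure on $\mathbb{T}^b$ with parameters $(\beta,h)$ is non-unique when $|h|\le h_c(\beta)$ and unique when $|h|>h_c(\beta)$; for $\beta\le\beta_0$ (where the Gibbs measure is unique for all $h$) $h_c(\beta)=0$. *)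

(* Defs.v *)
From HB Require Import structures.
From mathcomp Require Import all_boot all_order all_algebra finmap.
From mathcomp Require Import all_classical all_reals all_analysis.

Set Implicit Arguments.
Unset Strict Implicit.
Unset Printing Implicit Defensive.

Import Order.TTheory GRing.Theory Num.Theory.
Import numFieldNormedType.Exports.

Local Open Scope ring_scope.

(* Vertices of the infinite rooted b-ary tree are finite words over 'I_b; the
   root is [::] and the children of u are the words i :: u, so the descendants
   of r at distance k are the words w ++ r with size w = k.                   *)
Definition vertex (b : nat) := seq 'I_b.

Definition child (b : nat) (u v : vertex b) : bool :=
  [exists i : 'I_b, v == i :: u].

Definition tree_adj (b : nat) (u v : vertex b) : bool :=
  child u v || child v u.

(* behead [::] = [::], but the root is not a neighbor of itself. *)
Definition neighbors (b : nat) (u : vertex b) : {fset vertex b} :=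
  [fset v in behead u :: [seq i :: u | i <- enum 'I_b] | tree_adj u v]%fset.

(* A spin is a boolean, with true for +1 and false for -1. *)
Definition config (b : nat) := vertex b -> bool.

Definition spin (R : realType) (s : bool) : R := if s then 1 else -1.

(* The configuration equal to xi on A and to eta off A. *)
Definition glue (b : nat) (A : {fset vertex b}) (eta : config b)
    (xi : {ffun A -> bool}) : config b :=
  fun v => oapp xi (eta v) (insub v).

(* W is the set of vertices that are taken into account: the whole tree for
   infinite-volume measures, T together with its boundary for the dynamics.   *)
Definition bdry (b : nat) (W : {pred vertex b}) (A : {fset vertex b}) :
    {fset vertex b} :=
  [fset v in \bigcup_(u <- A) neighbors u | (v \in W) && (v \notin A)]%fset.

(* The sum over (u, v) with v a child of u counts each edge once. *)
Definition energy (R : realType) (b : nat) (W : {pred vertex b}) (h : R)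
    (A : {fset vertex b}) (s : config b) : R :=
  let B := (A `|` bdry W A)%fset in
  \sum_(u <- B) \sum_(v <- B | child u v) spin R (s u) * spin R (s v)
  + h * \sum_(u <- A) spin R (s u).

(* The probability mu_A^eta(s). *)
Definition gibbs (R : realType) (b : nat) (W : {pred vertex b}) (beta h : R)
    (A : {fset vertex b}) (eta s : config b) : R :=
  if `[< forall v, v \notin A -> s v = eta v >] then
    expR (beta * energy W h A s)
    / \sum_(xi : {ffun A -> bool}) expR (beta * energy W h A (glue eta xi))
  else 0.

Definition beta0 (R : realType) (b : nat) : R :=
  2^-1 * ln ((b%:R + 1) / (b%:R - 1)).

Definition beta1 (R : realType) (b : nat) : R :=
  2^-1 * ln ((Num.sqrt b%:R + 1) / (Num.sqrt b%:R - 1)).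

Section InfiniteVolume.
Local Open Scope classical_set_scope.

Definition cylinders (b : nat) : set (set (config b)) :=
  [set E | exists v s, E = [set sigma | sigma v = s]].

Definition config_space (b : nat) := g_sigma_algebraType (@cylinders b).

(* Gibbs measures on the infinite tree, through the DLR equations. *)
Definition is_gibbs (R : realType) (b : nat) (beta h : R)
    (P : probability (config_space b) R) : Prop :=
  forall (A : {fset vertex b}) (E : set (config_space b)), measurable E ->
    P E = (\int[P]_eta
      (\sum_(xi : {ffun A -> bool})
         gibbs predT beta h A eta (glue eta xi) * \1_E (glue eta xi))%R%:E)%E.

Definition gibbs_unique (R : realType) (b : nat) (beta h : R) : Prop :=
  exists P : probability (config_space b) R, is_gibbs beta h P /\
    forall Q : probability (config_space b) R, is_gibbs beta h Q ->
      forall E, measurable E -> Q E = P E.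

Definition gibbs_nonunique (R : realType) (b : nat) (beta h : R) : Prop :=
  exists P Q : probability (config_space b) R,
    [/\ is_gibbs beta h P, is_gibbs beta h Q &
        exists2 E, measurable E & P E != Q E].

(* hc is the critical field h_c(beta); at most one hc has this property. *)
Definition is_critical_field (R : realType) (b : nat) (beta hc : R) : Prop :=
  if beta <= beta0 R b then hc = 0
  else 0 < hc /\
       forall h : R, (`|h| <= hc -> gibbs_nonunique b beta h) /\
                     (hc < `|h| -> gibbs_unique b beta h).

End InfiniteVolume.

(* The complete subtree of depth m rooted at r. The union of this tree and its
   boundary, the children of its leaves, is complete_subtree r m.+1.          *)
Definition complete_subtree (b : nat) (r : vertex b) (m : nat) :
    {fset vertex b} :=
  [fset (val w ++ r : vertex b) | w in {: m.-bseq 'I_b}]%fset.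

Section Dynamics.
Context (R : realType) (b : nat) (beta h : R) (tau : config b).
Context (r : vertex b) (m : nat).

Let T : {fset vertex b} := complete_subtree r m.
Let W : {pred vertex b} := mem (complete_subtree r m.+1).

(* The spins on the boundary are those of tau, so that an element of Omega is
   given by its spins on T; fullc recovers the whole configuration.           *)
Definition Omega := {ffun complete_subtree r m -> bool}.

Definition fullc (s : Omega) : config b := glue tau s.

Definition mu (s : Omega) : R := gibbs W beta h T tau (fullc s).

Definition flip (s : Omega) (x : T) : Omega :=
  [ffun y => if y == x then ~~ s y else s y].

Definition generator (f : Omega -> R) (s : Omega) : R :=
  \sum_(x : T)
    gibbs W beta h [fset val x]%fset (fullc s) (fullc (flip s x))
    * (f (flip s x) - f s).

(* P_t(s, eta) for P_t = e^(tL), as the exponential series applied to the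
   indicator function of eta.                                                 *)
Definition heat_kernel (t : R) (s eta : Omega) : R :=
  limn (series (fun k =>
    exp_coeff t k * iter k generator (fun z => (z == eta)%:R) s)).

Definition density (t : R) (s eta : Omega) : R := heat_kernel t s eta / mu eta.

Definition Lp_norm (p : R) (f : Omega -> R) : R :=
  (\sum_(s : Omega) mu s * `|f s| `^ p) `^ p^-1.

Definition Lp_distance (p t : R) : R :=
  \big[Num.max/0]_(s : Omega) Lp_norm p (fun eta => density t s eta - 1).

(* T_p = t, where T_p is defined as a minimum over positive times. *)
Definition is_mixing_time (p t : R) : Prop :=
  [/\ 0 < t, Lp_distance p t <= (expR 1)^-1 &
      forall u : R, 0 < u -> Lp_distance p u <= (expR 1)^-1 -> t <= u].

End Dynamics.

(* Main.v *)
Require Import Defs.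
From HB Require Import structures.
From mathcomp Require Import all_boot all_order all_algebra finmap.
From mathcomp Require Import all_classical all_reals all_analysis measurable_realfun.
From mathcomp Require Import ring lra zify.

Set Implicit Arguments.
Unset Strict Implicit.
Unset Printing Implicit Defensive.

Import Order.TTheory GRing.Theory Num.Theory.
Import numFieldNormedType.Exports.

Local Open Scope ring_scope.

Local Notation glue := Defs.glue.

(** The measure mu is a Markov chain on the tree: a spin sees its parent through
    the kernel logis (u + 2 beta parent), where the effective field u of a vertex
    obeys u = 2 beta h + (sum of gfun u' over the children).  The only input on
    (tau, beta, h) is that b theta kap(u) is bounded below 1 far from the boundary
    (theta = tanh beta, kap = gfun').  If beta < beta1 this holds since kap <= theta
    and b theta^2 < 1.  Otherwise the fields converge to a fixed point v of
    v = 2 beta h + b gfun v with b kap(v) <= 1, because it is the limit of the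
    iterates from the largest field; for an arbitrary tau this needs the fixed
    point to be unique, and two fixed points would give two Gibbs measures, which
    are built by coding the spins into the digits of a uniform point of [0, 1].

    Under that hypothesis the information that the spins at depth l carry on an
    ancestor decays exponentially in l, with Gaussian-type concentration of the
    log-likelihood ratio.  Hence in the decomposition of the entropy of f^2 along
    the tree, the part of the entropy at x that comes from far below x can be
    absorbed, and a logarithmic Sobolev inequality holds with a constant that does
    not depend on T.  For the density of P_t the second moment y then satisfies
    y' <= - c y ln y, with ln y = O(n) at time 0, hence T_2 = O(log n). *)

(** * Expectations along the tree *)

(** The mean of the log-likelihood ratio under a plus at the ancestor, minus its mean under a minus,
    is the symmetrised relative entropy of the two laws of the far spins. One generation multiplies
    it by at most [b * theta * kap]: [kap] for the edge channel, [theta] for the slope of [gfun]. As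
    [theta < 1], a fixed point with [b kap(v) = 1] is still admissible. The absorption shapes the
    rest. A vertex lies in the blocks of up to [N], at most [2 l], ancestors, so the far part must
    carry a coefficient below a constant over [l]. The variational formula for the entropy asks for
    exponential moments of some order [t0] and loses a term [2 / t0], which does not decay
    exponentially; so [t0] must be a large multiple of [l]. Such moments stay under control because
    the ratio is passed through [i] more levels: each is a sum over conditionally independent child
    subtrees with Lipschitz constant [theta], which turns [t0] into [t0 theta^i]. With [i] fixed
    large, the loss [expR (t0 theta^i M)] is beaten by the exponentially small first moment, while
    [b^i] is only a constant. *)

Section Operators.
Context (R : realType) (b : nat).
Implicit Types (v w x y : vertex b) (s : config b) (F G : config b -> R).
Implicit Types (l : seq (vertex b)) (P : pred (vertex b)).

Definition upd s v (a : bool) : config b := fun w => if w == v then a else s w.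

(* The parent spin of the root is a dummy. *)
Definition par s v : bool := if v is _ :: x then s x else true.

Definition isparent w v : bool := if v is _ :: x then w == x else false.

(** The predicate collects the spins that are ignored, not those that are read: independence passes
    to smaller predicates ([indepW]). *)
Definition indep P F := forall s s', (forall v, ~~ P v -> s v = s' v) -> F s = F s'.

Lemma upd_comm s v w a c : v != w -> upd (upd s v a) w c = upd (upd s w c) v a.
Proof.
move=> vw; apply/funext => y; rewrite /upd.
by case: (eqVneq y w) => // ->; rewrite eq_sym (negbTE vw).
Qed.

Lemma upd_upd s v a c : upd (upd s v a) v c = upd s v c.
Proof. by apply/funext => y; rewrite /upd; case: eqP. Qed.

Lemma upd_same s v a : upd s v a v = a.
Proof. by rewrite /upd eqxx. Qed.

Lemma upd_other s v a w : w != v -> upd s v a w = s w.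
Proof. by rewrite /upd => /negbTE ->. Qed.

Lemma par_upd s w a v : par (upd s w a) v = if isparent w v then a else par s v.
Proof. by case: v => //= i v; rewrite /upd eq_sym. Qed.

Lemma isparent_irr v : isparent v v = false.
Proof. by case: v => //= i v; apply/eqP => /(congr1 size) /=; lia. Qed.

Lemma indep_upd P F s v a : indep P F -> P v -> F (upd s v a) = F s.
Proof. by move=> iF Pv; apply: iF => w; rewrite /upd; case: eqP => // ->; rewrite Pv. Qed.

Lemma indepW P P' F : (forall v, P' v -> P v) -> indep P F -> indep P' F.
Proof. by move=> PP iF s s' ss; apply: iF => v /(contra (PP v)) /ss. Qed.

Lemma indep_comp P F (g : R -> R) : indep P F -> indep P (fun s => g (F s)).
Proof. by move=> iF s s' ss; rewrite (iF _ _ ss). Qed.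

Lemma indep_comp2 P F G (g : R -> R -> R) :
  indep P F -> indep P G -> indep P (fun s => g (F s) (G s)).
Proof. by move=> iF iG s s' ss; rewrite (iF _ _ ss) (iG _ _ ss). Qed.

Context (K : vertex b -> bool -> bool -> R).

(* Resamples the spin at v given its parent; Qs l F is thus the conditional
   expectation of F given the spins off l, when parents precede children in l. *)
Definition Q v F : config b -> R := fun s =>
  K v (par s v) true * F (upd s v true) + K v (par s v) false * F (upd s v false).

Definition Qs l F : config b -> R := foldr Q F l.

Definition topo l := pairwise (fun v w => ~~ isparent w v) l.

Lemma Qs_cat l l' F : Qs (l ++ l') F = Qs l (Qs l' F).
Proof. exact: foldr_cat. Qed.

Lemma Qs_cons v l F : Qs (v :: l) F = Q v (Qs l F).
Proof. by []. Qed.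

(** Neither kernel reads the spin that the other resamples. All reorderings of the sampling rest on
    this one commutation. *)
Lemma Q_comm v w F : v != w -> ~~ isparent v w -> ~~ isparent w v ->
  Q v (Q w F) = Q w (Q v F).
Proof.
move=> vw pvw pwv; apply/funext => s; rewrite /Q !par_upd (negbTE pvw) (negbTE pwv).
by rewrite ![upd (upd s v _) w _]upd_comm //; ring.
Qed.

Lemma QD v F G : Q v (fun s => F s + G s) = fun s => Q v F s + Q v G s.
Proof. by apply/funext => s; rewrite /Q; ring. Qed.

Lemma QsD l F G : Qs l (fun s => F s + G s) = fun s => Qs l F s + Qs l G s.
Proof. by elim: l => //= v l ->; rewrite QD. Qed.

Lemma Q_pull v c F : indep (pred1 v) c -> Q v (fun s => c s * F s) = fun s => c s * Q v F s.
Proof.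
move=> ic; apply/funext => s; rewrite /Q !(indep_upd _ _ ic) /= ?eqxx //; ring.
Qed.

Lemma Qs_pull l c F : indep (mem l) c -> Qs l (fun s => c s * F s) = fun s => c s * Qs l F s.
Proof.
elim: l => //= v l IH ic; rewrite IH ?Q_pull //.
  by apply: indepW ic => w /= /eqP ->; rewrite inE eqxx.
by apply: indepW ic => w /= wl; rewrite inE wl orbT.
Qed.

Lemma QsZ l (k : R) F : Qs l (fun s => k * F s) = fun s => k * Qs l F s.
Proof. by rewrite (@Qs_pull l (fun=> k)). Qed.

Lemma QsN l F : Qs l (fun s => - F s) = fun s => - Qs l F s.
Proof.
have -> : (fun s => - F s) = fun s => -1 * F s by apply/funext => s; rewrite mulN1r.
by rewrite QsZ; apply/funext => s; rewrite mulN1r.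
Qed.

Lemma QsB l F G : Qs l (fun s => F s - G s) = fun s => Qs l F s - Qs l G s.
Proof. by rewrite QsD QsN. Qed.

Lemma Qs_sum l (I : Type) (r : seq I) (D : pred I) (F : I -> config b -> R) :
  Qs l (fun s => \sum_(i <- r | D i) F i s) = fun s => \sum_(i <- r | D i) Qs l (F i) s.
Proof.
elim: r => [|i r IH].
  have -> : (fun s => \sum_(i <- [::] | D i) F i s) = fun s => 0 * (0:R).
    by apply/funext => s; rewrite big_nil mul0r.
  by rewrite QsZ; apply/funext => s; rewrite big_nil mul0r.
have -> : (fun s => \sum_(j <- i :: r | D j) F j s)
   = fun s => (if D i then F i s else 0) + \sum_(j <- r | D j) F j s.
  by apply/funext => s; rewrite big_cons; case: ifP; rewrite ?add0r.
rewrite QsD IH; apply/funext => s; rewrite big_cons; case: ifP => // _.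
suff -> : Qs l (fun=> (0:R)) s = 0 by rewrite add0r.
have := QsZ l 0 (fun=> (0:R)) => /(congr1 (fun f => f s)) /=.
by rewrite !mul0r.
Qed.

Hypothesis K_gt0 : forall v p a, 0 < K v p a.
Hypothesis K_sum : forall v p, K v p true + K v p false = 1.

Lemma Q_indep_id v F : indep (pred1 v) F -> Q v F = F.
Proof.
move=> iF; apply/funext => s; rewrite /Q !(indep_upd _ _ iF) /= ?eqxx //.
by rewrite -mulrDl K_sum mul1r.
Qed.

Lemma Qs_indep_id l F : indep (mem l) F -> Qs l F = F.
Proof.
elim: l => //= v l IH iF; rewrite IH ?Q_indep_id //.
  by apply: indepW iF => w /= /eqP ->; rewrite inE eqxx.
by apply: indepW iF => w /= wl; rewrite inE wl orbT.
Qed.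

Lemma Qs_cst l (k : R) : Qs l (fun=> k) = fun=> k.
Proof. by rewrite Qs_indep_id. Qed.

Lemma Q_le v F G : (forall s, F s <= G s) -> forall s, Q v F s <= Q v G s.
Proof. by move=> FG s; rewrite /Q lerD // ler_pM2l. Qed.

Lemma Qs_le l F G : (forall s, F s <= G s) -> forall s, Qs l F s <= Qs l G s.
Proof. by move=> FG; elim: l => //= v l IH s; apply: Q_le. Qed.

Lemma Qs_gt0 l F : (forall s, 0 < F s) -> forall s, 0 < Qs l F s.
Proof.
move=> F0; elim: l => //= v l IH s; rewrite /Q; apply: addr_gt0; apply: mulr_gt0 => //.
Qed.

Lemma Qs_ge0 l F : (forall s, 0 <= F s) -> forall s, 0 <= Qs l F s.
Proof. by move=> F0 s; have := Qs_le l F0 s; rewrite Qs_cst. Qed.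

Lemma Qs_norm l F s : `|Qs l F s| <= Qs l (fun s => `|F s|) s.
Proof.
rewrite ler_norml; apply/andP; split; last by apply: Qs_le => ?; exact: ler_norm.
have := @Qs_le l (fun s => - `|F s|) F; rewrite QsN; apply => ?.
by rewrite lerNl -normrN; exact: ler_norm.
Qed.

(** Resampling at [v] erases the dependence on [v] but creates one on the parent of [v], which
    therefore must not be among the ignored spins. *)
Lemma Q_indep P v F : indep P F -> (forall w, isparent w v -> ~~ (P w || (w == v))) ->
  indep (fun w => P w || (w == v)) (Q v F).
Proof.
move=> iF pv s s' ss.
have pe : par s v = par s' v.
  by case: v pv ss => //= i x pv ss; apply: ss; apply: pv.
rewrite /Q pe; congr (_ * _ + _ * _); apply: iF => w Pw; rewrite /upd; case: eqP => // /eqP wv;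
 by apply: ss; rewrite negb_or Pw.
Qed.

Lemma Qs_indep P l F : indep P F -> topo l ->
  (forall v w, v \in l -> isparent w v -> ~~ P w) ->
  indep (fun w => P w || (w \in l)) (Qs l F).
Proof.
move=> iF; elim: l => [_ _|v l IH] /=.
  by apply: indepW iF => w; rewrite orbF.
rewrite /topo /= => /andP[/allP tv tl] pl.
have := @Q_indep (fun w => P w || (w \in l)) v (Qs l F).
move=> H; apply: indepW (H _ _) => [w|//|w pw].
- by rewrite inE; case: eqP; rewrite ?orbT //= orbF.
- by apply: IH => // v' w' v'l; apply: pl; rewrite inE v'l orbT.
- rewrite -orbA negb_or (pl v w) ?inE ?eqxx //= negb_or.
  apply/andP; split; first by apply/negP => /tv; rewrite pw.
  by apply/negP => /eqP wv; move: pw; rewrite wv isparent_irr.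
Qed.

Lemma Qs_indep_self l F : topo l -> indep (mem l) (Qs l F).
Proof.
move=> tl; have := @Qs_indep (fun=> false) l F; apply=> //.
by move=> s s' ss; congr F; apply/funext => v; exact: ss.
Qed.

Lemma Qs_move l1 v F : v \notin l1 -> (forall w, w \in l1 -> ~~ isparent w v /\ ~~ isparent v w) ->
  Qs l1 (Q v F) = Q v (Qs l1 F).
Proof.
elim: l1 => //= w l IH; rewrite inE negb_or => /andP[vw vl] H.
rewrite IH // => [|w' w'l]; last by apply: H; rewrite inE w'l orbT.
by have [] := H w; rewrite ?inE ?eqxx // => ? ?; apply: Q_comm => //; rewrite eq_sym.
Qed.

(** The head [v] of [l'] can be moved to the front of [l]: what stands before it in [l] is no parent
    of [v], because [v] comes first in [l'], and no child of [v], because [l] puts parents first. *)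
Lemma Qs_perm l l' F : perm_eq l l' -> uniq l -> topo l -> topo l' -> Qs l F = Qs l' F.
Proof.
elim: l' l => [|v l' IH] l.
  by move/perm_nilP => ->.
move=> pl ul tl tl'.
have vl : v \in l by rewrite (perm_mem pl) inE eqxx.
case/splitPr: vl pl ul tl => l1 l2 pl ul tl.
have pl12 : perm_eq (l1 ++ l2) l'.
  by rewrite -(perm_cons v) -(perm_catCA l1 [:: v]).
have ss : subseq (l1 ++ l2) (l1 ++ v :: l2).
  by rewrite cat_subseq //; exact: subseq_cons.
have t12 : topo (l1 ++ l2) by exact: subseq_pairwise ss tl.
move: (tl'); rewrite /topo /= => /andP[/allP tv tl2].
move: tl; rewrite /topo pairwise_cat => /and3P[tl1 _ _].
rewrite Qs_cat Qs_cons Qs_move.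
- by rewrite -Qs_cat (IH _ pl12) // (subseq_uniq ss).
- by move: ul; rewrite cat_uniq /= => /and3P[_ /norP[]].
- move=> w wl1; split.
    by apply: tv; rewrite -(perm_mem pl12) mem_cat wl1.
  by have /allP /(_ v) := allP tl1 _ wl1; rewrite inE eqxx /=; apply.
Qed.

End Operators.

Section Words.
Context (b : nat).
Implicit Types (v w x y z : vertex b).

Definition desc z : pred (vertex b) := fun v => suffix z v && (v != z).

Lemma isparent_size w v : isparent w v -> size v = (size w).+1.
Proof. by case: v => //= i v /eqP ->. Qed.

Lemma isparent_suffix w v : isparent w v -> suffix w v.
Proof. by case: v => //= i v /eqP ->; exact: suffix_cons. Qed.

Lemma suffix_size z v : suffix z v -> (size z <= size v)%N.
Proof. exact: size_suffix. Qed.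

Lemma suffix_isparent z w v : suffix z v -> v != z -> isparent w v -> suffix z w.
Proof.
case: v => //= i v /suffixP[[|j t]] /=; first by move=> ->; rewrite eqxx.
by move=> [_ ->] _ /eqP ->; exact: suffix_suffix.
Qed.

Lemma child_suffix x v : desc x v -> exists i, suffix (i :: x) v.
Proof.
move=> /andP[/suffixP[t ->]]; elim/last_ind: t => [|t i _]; first by rewrite eqxx.
by move=> _; exists i; rewrite cat_rcons suffix_suffix.
Qed.

Lemma desc_child x v i : suffix (i :: x) v -> desc x v.
Proof.
move=> h; apply/andP; split; first by apply: suffix_trans h; exact: suffix_cons.
by apply/eqP => E; have := suffix_size h; rewrite E /= ltnn.
Qed.

Lemma child_suffix_inj x v i j : suffix (i :: x) v -> suffix (j :: x) v -> i = j.
Proof.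
move=> /suffixP[t ->] /suffixP[t' E].
have st : size t = size t' by have := congr1 size E; rewrite !size_cat /=; lia.
by move/eqP: E; rewrite eqseq_cat // => /andP[_ /eqP [->]].
Qed.

Lemma suffix_eq_size z v : suffix z v -> (size v <= size z)%N -> v = z.
Proof. by move=> /suffixP[[|i t] ->] //=; rewrite size_cat; lia. Qed.

Lemma neq_cons x i : x != i :: x.
Proof. by apply/eqP => /(congr1 size) /=; lia. Qed.

Lemma suffix_consN x i : ~~ suffix (i :: x) x.
Proof. by apply/negP => /suffix_size; rewrite ltnn. Qed.

End Words.

(** Young's inequality for the conjugate pair [a ln a - a] and [expR y], that is, the tangent line
    of [expR] at [ln a]. The variational formula and the convexity of the entropy are integrated
    forms of it. *)
Lemma mul_le_entropy (R : realType) (a y : R) : 0 < a -> a * y <= a * ln a - a + expR y.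
Proof.
move=> a0; have := @expR_ge1Dx R (y - ln a).
rewrite expRB lnK ?posrE // ler_pdivlMr //; nra.
Qed.

(** * Entropy *)

Section Entropy.
Context (R : realType) (b : nat) (K : vertex b -> bool -> bool -> R).
Hypothesis K_gt0 : forall v p a, 0 < K v p a.
Hypothesis K_sum : forall v p, K v p true + K v p false = 1.
Implicit Types (v w x y z : vertex b) (s : config b) (F G : config b -> R).
Implicit Types (l : seq (vertex b)) (P : pred (vertex b)).

Local Notation Qs := (Qs K).

Definition Ent l F s := Qs l (fun s => F s * ln (F s)) s - Qs l F s * ln (Qs l F s).

(** Chain rule: [l] is sampled before [l'], so the entropy over [l'] is averaged over [l]. *)
Lemma Ent_cat l l' F s : Ent (l ++ l') F s = Qs l (Ent l' F) s + Ent l (Qs l' F) s.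
Proof. by rewrite /Ent !Qs_cat QsB; ring. Qed.

(** The upper half of the Donsker-Varadhan formula: Young's inequality at [psi + ln m - ln e],
    integrated. The averages [m] and [e] ignore [l], so they pass through [Qs l]. *)
Lemma Ent_variational l F (psi : config b -> R) s : topo l -> (forall s, 0 < F s) ->
  Qs l (fun s => F s * psi s) s <=
  Ent l F s + Qs l F s * ln (Qs l (fun s => expR (psi s)) s).
Proof.
move=> tl F0; set m := Qs l F; set e := Qs l (fun s => expR (psi s)).
have m0 s' : 0 < m s' by exact: Qs_gt0.
have e0 s' : 0 < e s' by apply: Qs_gt0 => // ?; exact: expR_gt0.
have im : indep (mem l) m by exact: Qs_indep_self.
have ie : indep (mem l) e by exact: Qs_indep_self.
have := @Qs_le _ _ K K_gt0 l
  (fun s => F s * psi s) (fun s => (F s * ln (F s) - F s) +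
     ((m s / e s) * expR (psi s) + (ln (e s) - ln (m s)) * F s)) _ s.
rewrite QsD QsB QsD (@Qs_pull _ _ K l (fun s => m s / e s));
  last exact: (indep_comp2 (fun a c => a / c) im ie).
rewrite (@Qs_pull _ _ K l (fun s => ln (e s) - ln (m s)));
  last exact: (indep_comp2 (fun a c => ln a - ln c) ie im).
move=> H; apply: (le_trans (H _)) => {H}.
  move=> s'; have := @mul_le_entropy R (F s') (psi s' + (ln (m s') - ln (e s'))) (F0 s').
  rewrite expRD expRB !lnK ?posrE //; lra.
rewrite -/m -/e /Ent -/m divfK ?gt_eqF //; lra.
Qed.

Lemma Ent_ge0 l F s : topo l -> (forall s, 0 < F s) -> 0 <= Ent l F s.
Proof.
move=> tl F0; have := @Ent_variational l F (fun=> 0) s tl F0.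
rewrite (_ : (fun s => F s * 0) = fun=> 0) ?Qs_cst //; last by apply/funext => ?; rewrite mulr0.
by rewrite expR0 ln1 mulr0 addr0.
Qed.

(** Young's inequality for [F] at [ln m + ln A - ln B], averaged over [l2] and then over [l1];
    commutation identifies [B] with the average of [A] over [l1]. *)
Lemma Ent_convex l1 l2 F s : topo l1 -> topo l2 -> (forall G, Qs l1 (Qs l2 G) = Qs l2 (Qs l1 G)) ->
  (forall s, 0 < F s) -> Ent l1 (Qs l2 F) s <= Qs l2 (Ent l1 F) s.
Proof.
move=> t1 t2 H12 F0.
set m := Qs l1 F; set A := Qs l2 F; set B := Qs l2 m.
have BA : Qs l1 A = B by rewrite /B /A H12.
have m0 s' : 0 < m s' by exact: Qs_gt0.
have A0 s' : 0 < A s' by exact: Qs_gt0.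
have B0 s' : 0 < B s' by exact: Qs_gt0.
have iA : indep (mem l2) A by exact: Qs_indep_self.
have iB2 : indep (mem l2) B by exact: Qs_indep_self.
have iB1 : indep (mem l1) B by rewrite -BA; exact: Qs_indep_self.
have im : indep (mem l1) m by exact: Qs_indep_self.
have H : forall s, A s * ln (A s) - ln (B s) * A s
   <= Qs l2 (fun s => F s * ln (F s) - ln (m s) * F s) s.
  move=> s'.
  have := @Qs_le _ _ K K_gt0 l2
    (fun s => (1 + ln (A s) - ln (B s)) * F s + (- (A s / B s)) * m s)
    (fun s => F s * ln (F s) - ln (m s) * F s) _ s'.
  rewrite QsD (@Qs_pull _ _ K l2 (fun s => 1 + ln (A s) - ln (B s)));
    last exact: (indep_comp2 (fun a c => 1 + ln a - ln c) iA iB2).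
  rewrite (@Qs_pull _ _ K l2 (fun s => - (A s / B s)));
    last exact: (indep_comp2 (fun a c => - (a / c)) iA iB2).
  move=> H; apply: le_trans (H _) => {H}.
    rewrite -/A -/B mulNr divfK ?gt_eqF //; lra.
  move=> t; have := @mul_le_entropy R (F t) (ln (m t) + (ln (A t) - ln (B t))) (F0 t).
  rewrite expRD expRB !lnK ?posrE //.
  move: (A t / B t) => r; lra.
have := @Qs_le _ _ K K_gt0 l1 _ _ H s.
rewrite QsB (@Qs_pull _ _ K l1 (fun s => ln (B s))); last exact: (indep_comp (fun a => ln a)).
rewrite H12 QsB (@Qs_pull _ _ K l1 (fun s => ln (m s))); last exact: (indep_comp (fun a => ln a)).
rewrite BA /Ent -/A BA -/m.
rewrite [ln (B s) * _]mulrC => h; apply: le_trans h _.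
by apply: Qs_le => // s'; rewrite [ln (m s') * _]mulrC.
Qed.

(** Integrates [ln x <= x - 1] at [x = F / m]. *)
Lemma Ent_le_var l F s : topo l -> (forall s, 0 < F s) ->
  Ent l F s <= (Qs l (fun s => F s ^+ 2) s - Qs l F s ^+ 2) / Qs l F s.
Proof.
move=> tl F0; set m := Qs l F.
have m0 s' : 0 < m s' by exact: Qs_gt0.
have im : indep (mem l) m by exact: Qs_indep_self.
have := @Qs_le _ _ K K_gt0 l (fun s => F s * ln (F s) )
   (fun s => (m s)^-1 * (F s ^+ 2) + (ln (m s) - 1) * F s) _ s.
rewrite QsD (@Qs_pull _ _ K l (fun s => (m s)^-1));
  last exact: (indep_comp (fun a => a^-1)).
rewrite (@Qs_pull _ _ K l (fun s => ln (m s) - 1));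
  last exact: (indep_comp (fun a => ln a - 1)).
rewrite -/m.
move=> H; rewrite /Ent -/m.
rewrite mulrBl [m s ^+ 2]expr2 mulfK ?gt_eqF //.
apply: le_trans (lerB (H _) (lexx _)) _; last by rewrite [(m s)^-1 * _]mulrC; lra.
move=> t; have := @expR_ge1Dx R (ln (F t) - ln (m t)).
rewrite expRB !lnK ?posrE // => h.
have := F0 t; have -> : (m t)^-1 * F t ^+ 2 = F t * (F t / m t) by ring.
move: (F t / m t) h => q; nra.
Qed.

Definition level_sorted l := pairwise (fun v w => size v <= size w)%N l.

Lemma level_sorted_topo l : level_sorted l -> topo l.
Proof. by apply: sub_pairwise => v w h; apply/negP => /isparent_size; lia. Qed.

Lemma topo_filter P l : topo l -> topo (seq.filter P l).
Proof. by apply: subseq_pairwise; exact: filter_subseq. Qed.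

Lemma topo_cat l l' : topo l -> topo l' -> (forall v w, v \in l -> w \in l' -> ~~ isparent w v) ->
  topo (l ++ l').
Proof.
move=> tl tl' h; rewrite /topo pairwise_cat; apply/and3P; split => //.
by apply/allrelP => v w; exact: h.
Qed.

(** Chain rule and convexity. Peeling off the first vertex [v] leaves the entropy at [v] of
    [Qs l F]; the non-descendants [o] commute with [v], so their average moves outside the entropy.
    Inside, only an average over the descendants of [v] is left, and this locality is what the decay
    of information acts on. *)
Lemma Ent_desc l F s : uniq l -> level_sorted l -> (forall s, 0 < F s) ->
  Ent l F s <= \sum_(z <- l) Qs l (Ent [:: z] (Qs (seq.filter (desc z) l) F)) s.
Proof.
move=> ul sl F0; elim: l s ul sl => [|v l IH] s.
  by rewrite big_nil /Ent /= subrr.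
rewrite cons_uniq /level_sorted pairwise_cons => /andP[vl ul] /andP[/allP sv sl].
have tl := level_sorted_topo sl.
have vpl w : w \in l -> ~~ isparent w v.
  by move=> /sv h; apply/negP => /isparent_size; lia.
have -> : Ent (v :: l) F s = Q K v (Ent l F) s + Ent [:: v] (Qs l F) s.
  by rewrite -(cat1s v l) Ent_cat.
have tv : topo [:: v] by [].
set d := seq.filter (desc v) l; set o := seq.filter (predC (desc v)) l.
have td : topo d by exact: topo_filter.
have to : topo o by exact: topo_filter.
(* Drawing [o] before [d] is admissible since a child of a descendant of [v] is again a
   descendant. *)
have E1 : Qs l F = Qs o (Qs d F).
  rewrite -Qs_cat; apply: Qs_perm => //.
    by rewrite perm_sym perm_catC; apply/permPl; exact: perm_filterC.
  apply: topo_cat => // x y; rewrite !mem_filter => /andP[nx xl] /andP[/andP[dy1 dy2] yl].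
  apply/negP => xy; move/negP: nx; apply; apply/andP; split.
    exact: suffix_trans dy1 (isparent_suffix xy).
  by apply: contraNneq vl => <-.
have E2 G : Qs [:: v] (Qs o G) = Qs o (Qs [:: v] G).
  rewrite /= Qs_move //; first by rewrite mem_filter (negbTE vl) andbF.
  move=> w; rewrite mem_filter => /andP[nw wl]; split; first exact: vpl.
  apply/negP => vw; move/negP: nw; apply; apply/andP; split; first exact: isparent_suffix.
  by apply: contraNneq vl => <-.
have F0d s' : 0 < Qs d F s' by exact: Qs_gt0.
rewrite big_cons addrC; apply: lerD.
- rewrite E1 (_ : seq.filter (desc v) (v :: l) = d); last by rewrite /= /desc eqxx andbF.
  apply: le_trans (Ent_convex _ _ to E2 _) _ => //.
  suff -> : Qs (v :: l) (Ent [:: v] (Qs d F)) = Qs o (Ent [:: v] (Qs d F)) by [].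
  have ie : indep (mem (v :: d)) (Ent [:: v] (Qs d F)).
    have i1 : indep (fun w => (w \in d) || (w \in [:: v])) (Qs [:: v] (Qs d F)).
      apply: Qs_indep => //; first exact: Qs_indep_self.
      by move=> x y; rewrite inE => /eqP -> yv; apply: contraL yv; rewrite mem_filter => /andP[_]; exact: vpl.
    have i2 : indep (fun w => (w \in d) || (w \in [:: v])) (Qs [:: v] (fun s => Qs d F s * ln (Qs d F s))).
      apply: Qs_indep => //; first by apply: (indep_comp (fun a => a * ln a)); exact: Qs_indep_self.
      by move=> x y; rewrite inE => /eqP -> yv; apply: contraL yv; rewrite mem_filter => /andP[_]; exact: vpl.
    apply: (@indepW _ _ (fun w => (w \in d) || (w \in [:: v]))).
      by move=> w /=; rewrite !inE orbC.
    exact: (indep_comp2 (fun a c => a - c * ln c) i2 i1).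
  rewrite Qs_cons.
  have -> : Qs l (Ent [:: v] (Qs d F)) = Qs o (Qs d (Ent [:: v] (Qs d F))).
    rewrite -Qs_cat; apply: Qs_perm => //.
      by rewrite perm_sym perm_catC; apply/permPl; exact: perm_filterC.
    apply: topo_cat => // x y; rewrite !mem_filter => /andP[nx xl] /andP[/andP[dy1 dy2] yl].
    apply/negP => xy; move/negP: nx; apply; apply/andP; split.
      exact: suffix_trans dy1 (isparent_suffix xy).
    by apply: contraNneq vl => <-.
  rewrite (@Qs_indep_id _ _ K K_sum d); last by apply: indepW ie => w /= wd; rewrite inE wd orbT.
  rewrite -[Q K v _]/(Qs [:: v] _) E2 (@Qs_indep_id _ _ K K_sum [:: v]) //.
  by apply: indepW ie => w /=; rewrite !inE => ->.
- have -> : \sum_(z <- l) Qs (v :: l) (Ent [:: z] (Qs (seq.filter (desc z) (v :: l)) F)) s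
    = Q K v (fun s => \sum_(z <- l) Qs l (Ent [:: z] (Qs (seq.filter (desc z) l) F)) s) s.
    have E3 : Q K v (fun s => \sum_(z <- l) Qs l (Ent [:: z] (Qs (seq.filter (desc z) l) F)) s)
        = fun s => \sum_(z <- l) Q K v (Qs l (Ent [:: z] (Qs (seq.filter (desc z) l) F))) s.
      exact: (@Qs_sum _ _ K [:: v] _ l xpredT).
    rewrite E3.
    rewrite !big_seq; apply: eq_bigr => z zl.
    suff -> : seq.filter (desc z) (v :: l) = seq.filter (desc z) l by [].
    rewrite /=; case: ifP => // /andP[/suffixP[t def_v] nvz].
    have := sv _ zl; rewrite def_v size_cat; case: t def_v => [def_v|i t _ /=]; last by lia.
    by rewrite def_v eqxx in nvz.
  by apply: Q_le => // s'; exact: IH.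
Qed.

End Entropy.

(** * Effective fields *)

Section Fields.
Context (R : realType).
Implicit Types (u v w x beta : R).

Definition logis x : R := (1 + expR (- x))^-1.

Definition softplus x : R := ln (1 + expR x).

(** Effective fields are log-odds, hence the factors 2. The formula equals [ln (cosh (u / 2 + beta)
    / cosh (u / 2 - beta))], the log-odds that a child with field [u] sends to its parent. *)
Definition gfun beta u : R := softplus (u + 2 * beta) - softplus (u - 2 * beta) - 2 * beta.

(** Besides being the slope of [gfun], this is the change in the probability of a plus at a child
    with field [u] when its parent goes from minus to plus. *)
Definition kap beta u : R := logis (u + 2 * beta) - logis (u - 2 * beta).

Definition theta beta : R := (expR (2 * beta) - 1) / (expR (2 * beta) + 1).

Lemma logis_gt0 x : 0 < logis x.
Proof. by rewrite invr_gt0 addr_gt0 // expR_gt0. Qed.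

Lemma logisE x : logis x = expR x / (1 + expR x).
Proof.
rewrite /logis expRN; have := expR_gt0 x; move: (expR x) => e e0.
have n0 : e != 0 by rewrite gt_eqF.
have n1 : 1 + e != 0 by rewrite gt_eqF //; lra.
have n2 : e + 1 != 0 by rewrite gt_eqF //; lra.
by field; rewrite ?n0 ?n1 ?n2.
Qed.

Lemma logis_sum x : logis x + logis (- x) = 1.
Proof.
rewrite logisE /logis opprK; have := expR_gt0 x; move: (expR x) => e e0.
have n1 : 1 + e != 0 by rewrite gt_eqF //; lra.
by rewrite -[X in _ + X]mul1r -mulrDl addrC divff.
Qed.

Lemma logis_lt1 x : logis x < 1.
Proof. by rewrite -(logis_sum x) ltrDl logis_gt0. Qed.

Lemma logis_le x y : x <= y -> logis x <= logis y.
Proof.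
move=> xy; rewrite /logis lef_pV2 ?posrE ?addr_gt0 ?expR_gt0 // lerD2l ler_expR lerN2 //.
Qed.

Lemma is_derive_softplus x : is_derive x 1 softplus (logis x).
Proof.
have p : 0 < 1 + expR x by rewrite addr_gt0 ?expR_gt0.
have h : is_derive x 1 (cst 1 + expR : R -> R) (0 + expR x) by apply: is_deriveD.
have := @is_derive1_comp R (@ln R) (cst 1 + expR : R -> R) x _ _ (is_derive1_ln p) h.
by rewrite logisE add0r => k; apply: (is_derive_eq k); rewrite mulrC.
Qed.

Lemma is_derive_gfun beta u : is_derive u 1 (gfun beta) (kap beta u).
Proof.
have h c : is_derive u 1 (@softplus \o (fun x => x + c)) (logis (u + c)).
  have k : is_derive u 1 (id + cst c : R -> R) (1 + 0) by apply: is_deriveD.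
  have := @is_derive1_comp R (@softplus) (id + cst c : R -> R) u _ _ (is_derive_softplus (u + c)) k.
  by move=> k'; apply: (is_derive_eq k'); rewrite addr0 mulr1.
have h1 := h (2 * beta); have h2 := h (- (2 * beta)).
have := is_deriveB (is_deriveB h1 h2) (is_derive_cst (2 * beta) u 1).
by move=> k; apply: (is_derive_eq k); rewrite subr0.
Qed.

Lemma gfun_is_derive_MVT beta u v : u <= v ->
  exists2 c, u <= c <= v & gfun beta v - gfun beta u = kap beta c * (v - u).
Proof.
move=> uv.
have [|c cuv E] := @MVT_segment R (gfun beta) (kap beta) u v uv (fun x _ => is_derive_gfun beta x).
  apply: continuous_subspaceT => x; apply: differentiable_continuous.
  by apply/derivable1_diffP; exact: (@ex_derive _ _ _ _ _ _ _ (is_derive_gfun beta x)).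
by exists c => //; move: cuv; rewrite in_itv.
Qed.

Lemma kap_ge0 beta u : 0 <= beta -> 0 <= kap beta u.
Proof. by move=> b0; rewrite subr_ge0 logis_le //; lra. Qed.

(** With [X = expR u] and [B = expR (2 * beta)], and up to the factor [B - 1], the inequality is
    [B (X - 1)^2 >= 0]; equality holds at zero field. *)
Lemma kap_le_theta beta u : 0 <= beta -> kap beta u <= theta beta.
Proof.
move=> b0; rewrite /kap /theta !logisE expRD expRB.
have := expR_gt0 u; move: (expR u) => X X0.
have : 1 <= expR (2 * beta) by have := @expR_ge1Dx R (2 * beta); lra.
move: (expR (2 * beta)) => B B1.
have n1 : 0 < 1 + X * B by nra.
have n2 : 0 < B + X by nra.
have n3 : 0 < B + 1 by nra.
have -> : X * B / (1 + X * B) - X / B / (1 + X / B) = X * (B ^+ 2 - 1) / ((1 + X * B) * (B + X)).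
  have m1 : 1 + X * B != 0 by rewrite gt_eqF.
  have m2 : B + X != 0 by rewrite gt_eqF.
  have m3 : B != 0 by rewrite gt_eqF //; lra.
  by field; rewrite ?m1 ?m2 ?m3.
rewrite ler_pdivrMr ?mulr_gt0 // mulrAC ler_pdivlMr //.
have -> : X * (B ^+ 2 - 1) * (B + 1) = (B - 1) * (X * (B + 1) ^+ 2) by ring.
apply: ler_wpM2l; first lra.
by have := sqr_ge0 (X - 1); nra.
Qed.

Lemma theta_ge0 beta : 0 <= beta -> 0 <= theta beta.
Proof.
move=> b0; have : 1 <= expR (2 * beta) by have := @expR_ge1Dx R (2 * beta); lra.
by move=> h; apply: divr_ge0; lra.
Qed.

Lemma theta_lt1 beta : theta beta < 1.
Proof. by have := expR_gt0 (2 * beta) => h; rewrite ltr_pdivrMr; lra. Qed.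

Lemma gfun_le beta u v : 0 <= beta -> u <= v -> gfun beta u <= gfun beta v.
Proof.
move=> b0 uv; have [c _ E] := gfun_is_derive_MVT beta uv.
by rewrite -subr_ge0 E mulr_ge0 ?kap_ge0 // subr_ge0.
Qed.

Lemma gfun_lip_le beta u v : 0 <= beta -> u <= v -> gfun beta v - gfun beta u <= theta beta * (v - u).
Proof.
move=> b0 uv; have [c _ ->] := gfun_is_derive_MVT beta uv.
by rewrite ler_wpM2r ?subr_ge0 // kap_le_theta.
Qed.

Lemma gfun_lip beta u v : 0 <= beta -> `|gfun beta v - gfun beta u| <= theta beta * `|v - u|.
Proof.
move=> b0; wlog uv : u v / u <= v => [H|].
  by case: (leP u v) => [|/ltW] uv; [exact: H|rewrite distrC (distrC v u); exact: H].
by rewrite !ger0_norm ?subr_ge0 ?gfun_le // gfun_lip_le.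
Qed.

Lemma softplus_lip x y : x <= y -> softplus x <= softplus y <= softplus x + (y - x).
Proof.
move=> xy; have p z : 1 + expR z \is Num.pos by rewrite posrE addr_gt0 ?expR_gt0.
apply/andP; split; first by rewrite /softplus ler_ln ?p // lerD2l ler_expR.
rewrite -[y - x]expRK /softplus -lnM ?p ?posrE ?expR_gt0 //.
rewrite ler_ln ?p //; last by rewrite posrE mulr_gt0 ?expR_gt0 //; have := p x; rewrite posrE.
rewrite mulrDl mul1r -expRD (_ : x + (y - x) = y) ?lerD2r; last ring.
by have := @expR_ge1Dx R (y - x); lra.
Qed.

Lemma gfun_bound beta u : 0 <= beta -> `|gfun beta u| <= 2 * beta.
Proof.
move=> b0; have /andP[] : softplus (u - 2 * beta) <= softplus (u + 2 * beta)
    <= softplus (u - 2 * beta) + (u + 2 * beta - (u - 2 * beta)) by apply: softplus_lip; lra.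
by rewrite ler_norml /gfun => *; lra.
Qed.

(* Bayes' rule for the channel from a vertex to its parent. *)
Lemma gfun_bayes beta u w :
  expR (gfun beta (u + w) - gfun beta u) * (logis (u - 2 * beta) * expR w + logis (- (u - 2 * beta)))
  = logis (u + 2 * beta) * expR w + logis (- (u + 2 * beta)).
Proof.
have p z : 1 + expR z \is Num.pos by rewrite posrE addr_gt0 ?expR_gt0.
have -> : gfun beta (u + w) - gfun beta u = (softplus (u + 2 * beta + w) - softplus (u - 2 * beta + w))
   - (softplus (u + 2 * beta) - softplus (u - 2 * beta)).
  by rewrite /gfun [u + w + _]addrAC [u + w - _]addrAC; ring.
have E a c : expR (softplus a - softplus c) = (1 + expR a) / (1 + expR c).
  by rewrite /softplus expRB !lnK ?p.
have N z : logis (- z) = (1 + expR z)^-1 by rewrite /logis opprK.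
rewrite (expRB (softplus _ - _)) !E !N !logisE ![expR (_ + w)]expRD.
have := expR_gt0 (u + 2 * beta); have := expR_gt0 (u - 2 * beta).
move: (expR (u + 2 * beta)) (expR (u - 2 * beta)) (expR_gt0 w) => A B.
move: (expR w) => W W0 B0 A0.
have n1 : 1 + A != 0 by rewrite gt_eqF //; lra.
have n2 : 1 + B != 0 by rewrite gt_eqF //; lra.
have n3 : 1 + A * W != 0 by rewrite gt_eqF //; nra.
have n4 : 1 + B * W != 0 by rewrite gt_eqF //; nra.
by field; rewrite ?n1 ?n2 ?n3 ?n4.
Qed.

(** The limiting case of [gfun_bayes] in which the child itself is observed: its log-likelihood
    ratio is infinite, and [gfun (u + w)] becomes its limit [2 beta] or [- 2 beta]. *)
Lemma gfun_bayes_spin beta u (a : bool) :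
  logis ((if a then 1 else -1) * (u + 2 * beta)) =
  logis ((if a then 1 else -1) * (u - 2 * beta)) *
    expR (2 * beta * (if a then 1 else -1) - gfun beta u).
Proof.
have p z : 1 + expR z \is Num.pos by rewrite posrE addr_gt0 ?expR_gt0.
have E : expR (gfun beta u) = (1 + expR (u + 2 * beta)) / (1 + expR (u - 2 * beta)) / expR (2 * beta).
  by rewrite /gfun (expRB (softplus _ - _)) (expRB (softplus _)) /softplus !lnK ?p.
rewrite expRB E.
case: a; rewrite ?mul1r ?mulN1r ?mulr1 ?mulrN1 ?[expR (- (2 * beta))]expRN.
  rewrite !logisE expRB expRD.
  have := expR_gt0 u; have := expR_gt0 (2 * beta); move: (expR u) (expR (2 * beta)) => X B B0 X0.
  have n1 : 1 + X * B != 0 by rewrite gt_eqF //; nra.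
  have n2 : B + X != 0 by rewrite gt_eqF //; nra.
  have n3 : B != 0 by rewrite gt_eqF.
  by field; rewrite ?n1 ?n2 ?n3.
rewrite /logis !opprK expRB expRD.
have := expR_gt0 u; have := expR_gt0 (2 * beta); move: (expR u) (expR (2 * beta)) => X B B0 X0.
have n1 : 1 + X * B != 0 by rewrite gt_eqF //; nra.
have n2 : B + X != 0 by rewrite gt_eqF //; nra.
have n3 : B != 0 by rewrite gt_eqF.
by field; rewrite ?n1 ?n2 ?n3.
Qed.

End Fields.

(** * Conditional expectations over sets of vertices *)

Section TreeExpectation.
Context (R : realType) (b : nat) (K : vertex b -> bool -> bool -> R).
Hypothesis K_gt0 : forall v p a, 0 < K v p a.
Hypothesis K_sum : forall v p, K v p true + K v p false = 1.
Context (V : seq (vertex b)).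
Hypothesis V_uniq : uniq V.
Hypothesis V_sorted : level_sorted V.
Implicit Types (v w x y z : vertex b) (s : config b) (F G : config b -> R).
Implicit Types (l : seq (vertex b)) (P : pred (vertex b)).

Lemma Qs_upd l F s x a : x \notin l ->
  Qs K l F (upd s x a) = Qs K l (fun s => F (upd s x a)) (upd s x a).
Proof.
elim: l s => [|v l IH] s /=; first by rewrite upd_upd.
rewrite inE negb_or => /andP[xv xl].
by rewrite /Q ![upd (upd s x a) v _]upd_comm // !IH // eq_sym.
Qed.

Lemma Qs_indep_pred P l F : indep P F -> topo l ->
  (forall v w, v \in l -> isparent w v -> ~~ P w) -> indep P (Qs K l F).
Proof.
by move=> iF tl h; apply: indepW (Qs_indep K iF tl h) => v ->.
Qed.

(** Filtering one fixed sorted list gives every set of vertices an admissible order, so that orders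
    need not be tracked once [Ex_split] is available. *)
Definition Ex P F := Qs K (seq.filter P V) F.

Let V_topo : topo V := level_sorted_topo V_sorted.

Lemma topo_Ex P : topo (seq.filter P V).
Proof. exact: topo_filter. Qed.

Lemma eq_Ex P P' F : {in V, P =1 P'} -> Ex P F = Ex P' F.
Proof. by move=> h; rewrite /Ex (eq_in_filter h). Qed.

(** [P1] is drawn first and [P2] given [P1]; the only obstruction would be a vertex of [P1] whose
    parent lies in [P2]. *)
Lemma Ex_split P P1 P2 F :
  {in V, forall v, P v = P1 v || P2 v} -> {in V, forall v, P1 v -> P2 v -> False} ->
  {in V &, forall v w, P1 v -> isparent w v -> ~~ P2 w} ->
  Ex P F = Ex P1 (Ex P2 F).
Proof.
move=> h0 h1 h2; rewrite /Ex -Qs_cat; apply: Qs_perm.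
- apply: uniq_perm; first exact: filter_uniq.
    rewrite cat_uniq !filter_uniq // andbT /=; apply/hasPn => v; rewrite !mem_filter.
    by move=> /andP[p2 vV]; apply/negP => /andP[p1 _]; exact: (h1 v).
  move=> v; rewrite mem_cat !mem_filter -andb_orl.
  by case vV: (v \in V); rewrite ?andbT ?andbF // h0.
- exact: filter_uniq.
- exact: topo_filter.
- apply: topo_cat; [exact: topo_filter|exact: topo_filter|].
  move=> v w; rewrite !mem_filter => /andP[p1 vV] /andP[p2 wV].
  by apply/negP => /(h2 _ _ vV wV p1); rewrite p2.
Qed.

Lemma Ex_le P F G : (forall s, F s <= G s) -> forall s, Ex P F s <= Ex P G s.
Proof. exact: Qs_le. Qed.

Lemma Ex_gt0 P F : (forall s, 0 < F s) -> forall s, 0 < Ex P F s.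
Proof. exact: Qs_gt0. Qed.

Lemma Ex_ge0 P F : (forall s, 0 <= F s) -> forall s, 0 <= Ex P F s.
Proof. exact: Qs_ge0. Qed.

Lemma mem_filter_sub P v : v \in seq.filter P V -> P v.
Proof. by rewrite mem_filter => /andP[]. Qed.

Lemma Ex_pull P (c F : config b -> R) : indep P c ->
  Ex P (fun s => c s * F s) = fun s => c s * Ex P F s.
Proof. by move=> ic; apply: Qs_pull; apply: indepW ic => v /mem_filter_sub. Qed.

Lemma Ex_indep_id P F : indep P F -> Ex P F = F.
Proof. by move=> ic; apply: Qs_indep_id => //; apply: indepW ic => v /mem_filter_sub. Qed.

Lemma Ex_indep_self P P' F : (forall v, P' v -> P v && (v \in V)) -> indep P' (Ex P F).
Proof.
move=> h; have := @Qs_indep_self _ _ K _ F (topo_Ex P).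
by apply: indepW => v /h h1 /=; rewrite mem_filter.
Qed.

Lemma Ex_indep P P' F : indep P' F -> {in V, forall v w, P v -> isparent w v -> ~~ P' w} ->
  indep P' (Ex P F).
Proof.
move=> iF h; apply: Qs_indep_pred => //; first exact: topo_Ex.
by move=> v w; rewrite mem_filter => /andP[pv vV]; exact: h.
Qed.

Lemma Ex_upd P F s x a : ~~ P x || (x \notin V) ->
  Ex P F (upd s x a) = Ex P (fun s => F (upd s x a)) (upd s x a).
Proof. by move=> nx; apply: Qs_upd; rewrite mem_filter negb_and. Qed.

Lemma ExD P F G : Ex P (fun s => F s + G s) = fun s => Ex P F s + Ex P G s.
Proof. exact: QsD. Qed.

Lemma ExB P F G : Ex P (fun s => F s - G s) = fun s => Ex P F s - Ex P G s.
Proof. exact: QsB. Qed.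

Lemma ExZ P (k : R) F : Ex P (fun s => k * F s) = fun s => k * Ex P F s.
Proof. exact: QsZ. Qed.

Lemma ExZ_at P (k : R) F s : k * Ex P F s = Ex P (fun s => k * F s) s.
Proof. by rewrite ExZ. Qed.

Lemma ExD_at P F G s : Ex P F s + Ex P G s = Ex P (fun s => F s + G s) s.
Proof. by rewrite ExD. Qed.

Lemma Ex_cst P (k : R) : Ex P (fun=> k) = fun=> k.
Proof. exact: Qs_cst. Qed.

Lemma Ex_sum P (I : Type) (rr : seq I) (D : pred I) (F : I -> config b -> R) :
  Ex P (fun s => \sum_(i <- rr | D i) F i s) = fun s => \sum_(i <- rr | D i) Ex P (F i) s.
Proof. exact: Qs_sum. Qed.

Lemma Ex_suffix x F : x \in V -> Ex (suffix x) F = Q K x (Ex (desc x) F).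
Proof.
move=> xV; rewrite (@Ex_split _ (pred1 x) (desc x)).
- by rewrite {1}/Ex filter_pred1_uniq.
- move=> v vV; rewrite /desc /=; case: eqVneq => [->|_] /=; first by rewrite suffix_refl.
  by rewrite andbT.
- by move=> v vV /= /eqP ->; rewrite /desc eqxx andbF.
- by move=> v w _ _ /= /eqP -> /isparent_size h; apply/negP => /andP[/suffix_size]; lia.
Qed.

(** No edge joins two sibling subtrees, so they can be integrated one after the other. *)
Lemma Ex_children x F (is_ : seq 'I_b) : uniq is_ ->
  Ex (fun v => has (fun i => suffix (i :: x) v) is_) F
  = foldr (fun i G => Ex (suffix (i :: x)) G) F is_.
Proof.
elim: is_ => [|i l IH] /=.
  move=> _; apply: Ex_indep_id => s s' ss; congr F; apply/funext => v; exact: ss.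
move=> /andP[il ul]; rewrite -IH //; apply: Ex_split => //.
- move=> v _ iv /hasP[j jl jv]; move/negP: il; apply.
  by rewrite (child_suffix_inj iv jv).
- move=> v w _ _ iv wv; apply/hasPn => j jl; apply/negP => jw.
  move/negP: il; apply; rewrite (@child_suffix_inj _ x v i j) //.
  exact: suffix_trans jw (isparent_suffix wv).
Qed.

Lemma Ex_desc x F : Ex (desc x) F = foldr (fun i G => Ex (suffix (i :: x)) G) F (enum 'I_b).
Proof.
rewrite -Ex_children ?enum_uniq //; apply: eq_Ex => v vV; apply/idP/hasP.
  by move=> /child_suffix[i iv]; exists i => //; rewrite mem_enum.
by move=> [i _ /desc_child].
Qed.

Lemma Ex_desc_single x i F : indep (fun v => desc x v && ~~ suffix (i :: x) v) F ->
  Ex (desc x) F = Ex (suffix (i :: x)) F.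
Proof.
move=> iF; rewrite (@Ex_split _ (suffix (i :: x)) (fun v => desc x v && ~~ suffix (i :: x) v)).
- by rewrite (Ex_indep_id iF).
- move=> v _; case iv : (suffix _ v); rewrite ?andbT //; exact: desc_child iv.
- by move=> v _ -> /=; rewrite andbF.
- move=> v w _ _ iv wv; rewrite negb_and negbK.
  case: (eqVneq v (i :: x)) iv wv => [->|vn] iv wv.
    by move: wv => /= /eqP ->; rewrite /desc eqxx andbF.
  by rewrite (suffix_isparent iv vn wv) orbT.
Qed.

(** Conditional independence of the child subtrees given [x], in the one-sided form that moment
    generating functions require. *)
Lemma Ex_desc_prod_le x (k : 'I_b -> config b -> R) (C : R) :
  (forall i, indep (fun v => ~~ suffix (i :: x) v) (k i)) ->
  (forall i s, 0 <= k i s) -> (forall i s, Ex (suffix (i :: x)) (k i) s <= C) ->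
  forall s, Ex (desc x) (fun s => \prod_i k i s) s <= C ^+ b.
Proof.
move=> ik k0 kC s; rewrite Ex_desc.
suff H (l : seq 'I_b) : uniq l -> forall s,
    foldr (fun i G => Ex (suffix (i :: x)) G) (fun s => \prod_(i <- l) k i s) l s <= C ^+ size l.
  have := H (enum 'I_b) (enum_uniq _) s; rewrite size_enum_ord; apply: le_trans.
  rewrite le_eqVlt; apply/orP; left; apply/eqP; congr (foldr _ _ _ _).
  by apply/funext => t; rewrite big_enum.
(* The sign of [C] is known only through the bound at some child, so the absence of children is
   treated apart. *)
case: (pselect (exists i : 'I_b, True)) => [[i0 _]|ni]; last first.
  by case: l => [|i l]; [rewrite /= => _ t; rewrite big_nil expr0|case: ni; exists i].
have C0 : 0 <= C by apply: le_trans (kC i0 s); exact: Ex_ge0.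
elim: l => [_ t|i l IH /= /andP[il ul] t]; first by rewrite /= big_nil expr0.
have E : foldr (fun i G => Ex (suffix (i :: x)) G) (fun s => \prod_(j <- i :: l) k j s) l
   = fun s => k i s * foldr (fun i G => Ex (suffix (i :: x)) G) (fun s => \prod_(j <- l) k j s) l s.
  rewrite -!Ex_children // -Ex_pull.
    by congr Ex; apply/funext => ?; rewrite big_cons.
  apply: indepW (ik i) => v /hasP[j jl jv]; apply/negP => iv.
  by move/negP: il; apply; rewrite (child_suffix_inj iv jv).
rewrite E; apply: (@le_trans _ _ (Ex (suffix (i :: x)) (fun s => C ^+ size l * k i s) t)).
  by apply: Ex_le => t'; rewrite mulrC ler_wpM2r ?IH.
by rewrite ExZ exprSr ler_wpM2l ?exprn_ge0.
Qed.

End TreeExpectation.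

(** * Decay of information along the tree *)

Section LikelihoodRatio.
Context (R : realType) (b : nat) (K : vertex b -> bool -> bool -> R).
Hypothesis K_gt0 : forall v p a, 0 < K v p a.
Hypothesis K_sum : forall v p, K v p true + K v p false = 1.
Context (V : seq (vertex b)).
Hypothesis V_uniq : uniq V.
Hypothesis V_sorted : level_sorted V.
Context (r : vertex b) (m : nat).
Hypothesis V_mem : forall v, (v \in V) = suffix r v && (size v <= size r + m)%N.
Context (beta : R) (u : vertex b -> R).
Hypothesis beta_ge0 : 0 <= beta.
Hypothesis K_true : forall v p, v != r -> v \in V -> K v p true = logis (u v + 2 * beta * spin R p).
Implicit Types (v w x y z : vertex b) (s : config b) (F G : config b -> R).
Implicit Types (P : pred (vertex b)).

Local Notation Ex := (Ex K V).

(* [wlik l x] is the log-likelihood ratio of the spin at x given the spins at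
   depth l.+1 below x; [Glik l z] is the contribution of the child z. *)
Fixpoint Glik (l : nat) z s : R :=
  if l is l'.+1 then gfun beta (u z + \sum_(i < b) Glik l' (i :: z) s) - gfun beta (u z)
  else 2 * beta * spin R (s z) - gfun beta (u z).

Definition wlik l x s := \sum_(i < b) Glik l (i :: x) s.

Lemma GlikS l z s : Glik l.+1 z s = gfun beta (u z + wlik l z s) - gfun beta (u z).
Proof. by []. Qed.

Lemma Glik_indep l z : indep (fun v => ~~ (suffix z v && (size v == size z + l)%N)) (Glik l z).
Proof.
elim: l z => [|l IH] z s s' ss /=.
  by rewrite ss // negbK suffix_refl addn0 eqxx.
congr (gfun _ (_ + _) - _); apply: eq_bigr => i _; apply: IH => v; rewrite negbK => /andP[iv /eqP sv].
apply: ss; rewrite negbK; apply/andP; split; first by apply: suffix_trans iv; exact: suffix_cons.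
by rewrite sv /= addSnnS.
Qed.

Lemma wlik_indep l x : indep (fun v => ~~ (desc x v && (size v == size x + l.+1)%N)) (wlik l x).
Proof.
move=> s s' ss; apply: eq_bigr => i _; apply: Glik_indep => v; rewrite negbK => /andP[iv /eqP sv].
by apply: ss; rewrite negbK (desc_child iv) sv /= addSnnS.
Qed.

Lemma Glik_bound l z s : `|Glik l z s| <= 4 * beta.
Proof.
have b0 := beta_ge0; have k := gfun_bound (u z) beta_ge0.
case: l => [|l] /=.
  apply: le_trans (ler_normB _ _) _.
  suff : `|2 * beta * spin R (s z)| <= 2 * beta by lra.
  rewrite /spin; case: (s z) => /=; rewrite ?mulr1 ?mulrN1 ?normrN ger0_norm //; lra.
apply: le_trans (ler_normB _ _) _.
by have := gfun_bound (u z + \sum_(i < b) Glik l (i :: z) s) beta_ge0; lra.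
Qed.

Definition Mb : R := 4 * beta * b%:R.

Lemma Mb_ge0 : 0 <= Mb. Proof. by rewrite !mulr_ge0. Qed.

Lemma wlik_bound l x s : `|wlik l x s| <= Mb.
Proof.
apply: le_trans (ler_norm_sum _ _ _) _.
apply: (@le_trans _ _ (\sum_(i < b) 4 * beta)); first by apply: ler_sum => i _; exact: Glik_bound.
by rewrite sumr_const card_ord /Mb mulr_natr.
Qed.

(** The top [l] levels of the subtree of [x], with [x] included. A function independent of it may
    read spins outside the subtree and at depth at least [l] below [x]. *)
Definition block x l : pred (vertex b) := fun v => suffix x v && (size v < size x + l)%N.

Lemma V_child i x : x \in V -> (i :: x \in V) = (size x < size r + m)%N.
Proof.
rewrite !V_mem => /andP[rx _]; rewrite (suffix_trans rx) ?suffix_cons //=.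
Qed.

Lemma child_neq_r i x : x \in V -> i :: x != r.
Proof using V_mem.
by rewrite V_mem => /andP[h _]; apply/eqP => E; move: h; rewrite -E (negbTE (suffix_consN _ _)).
Qed.

Lemma K_false v p : v != r -> v \in V -> K v p false = logis (- (u v + 2 * beta * spin R p)).
Proof.
move=> vr vV; have := K_sum v p; have := logis_sum (u v + 2 * beta * spin R p).
by rewrite K_true //; lra.
Qed.

Lemma Ex_child_upd F x i s a : x \in V -> i :: x \in V -> indep (pred1 x) F ->
  Ex (suffix (i :: x)) F (upd s x a) =
  K (i :: x) a true * Ex (desc (i :: x)) F (upd s (i :: x) true) +
  K (i :: x) a false * Ex (desc (i :: x)) F (upd s (i :: x) false).
Proof using V_uniq V_sorted.
move=> xV zV iF; rewrite Ex_suffix // /Q /= upd_same.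
have xz := neq_cons x i.
have iE : indep (pred1 x) (Ex (desc (i :: x)) F).
  apply: Ex_indep => // v _ w dv wv; apply/negP => /eqP wx; have h := isparent_size wv.
  case/andP: dv => /suffix_eq_size h1 /eqP; apply.
  by apply: h1; rewrite h wx.
by rewrite (upd_comm s a true xz) (upd_comm s a false xz) !(@indep_upd _ _ _ _ _ x _ iE) /= ?eqxx.
Qed.

Lemma K_spin v p a : v != r -> v \in V ->
  K v p a = logis (spin R a * (u v + 2 * beta * spin R p)).
Proof. by move=> vr vV; case: a; rewrite ?K_true ?K_false // /spin ?mul1r ?mulN1r. Qed.

Lemma x_notin_child x i : ~~ suffix (i :: x) x || (x \notin V).
Proof using. by rewrite suffix_consN. Qed.

Lemma indep_upd_comp P F x a : indep P F -> indep P (fun s => F (upd s x a)).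
Proof. by move=> iF s s' ss; apply: iF => v nv; rewrite /upd; case: eqP => // _; exact: ss. Qed.

Lemma indep_upd_self F x a : indep (pred1 x) (fun s => F (upd s x a)).
Proof.
move=> s s' ss; congr F; apply/funext => v; rewrite /upd; case: eqP => // /eqP nv; exact: ss.
Qed.

Lemma Glik_upd l i x s a : Glik l (i :: x) (upd s x a) = Glik l (i :: x) s.
Proof using.
apply: (indep_upd (P := fun v => ~~ (suffix (i :: x) v && (size v == size (i :: x) + l)%N))).
  exact: Glik_indep.
by rewrite (negbTE (suffix_consN _ _)).
Qed.

(** The statement for a single child is kept as a hypothesis because [lik_child] is proved by
    induction on [l], calling this lemma one generation further down. The children are treated one
    at a time; the factor of a treated child ignores the other subtrees and leaves their
    expectations. *)
Lemma lik_desc l x : x \in V ->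
  (forall i (c : config b -> R) s, indep (block (i :: x) l) c -> indep (pred1 x) c ->
    Ex (suffix (i :: x)) c (upd s x true) =
    Ex (suffix (i :: x)) (fun s => expR (Glik l (i :: x) s) * c s) (upd s x false)) ->
  forall (c : config b -> R) s, indep (block x l.+1) c ->
    Ex (desc x) c (upd s x true) = Ex (desc x) (fun s => expR (wlik l x s) * c s) (upd s x false).
Proof.
move=> xV HI c s ic; rewrite !Ex_desc //.
have -> : (fun s => expR (wlik l x s) * c s)
  = (fun s => expR (\sum_(i <- enum 'I_b) Glik l (i :: x) s) * c s).
  by apply/funext => t; rewrite big_enum.
elim: (enum 'I_b) (enum_uniq 'I_b) s => [_ s|i il IH].
  rewrite /= big_nil expR0 mul1r (@indep_upd _ _ _ _ _ x _ ic) ?(@indep_upd _ _ _ _ _ x _ ic) //;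
  by rewrite /block suffix_refl; lia.
rewrite cons_uniq => /andP[ni ul] s /=.
set E := foldr _ _ _ in IH *.
have EE F : foldr (fun i G => Ex (suffix (i :: x)) G) F il = Ex (fun v => has (fun i => suffix (i :: x) v) il) F.
  by rewrite Ex_children.
rewrite Ex_upd ?x_notin_child // HI; first last.
- exact: indep_upd_self.
- apply: indep_upd_comp; rewrite /E EE; apply: Ex_indep => //.
    apply: indepW ic => v /andP[iv sv]; apply/andP; split; last by move: sv => /=; lia.
    by apply: suffix_trans iv; exact: suffix_cons.
  move=> v _ w /hasP[j jl jv] wv; apply/negP => /andP[iw sw].
  move/negP: ni; apply; rewrite (@child_suffix_inj _ x v i j) //.
  exact: suffix_trans iw (isparent_suffix wv).
rewrite [RHS]Ex_upd ?x_notin_child //.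
congr (Ex _ _ _); apply/funext => t; rewrite IH //.
have -> : (fun s => expR (\sum_(j <- i :: il) Glik l (j :: x) s) * c s)
  = fun s => expR (Glik l (i :: x) s) * (expR (\sum_(j <- il) Glik l (j :: x) s) * c s).
  by apply/funext => t'; rewrite big_cons expRD mulrA.
rewrite !EE [in RHS]Ex_pull; first by rewrite Glik_upd.
apply: (indep_comp (@expR R)); apply: indepW (Glik_indep (l := l) (z := i :: x)) => v /hasP[j jl jv].
apply/negP => /andP[iv _]; move/negP: ni; apply.
by rewrite (@child_suffix_inj _ x v i j).
Qed.

(** Induction on the depth of the observed level. At depth 0 the child itself is observed and
    [gfun_bayes_spin] applies; in the step the child is summed out, and [gfun_bayes] converts its
    own ratio [wlik l] into its contribution to the parent. *)
Lemma lik_child l x i (c : config b -> R) s : x \in V -> (size x + l.+1 <= size r + m)%N ->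
  indep (block (i :: x) l) c -> indep (pred1 x) c ->
  Ex (suffix (i :: x)) c (upd s x true) =
  Ex (suffix (i :: x)) (fun s => expR (Glik l (i :: x) s) * c s) (upd s x false).
Proof.
elim: l x i c s => [|l IH] x i c s xV hx ic ix.
  have zV : i :: x \in V by rewrite V_child //; lia.
  have zr := child_neq_r i xV.
  have iG : indep (pred1 x) (fun s => expR (Glik 0 (i :: x) s) * c s).
    move=> t t' tt; rewrite (ix _ _ tt) /= tt //; apply/eqP => /(congr1 size) /=; lia.
  rewrite !Ex_child_upd //.
  have -> : Ex (desc (i :: x)) (fun s => expR (Glik 0 (i :: x) s) * c s)
    = fun s => expR (Glik 0 (i :: x) s) * Ex (desc (i :: x)) c s.
    apply: Ex_pull; apply: (indep_comp (@expR R)) => t t' tt /=.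
    by rewrite tt // /desc eqxx andbF.
  rewrite /= !upd_same !mulrA !K_spin //.
  have Ea a : logis (spin R a * (u (i :: x) + 2 * beta * spin R true)) =
     logis (spin R a * (u (i :: x) + 2 * beta * spin R false)) *
       expR (2 * beta * spin R a - gfun beta (u (i :: x))).
    by rewrite /spin mulr1 mulrN1; exact: gfun_bayes_spin.
  by rewrite !Ea.
have zV : i :: x \in V by rewrite V_child //; lia.
have zr := child_neq_r i xV.
have J := lik_desc zV (fun j d t => IH (i :: x) j d t zV _).
have {}J (d : config b -> R) t : indep (block (i :: x) l.+1) d ->
    Ex (desc (i :: x)) d (upd t (i :: x) true) =
    Ex (desc (i :: x)) (fun s => expR (wlik l (i :: x) s) * d s) (upd t (i :: x) false).
  by apply: J => *; move: hx => /=; lia.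
have iG P : (forall v, P v -> ~~ (suffix (i :: x) v && (size v == size (i :: x) + l.+1)%N)) ->
    indep P c -> indep P (fun s => expR (Glik l.+1 (i :: x) s) * c s).
  move=> hP iPc; apply: (indep_comp2 (fun a d => expR a * d)) iPc.
  exact: indepW hP (@Glik_indep l.+1 (i :: x)).
rewrite !Ex_child_upd //; last first.
  by apply: iG => // v /eqP ->; apply/negP => /andP[/suffix_size /=]; lia.
rewrite !J //; last first.
  by apply: iG => // v /andP[_ h]; apply/negP => /andP[_ /eqP]; move: h; lia.
rewrite !ExZ_at !ExD_at.
congr (Ex _ _ _); apply/funext => t.
have := gfun_bayes beta (u (i :: x)) (wlik l (i :: x) t).
rewrite GlikS !K_true // !K_false // /spin !mulr1 !mulrN1.
move: (expR (gfun _ _ - _)) => A h.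
transitivity ((logis (u (i :: x) + 2 * beta) * expR (wlik l (i :: x) t) + logis (- (u (i :: x) + 2 * beta))) * c t); first ring.
by rewrite -h; ring.
Qed.

(** Change of measure: [expR (wlik l x)] is the density of the law of the spins from depth [l.+1]
    on, given a plus at [x], with respect to their law given a minus. Deeper spins depend on [x]
    only through those at depth [l.+1], so they do not enter the density. *)
Lemma lik_ratio l x (c : config b -> R) s : x \in V -> (size x + l.+1 <= size r + m)%N ->
  indep (block x l.+1) c ->
  Ex (desc x) c (upd s x true) = Ex (desc x) (fun s => expR (wlik l x s) * c s) (upd s x false).
Proof. by move=> xV hx; apply: lik_desc => // i d t; exact: lik_child. Qed.

End LikelihoodRatio.

Section Decay.
Context (R : realType) (b : nat) (K : vertex b -> bool -> bool -> R).
Hypothesis K_gt0 : forall v p a, 0 < K v p a.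
Hypothesis K_sum : forall v p, K v p true + K v p false = 1.
Context (V : seq (vertex b)).
Hypothesis V_uniq : uniq V.
Hypothesis V_sorted : level_sorted V.
Context (r : vertex b) (m : nat).
Hypothesis V_mem : forall v, (v \in V) = suffix r v && (size v <= size r + m)%N.
Context (beta : R) (u : vertex b -> R).
Hypothesis beta_ge0 : 0 <= beta.
Hypothesis K_true : forall v p, v != r -> v \in V -> K v p true = logis (u v + 2 * beta * spin R p).
Context (rho : R) (k0 : nat).
Hypothesis rho_ge0 : 0 <= rho.
Hypothesis k0_gt0 : (0 < k0)%N.
Hypothesis contracting : forall v, v \in V -> (size v + k0 <= size r + m)%N ->
  b%:R * theta beta * kap beta (u v) <= rho.
Implicit Types (v w x y z : vertex b) (s : config b) (F G : config b -> R).
Implicit Types (P : pred (vertex b)).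

Local Notation Ex := (Ex K V).
Local Notation wlik := (wlik beta u).
Local Notation Glik := (Glik beta u).
Local Notation M := (Mb b beta).

Let wlik_lik_ratio := lik_ratio K_sum V_uniq V_sorted V_mem beta_ge0 K_true.

Lemma wlik_indep_block l x : indep (block x l.+1) (wlik l x).
Proof.
apply: indepW (@wlik_indep _ _ beta u l x) => v /andP[_ h]; apply/negP => /andP[_ /eqP E].
by move: h; rewrite E ltnn.
Qed.

Lemma wlik_comp_indep_block l x (k : R -> R) : indep (block x l.+1) (fun s => k (wlik l x s)).
Proof. exact: (indep_comp k (@wlik_indep_block l x)). Qed.

Lemma lik_ratio_comp l x (k : R -> R) s : x \in V -> (size x + l.+1 <= size r + m)%N ->
  Ex (desc x) (fun s => k (wlik l x s)) (upd s x true) =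
  Ex (desc x) (fun s => expR (wlik l x s) * k (wlik l x s)) (upd s x false).
Proof. by move=> xV hx; apply: wlik_lik_ratio => //; exact: wlik_comp_indep_block. Qed.

Lemma expR_wlik_mean l x s : x \in V -> (size x + l.+1 <= size r + m)%N ->
  Ex (desc x) (fun s => expR (wlik l x s)) (upd s x false) = 1.
Proof.
move=> xV hx; have := @lik_ratio_comp l x (fun=> 1) s xV hx.
rewrite Ex_cst // => ->; congr (Ex _ _ _); apply/funext => t; by rewrite mulr1.
Qed.

(** After the change of measure the difference of the two means is the mean of
    [(expR w - 1) * (k w - k 0)], whose factors have the same sign. *)
Lemma wlik_mono l x (k : R -> R) s : x \in V -> (size x + l.+1 <= size r + m)%N ->
  (forall a c, a <= c -> k a <= k c) ->
  Ex (desc x) (fun s => k (wlik l x s)) (upd s x false) <=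
  Ex (desc x) (fun s => k (wlik l x s)) (upd s x true).
Proof.
move=> xV hx km; rewrite lik_ratio_comp //.
have := @Ex_ge0 _ _ K K_gt0 K_sum V (desc x)
  (fun s => expR (wlik l x s) * k (wlik l x s) - k (wlik l x s) - k 0 * (expR (wlik l x s) - 1)) _ (upd s x false).
rewrite !ExB ExZ ExB Ex_cst // expR_wlik_mean // subrr mulr0 subr0 subr_ge0; apply => t.
have -> : forall e w : R, e * w - w - k 0 * (e - 1) = (e - 1) * (w - k 0) by move=> *; ring.
move: (wlik l x t) => w; case: (leP 0 w) => w0.
  by rewrite mulr_ge0 ?subr_ge0 ?km // -expR0 ler_expR.
by rewrite mulr_le0 ?subr_le0 ?km ?ltW // -?expR0 ?ltr_expR.
Qed.

Lemma Ex_desc_wlik l x : Ex (desc x) (wlik l x) = fun s => \sum_(i < b) Ex (suffix (i :: x)) (Glik l (i :: x)) s.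
Proof.
rewrite Ex_sum; apply/funext => s; apply: eq_bigr => i _; rewrite (@Ex_desc_single _ _ _ K_sum _ V_uniq V_sorted x i) //.
apply: indepW (@Glik_indep _ _ beta u l (i :: x)) => v /andP[_ ni]; apply/negP => /andP[iv _].
by rewrite iv in ni.
Qed.

Lemma Glik_indep_parent l i x : indep (pred1 x) (Glik l (i :: x)).
Proof.
apply: indepW (@Glik_indep _ _ beta u l (i :: x)) => v /= /eqP ->; by rewrite (negbTE (suffix_consN _ _)).
Qed.

(** The left side is a symmetrised relative entropy. From a child to its parent it gains the factor
    [kap], as this is how much the law of the child moves when the parent flips, and the factor
    [theta], the slope bound of [gfun]; summing over [b] children gives [rho] per generation. *)
Lemma wlik_diff l x s : x \in V -> (size x + l + k0 <= size r + m)%N ->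
  Ex (desc x) (wlik l x) (upd s x true) - Ex (desc x) (wlik l x) (upd s x false) <= rho ^+ l * M.
Proof.
have b0 := beta_ge0; have r0 := rho_ge0; have th0 := theta_ge0 beta_ge0; have th1 := theta_lt1 beta.
elim: l x s => [|l IH] x s xV hx; rewrite Ex_desc_wlik -sumrB.
  apply: (@le_trans _ _ (\sum_(i < b) 4 * beta)); last first.
    by rewrite sumr_const card_ord expr0 mul1r /Mb mulr_natr.
  apply: ler_sum => i _.
  have zV : i :: x \in V by rewrite (V_child V_mem) //; lia.
  have zr := child_neq_r V_mem i xV.
  rewrite !(Ex_child_upd K V_uniq V_sorted) //; try exact: Glik_indep_parent.
  rewrite Ex_indep_id //; last by move=> t t' tt /=; rewrite tt // /desc eqxx andbF.
  rewrite /= !upd_same !(K_true _ zr) // !(K_false K_sum K_true) //.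
  have k1 := kap_le_theta (u (i :: x)) b0; have k2 := kap_ge0 (u (i :: x)) b0.
  have E1 := logis_sum (u (i :: x) + 2 * beta); have E2 := logis_sum (u (i :: x) - 2 * beta).
  move: k1 k2; rewrite /kap /spin mulr1 mulrN1.
  move: (logis _) (logis _) (logis _) (logis _) E1 E2 => p1 p2 p3 p4 E1 E2 k1 k2.
  have -> : p2 = 1 - p1 by lra.
  have -> : p4 = 1 - p3 by lra.
  have : (p1 - p3) * (4 * beta) <= 1 * (4 * beta) by apply: ler_wpM2r; lra.
  move: (gfun _ _) => g; nra.
case: (posnP b) => [bz|b_gt0].
  apply: (@le_trans _ _ (\sum_(i < b) 0)).
    by apply: ler_sum => -[i ib] _; exfalso; lia.
  by rewrite big1 // mulr_ge0 ?exprn_ge0 ?Mb_ge0.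
have bR : (0 : R) < b%:R by rewrite ltr0n.
apply: (@le_trans _ _ (\sum_(i < b) (rho / b%:R) * (rho ^+ l * M))); last first.
  by rewrite sumr_const card_ord -[_ *+ b]mulr_natr exprS le_eqVlt; apply/orP; left; apply/eqP; field; rewrite gt_eqF.
apply: ler_sum => i _.
have zV : i :: x \in V by rewrite (V_child V_mem) //; lia.
have zr := child_neq_r V_mem i xV.
rewrite !(Ex_child_upd K V_uniq V_sorted) //; try exact: Glik_indep_parent.
set z := i :: x.
have hz : (size z + l + k0 <= size r + m)%N by move: hx => /=; lia.
have hz1 : (size z + l.+1 <= size r + m)%N by lia.
have := IH z s zV hz.
(* The means are taken under two different laws, so the Lipschitz bound cannot be used pointwise.
   Instead [theta w - gfun (u + w)] is nondecreasing in [w], and [wlik_mono] compares its two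
   means. *)
have := @wlik_mono l z (fun w : R => theta beta * w - gfun beta (u z + w)) s zV hz1 _.
have := @wlik_mono l z (fun w : R => gfun beta (u z + w)) s zV hz1 _.
have EG : Ex (desc z) (Glik l.+1 z) = fun s => Ex (desc z) (fun s => gfun beta (u z + wlik l z s)) s - gfun beta (u z).
  have := ExB K V (desc z) (fun s => gfun beta (u z + wlik l z s)) (fun=> gfun beta (u z)).
  by rewrite Ex_cst.
rewrite EG (ExB K V (desc z) (fun s => theta beta * wlik l z s)) ExZ.
rewrite !(K_true _ zr) // !(K_false K_sum K_true) //.
have : kap beta (u z) * theta beta <= rho / b%:R.
  by rewrite ler_pdivlMr //; have := contracting zV; rewrite mulrC mulrA mulrAC; apply; move: hx => /=; lia.
have k2 := kap_ge0 (u z) b0.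
have E1 := logis_sum (u z + 2 * beta); have E2 := logis_sum (u z - 2 * beta).
move: k2; rewrite /kap /spin mulr1 mulrN1.
move: (logis _) (logis _) (logis _) (logis _) E1 E2 => p1 p2 p3 p4 E1 E2 k2 kt.
have -> : p2 = 1 - p1 by lra.
have -> : p4 = 1 - p3 by lra.
move: (Ex _ _ _) (Ex _ _ _) (Ex _ _ _) (Ex _ _ _) => wT wF gT gF h1 h2 h3.
have : 0 <= rho ^+ l * M by rewrite mulr_ge0 ?exprn_ge0 ?Mb_ge0.
move: (rho ^+ l * M) h3 => B h3 B0.
have {}h1 : gF <= gT by apply: h1 => a c ac; apply: gfun_le => //; lra.
have {}h2 : theta beta * wF - gF <= theta beta * wT - gT.
  by apply: h2 => a c ac; have := @gfun_lip_le _ beta (u z + a) (u z + c) b0; lra.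
have k3 : 0 <= p1 - p3 by lra.
have h4 : (p1 - p3) * (gT - gF) <= (p1 - p3) * (theta beta * (wT - wF)).
  by apply: ler_wpM2l => //; lra.
have h5 : (p1 - p3) * theta beta * (wT - wF) <= (p1 - p3) * theta beta * B.
  by apply: ler_wpM2l => //; rewrite mulr_ge0.
have h6 : (p1 - p3) * theta beta * B <= rho / b%:R * B by apply: ler_wpM2r => //; have -> : p1 - p3 = p4 - p2 by lra.
move: (rho / b%:R * B) h6 => C h6.
move: (gfun beta (u z)) => gz.
rewrite [X in X <= _](_ : _ = (p1 - p3) * (gT - gF)); last by ring.
by apply: le_trans h4 _; rewrite mulrA; apply: le_trans h5 _.
Qed.

(** For [|w| <= M] one has [expR (- M) * w^2 <= (expR w - 1) * w], and the mean of the right side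
    under a minus is the difference bounded in [wlik_diff]. *)
Lemma second_moment0 l x s : x \in V -> (size x + l + k0 <= size r + m)%N ->
  Ex (desc x) (fun s => wlik l x s ^+ 2) (upd s x false) <= expR M * (rho ^+ l * M).
Proof.
move=> xV hx; have hx1 : (size x + l.+1 <= size r + m)%N by lia.
rewrite mulrC -ler_pdivrMr ?expR_gt0 // mulrC -expRN.
apply: le_trans (wlik_diff s xV hx).
rewrite (@lik_ratio_comp l x id) //.
have := @Ex_le _ _ K K_gt0 V (desc x) (fun s => expR (- M) * wlik l x s ^+ 2)
  (fun s => expR (wlik l x s) * wlik l x s - wlik l x s) _ (upd s x false).
rewrite ExZ ExB; apply => t.
have /ler_normlP[h1 h2] := wlik_bound u beta_ge0 l x t.
move: (wlik l x t) h1 h2 => w h1 h2.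
have := @expR_ge1Dx R w; have := @expR_ge1Dx R (- w); rewrite expRN.
have e0 := expR_gt0 w.
have : expR (- M) <= expR w by rewrite ler_expR; lra.
have : expR (- M) <= 1 by rewrite -expR0 ler_expR; have := Mb_ge0 b beta_ge0; lra.
have : (expR w)^-1 * expR w = 1 by rewrite mulVf // gt_eqF.
move: (expR (- M)) (expR_gt0 (- M)) e0 ((expR w)^-1) => q q0; move: (expR w) => e e0 e' ee q1 qe h3 h4.
case: (leP 0 w) => w0.
  apply: (@le_trans _ _ (1 * w ^+ 2)); first by rewrite ler_wpM2r ?sqr_ge0.
  have : 0 <= w * (e - 1 - w) by apply: mulr_ge0; lra.
  rewrite mul1r expr2; lra.
have h5 : e * (1 - w) <= e * e' by apply: ler_wpM2l; lra.
have h6 : 0 <= (1 - e + w * e) * (- w) by apply: mulr_ge0; lra.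
have h7 : 0 <= (e - q) * (w ^+ 2) by apply: mulr_ge0; [lra|exact: sqr_ge0].
by move: h6 h7; rewrite expr2; lra.
Qed.

(** One factor [expR M] comes from [second_moment0], the other from passing to the law under a
    plus. *)
Definition S2 l : R := expR M * (expR M * (rho ^+ l * M)).

Lemma second_moment l x a s : x \in V -> (size x + l + k0 <= size r + m)%N ->
  Ex (desc x) (fun s => wlik l x s ^+ 2) (upd s x a) <= S2 l.
Proof.
move=> xV hx; have hx1 : (size x + l.+1 <= size r + m)%N by lia.
have r0 := rho_ge0; have M0 := Mb_ge0 b beta_ge0.
have h := second_moment0 s xV hx.
have e1 : 1 <= expR M by rewrite -expR0 ler_expR.
case: a; last first.
  apply: le_trans h _; rewrite /S2 ler_peMl // mulr_ge0 ?expR_ge0 // mulr_ge0 // exprn_ge0 //.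
rewrite (@lik_ratio_comp l x (fun w : R => w ^+ 2)) //.
apply: (@le_trans _ _ (Ex (desc x) (fun s => expR M * wlik l x s ^+ 2) (upd s x false))).
  apply: Ex_le => // t; rewrite ler_wpM2r ?sqr_ge0 // ler_expR.
  by have /ler_normlP[] := wlik_bound u beta_ge0 l x t.
by rewrite ExZ ler_wpM2l ?expR_ge0.
Qed.

(** Averages [|w| <= w^2 / q + q]; the parameter [q] stands for a bound on the root of the second
    moment. *)
Lemma first_moment l x a s (q : R) : 0 < q -> S2 l <= q ^+ 2 ->
  x \in V -> (size x + l + k0 <= size r + m)%N ->
  Ex (desc x) (fun s => `|wlik l x s|) (upd s x a) <= 2 * q.
Proof.
move=> q0 hq xV hx; have h := second_moment a s xV hx.
have := @Ex_le _ _ K K_gt0 V (desc x) (fun s => `|wlik l x s|)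
  (fun s => q^-1 * wlik l x s ^+ 2 + q) _ (upd s x a).
rewrite ExD ExZ Ex_cst // => H; apply: le_trans (H _) _ => {H}.
  move=> t; rewrite -[wlik l x t ^+ 2]real_normK ?num_real //; move: (`|_|) => w.
  rewrite -(ler_pM2l q0) mulrDr mulrA mulfV ?gt_eqF // mul1r.
  by have := sqr_ge0 (w - q); nra.
rewrite mulr2n mulrDl mul1r lerD2r mulrC ler_pdivrMr //.
by rewrite -expr2; exact: le_trans hq.
Qed.

(** From [expR y <= 1 + y expR y] and [|w| <= M]. The factor [expR (t * M)] is crude, and is made
    harmless in [mgf] by a smaller [t]. *)
Lemma mgf0 l x a s (q t : R) : 0 < q -> S2 l <= q ^+ 2 -> 0 <= t ->
  x \in V -> (size x + l + k0 <= size r + m)%N ->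
  Ex (desc x) (fun s => expR (t * `|wlik l x s|)) (upd s x a) <= expR (t * expR (t * M) * (2 * q)).
Proof.
move=> q0 hq t0 xV hx; have h := first_moment a s q0 hq xV hx.
have := @Ex_le _ _ K K_gt0 V (desc x) (fun s => expR (t * `|wlik l x s|))
  (fun s => 1 + t * expR (t * M) * `|wlik l x s|) _ (upd s x a).
rewrite ExD ExZ Ex_cst // => H; apply: le_trans (H _) _ => {H}.
  move=> s'; have := wlik_bound u beta_ge0 l x s'.
  move: (`|_|) (normr_ge0 (wlik l x s')) => w w0 wM.
  have e1 := @expR_ge1Dx R (- (t * w)).
  have e2 : expR (t * w) <= expR (t * M) by rewrite ler_expR ler_wpM2l.
  have e3 : expR (- (t * w)) * expR (t * w) = 1 by rewrite mulrC expRxMexpNx_1.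
  have tw : 0 <= t * w by exact: mulr_ge0.
  have e4 : (1 - t * w) * expR (t * w) <= 1 by rewrite -[leRHS]e3 ler_wpM2r ?expR_ge0.
  have : (t * w) * expR (t * w) <= (t * w) * expR (t * M) by rewrite ler_wpM2l.
  by lra.
apply: le_trans (expR_ge1Dx _).
by rewrite lerD2l ler_wpM2l // mulr_ge0 ?expR_ge0.
Qed.

(** Each of the [i] upper levels replaces [t] by [t * theta], by the Lipschitz bound on [gfun], and
    splits the expectation into a product over [b] child subtrees. Thus [mgf0] is applied at
    [t * theta^i], to [b^i] factors. *)
Lemma mgf l i x a s (q t : R) : 0 < q -> S2 l <= q ^+ 2 -> 0 <= t ->
  x \in V -> (size x + (i + l) + k0 <= size r + m)%N ->
  Ex (desc x) (fun s => expR (t * `|wlik (i + l) x s|)) (upd s x a) <=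
  expR (b%:R ^+ i * ((t * theta beta ^+ i) * expR (t * theta beta ^+ i * M) * (2 * q))).
Proof.
have th0 := theta_ge0 beta_ge0.
move=> q0 hq; elim: i x a s t => [|i IH] x a s t t0 xV hx.
  by rewrite expr0 mul1r mulr1; exact: mgf0.
set C := expR (b%:R ^+ i * (((t * theta beta) * theta beta ^+ i) *
   expR ((t * theta beta) * theta beta ^+ i * M) * (2 * q))).
have -> : expR (b%:R ^+ i.+1 * (t * theta beta ^+ i.+1 * expR (t * theta beta ^+ i.+1 * M) * (2 * q)))
   = C ^+ b.
  by rewrite /C -expRM_natl !exprS !mulrA.
apply: le_trans (_ : _ <= Ex (desc x)
    (fun s => \prod_(j < b) expR (t * theta beta * `|wlik (i + l) (j :: x) s|)) (upd s x a)) _.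
  apply: Ex_le => // s'; rewrite -expR_sum ler_expR -mulr_sumr -mulrA ler_wpM2l //.
  rewrite addSn; apply: le_trans (ler_norm_sum _ _ _) _; rewrite mulr_sumr; apply: ler_sum => j _.
  rewrite GlikS; apply: le_trans (gfun_lip _ _ beta_ge0) _.
  by rewrite addrC addKr.
apply: (Ex_desc_prod_le (V := V) K_gt0 K_sum V_uniq V_sorted) => [j|j s'|j s'].
- apply: (indep_comp (fun c => expR (t * theta beta * `|c|))).
  apply: indepW (@wlik_indep _ _ beta u (i + l) (j :: x)) => v nv.
  by apply: contra nv => /andP[/andP[]].
- exact: expR_ge0.
- have zV : j :: x \in V by rewrite (V_child V_mem) //; lia.
  have hz : (size (j :: x) + (i + l) + k0 <= size r + m)%N by move: hx => /=; lia.
  rewrite Ex_suffix // /Q.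
  have t1 : 0 <= t * theta beta by exact: mulr_ge0.
  have h1 := IH (j :: x) true s' _ t1 zV hz; have h2 := IH (j :: x) false s' _ t1 zV hz.
  have k1 := K_gt0 (j :: x) (par s' (j :: x)) true; have k2 := K_gt0 (j :: x) (par s' (j :: x)) false.
  have kk := K_sum (j :: x) (par s' (j :: x)).
  apply: (@le_trans _ _ (K (j :: x) (par s' (j :: x)) true * C + K (j :: x) (par s' (j :: x)) false * C)).
    by apply: lerD; rewrite ler_pM2l.
  by rewrite -mulrDl kk mul1r.
Qed.

End Decay.

(** Here [X] is a covariance, [a] a mean and [H] an entropy. If [X <= a s2], the choice
    [t = X / (2 a s2)] gives [X^2 <= 4 s2 a H]. Otherwise [t = 1/2] gives [X <= 4 H]; then either
    [a e1 <= H], and [t0] gives [X <= 2 H / t0], squared with the help of [X <= a], or [H < a e1],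
    and [X^2 <= 16 H^2] suffices. *)
Lemma entropy_scalar (R : realType) (a H s2 t0 e1 X : R) :
  0 < a -> 0 <= H -> 0 < s2 -> 0 < t0 -> 0 <= e1 -> 0 <= X -> X <= a ->
  (forall t, 0 <= t -> t <= 2^-1 -> t * X <= H + a * (t ^+ 2 * s2)) ->
  t0 * X <= H + a * e1 ->
  X ^+ 2 <= (4 * s2 + 2 / t0 + 16 * e1) * (a * H).
Proof.
move=> a0 H0 s0 t00 e0 X0 Xa hs ht.
have aH : 0 <= a * H by rewrite mulr_ge0 // ltW.
have p1 : 0 <= 4 * s2 * (a * H) by rewrite !mulr_ge0 // ltW.
have p2 : 0 <= 2 / t0 * (a * H) by rewrite mulr_ge0 // divr_ge0 // ltW.
have p3 : 0 <= 16 * e1 * (a * H) by rewrite !mulr_ge0 // ltW.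
rewrite !mulrDl.
have [X1|X1] := leP X (a * s2).
  suff : X ^+ 2 <= 4 * s2 * (a * H) by lra.
  have d0 : 0 < 2 * (a * s2) by rewrite mulr_gt0 // mulr_gt0.
  have := hs (X / (2 * (a * s2))) _ _.
  have -> : a * ((X / (2 * (a * s2))) ^+ 2 * s2) = X ^+ 2 / (4 * (a * s2)).
    by field; rewrite !gt_eqF.
  have -> : X / (2 * (a * s2)) * X = 2 * (X ^+ 2 / (4 * (a * s2))).
    by field; rewrite !gt_eqF.
  move=> h; have : X ^+ 2 / (4 * (a * s2)) <= H.
    suff : 2 * (X ^+ 2 / (4 * (a * s2))) <= H + X ^+ 2 / (4 * (a * s2)) by lra.
    apply: h; first by rewrite divr_ge0 // ltW.
    by rewrite ler_pdivrMr //; lra.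
  by rewrite ler_pdivrMr ?mulr_gt0 //; lra.
have X4 : X <= 4 * H.
  have := hs 2^-1 _ _; rewrite expr2 => h.
  have {}h : 2^-1 * X <= H + a * (2^-1 * 2^-1 * s2) by apply: h; lra.
  by lra.
have [h|h] := leP (a * e1) H.
  suff : X ^+ 2 <= 2 / t0 * (a * H) by lra.
  have X2 : X <= 2 * H / t0 by rewrite ler_pdivlMr //; lra.
  have -> : 2 / t0 * (a * H) = a * (2 * H / t0) by ring.
  by rewrite expr2; apply: ler_pM.
suff : X ^+ 2 <= 16 * e1 * (a * H) by lra.
apply: (@le_trans _ _ ((4 * H) * (4 * H))); first by rewrite expr2; apply: ler_pM.
have -> : 16 * e1 * (a * H) = 16 * ((a * e1) * H) by ring.
have : H * H <= (a * e1) * H by apply: ler_wpM2r => //; exact: ltW.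
lra.
Qed.

Lemma expR_le_quad (R : realType) (y : R) : `|y| <= 2^-1 -> expR y <= 1 + y + 2 * y ^+ 2.
Proof.
move=> /ler_normlP[y1 y2].
have := @expR_ge1Dx R (- y).
have e3 : expR (- y) * expR y = 1 by rewrite mulrC expRxMexpNx_1.
have e0 := expR_gt0 y.
move=> h; have h1 : (1 - y) * expR y <= 1 by rewrite -[leRHS]e3 ler_wpM2r ?expR_ge0.
have : 0 <= y ^+ 2 * (1 - 2 * y) by rewrite mulr_ge0 ?sqr_ge0 //; lra.
rewrite !expr2 => h2.
have h3 : (1 - y) * expR y <= (1 - y) * (1 + y + 2 * (y * y)) by lra.
by move: h3; rewrite ler_pM2l //; lra.
Qed.

Section LocalExpectation.
Context (R : realType) (b : nat) (K : vertex b -> bool -> bool -> R).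
Hypothesis K_gt0 : forall v p a, 0 < K v p a.
Context (V : seq (vertex b)).

Lemma Qs_le_at l (F G : config b -> R) s :
  (forall s', (forall v, v \notin l -> s' v = s v) -> F s' <= G s') -> Qs K l F s <= Qs K l G s.
Proof.
elim: l s => /= [|v l IH] s h; first exact: h.
rewrite /Q; apply: lerD; rewrite ler_pM2l //; apply: IH => s' ss; apply: h => w;
  by rewrite inE negb_or => /andP[wv wl]; rewrite ss // upd_other.
Qed.

Lemma Qs_eq_at l (F G : config b -> R) s :
  (forall s', (forall v, v \notin l -> s' v = s v) -> F s' = G s') -> Qs K l F s = Qs K l G s.
Proof. by move=> h; apply/eqP; rewrite eq_le !Qs_le_at // => s' /h ->. Qed.

Lemma Ex_le_at P (F G : config b -> R) s :
  (forall s', (forall v, ~~ P v -> s' v = s v) -> F s' <= G s') -> Ex K V P F s <= Ex K V P G s.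
Proof.
move=> h; apply: Qs_le_at => s' ss; apply: h => v nv; apply: ss.
by rewrite mem_filter (negbTE nv).
Qed.

Lemma Ex_eq_at P (F G : config b -> R) s :
  (forall s', (forall v, ~~ P v -> s' v = s v) -> F s' = G s') -> Ex K V P F s = Ex K V P G s.
Proof. by move=> h; apply/eqP; rewrite eq_le !Ex_le_at // => s' /h ->. Qed.

End LocalExpectation.

(** * Centred posteriors of a spin given far spins *)

Section Posterior.
Context (R : realType).
Implicit Types p w : R.

(* A prior probability p and a log-likelihood ratio w give the posterior p + post p w. *)
Definition post p w : R := p * expR w / (p * expR w + (1 - p)) - p.

Lemma post_den_gt0 p w : 0 < p -> p < 1 -> 0 < p * expR w + (1 - p).
Proof. by move=> p0 p1; rewrite addr_gt0 ?mulr_gt0 ?expR_gt0 // subr_gt0. Qed.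

Lemma postE p w : 0 < p -> p < 1 ->
  post p w = p * (1 - p) * (expR w - 1) / (p * expR w + (1 - p)).
Proof.
move=> p0 p1; have d0 := post_den_gt0 w p0 p1.
by rewrite /post; field; rewrite gt_eqF.
Qed.

Lemma post_le_norm p w : 0 < p -> p < 1 -> `|post p w| <= `|w|.
Proof.
move=> p0 p1; have d0 := post_den_gt0 w p0 p1; rewrite postE //.
have e0 := expR_gt0 w; have h1 := @expR_ge1Dx R w; have h2 := @expR_ge1Dx R (- w).
have e3 : expR (- w) * expR w = 1 by rewrite mulrC expRxMexpNx_1.
have h3 : (1 - w) * expR w <= 1 by rewrite -[leRHS]e3 ler_wpM2r ?expR_ge0.
have pp : 0 < p * (1 - p) by rewrite mulr_gt0 // subr_gt0.
have pp1 : p * (1 - p) <= 1 by nra.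
case: (leP 0 w) => w0.
  have e1 : 1 <= expR w by lra.
  rewrite !ger0_norm //; last by apply: divr_ge0; [apply: mulr_ge0; lra|exact: ltW].
  rewrite ler_pdivrMr //.
  apply: (@le_trans _ _ (p * (1 - p) * (w * expR w))); first by rewrite ler_pM2l //; lra.
  rewrite mulrCA ler_wpM2l //; nra.
rewrite (ltr0_norm w0).
have e1 : expR w < 1 by rewrite -expR0 ltr_expR.
rewrite ler0_norm; last by apply: mulr_le0_ge0; [apply: mulr_ge0_le0; lra|by rewrite invr_ge0 ltW].
rewrite -mulNr ler_pdivrMr // -mulrN opprB.
have : p * (1 - p) * (1 - expR w) <= p * (1 - p) * (- w) by rewrite ler_pM2l //; lra.
suff : (p * (1 - p)) * (- w) <= (p * expR w + (1 - p)) * (- w) by lra.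
by apply: ler_wpM2r; nra.
Qed.

Lemma post_le1 p w : 0 < p -> p < 1 -> `|post p w| <= 1.
Proof.
move=> p0 p1; have d0 := post_den_gt0 w p0 p1.
have e0 := expR_gt0 w.
have q0 : 0 < p * expR w by exact: mulr_gt0.
have : p * expR w / (p * expR w + (1 - p)) < 1 by rewrite ltr_pdivrMr //; lra.
have : 0 < p * expR w / (p * expR w + (1 - p)) by exact: divr_gt0.
by rewrite /post ler_norml => *; apply/andP; split; lra.
Qed.

End Posterior.

Section PosteriorFunction.
Context (R : realType) (b : nat) (K : vertex b -> bool -> bool -> R).
Hypothesis K_gt0 : forall v p a, 0 < K v p a.
Hypothesis K_sum : forall v p, K v p true + K v p false = 1.
Context (V : seq (vertex b)).
Hypothesis V_uniq : uniq V.
Hypothesis V_sorted : level_sorted V.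
Context (r : vertex b) (m : nat).
Hypothesis V_mem : forall v, (v \in V) = suffix r v && (size v <= size r + m)%N.
Context (beta : R) (u : vertex b -> R).
Hypothesis beta_ge0 : 0 <= beta.
Hypothesis K_true : forall v p, v != r -> v \in V -> K v p true = logis (u v + 2 * beta * spin R p).
Context (rho : R) (k0 : nat).
Hypothesis rho_ge0 : 0 <= rho.
Hypothesis k0_gt0 : (0 < k0)%N.
Hypothesis contracting : forall v, v \in V -> (size v + k0 <= size r + m)%N ->
  b%:R * theta beta * kap beta (u v) <= rho.
Implicit Types (v x y z : vertex b) (s : config b) (F G : config b -> R).
Implicit Types (P : pred (vertex b)).

Local Notation Ex := (Ex K V).
Local Notation wlik := (wlik beta u).
Local Notation M := (Mb b beta).
Local Notation S2 := (S2 b beta rho).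

(* psi l x is the conditional expectation of phi x given the spins off the l.+1
   first levels of the subtree of x. *)
Definition phi x s : R := (s x)%:R - K x (par s x) true.
Definition psi l x s : R := post (K x (par s x) true) (wlik l x s).

Lemma K_lt1 v p a : K v p a < 1.
Proof. by have := K_sum v p; have := K_gt0 v p true; have := K_gt0 v p false; case: a; lra. Qed.

Lemma psi_le1 l x s : `|psi l x s| <= 1.
Proof. by apply: post_le1 => //; exact: K_lt1. Qed.

Lemma psi_le_wlik l x s : `|psi l x s| <= `|wlik l x s|.
Proof. by apply: post_le_norm => //; exact: K_lt1. Qed.

Lemma desc_par x s s' : (forall v, ~~ desc x v -> s' v = s v) -> par s' x = par s x.
Proof.
move=> ss; case: x ss => //= i x; apply; apply/negP => /andP[h _].
by move: h; rewrite (negbTE (suffix_consN _ _)).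
Qed.

Lemma par_upd_self x s a : par (upd s x a) x = par s x.
Proof. by rewrite par_upd isparent_irr. Qed.

Lemma Ex_suffix_le x F (C : R) : x \in V ->
  (forall s a, Ex (desc x) F (upd s x a) <= C) -> forall s, Ex (suffix x) F s <= C.
Proof.
move=> xV h s; rewrite Ex_suffix // /Q.
apply: (@le_trans _ _ (K x (par s x) true * C + K x (par s x) false * C)).
  by apply: lerD; rewrite ler_pM2l.
by rewrite -mulrDl K_sum mul1r.
Qed.

(** By [lik_ratio] both sides become expectations under a minus at [x], where the integrands agree:
    both equal [p (1 - p) (expR w - 1) c] with [w] the log-likelihood ratio. *)
Lemma psi_orth l x (c : config b -> R) s : x \in V -> (size x + l.+1 <= size r + m)%N ->
  indep (block x l.+1) c ->
  Ex (suffix x) (fun s => c s * psi l x s) s = Ex (suffix x) (fun s => c s * phi x s) s.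
Proof.
move=> xV hx ic; rewrite !Ex_suffix // /Q.
set p := K x (par s x) true.
have -> : K x (par s x) false = 1 - p by have := K_sum x (par s x); rewrite -/p; lra.
have p0 : 0 < p by exact: K_gt0.
have p1 : p < 1 by exact: K_lt1.
have lr := lik_ratio K_sum V_uniq V_sorted V_mem beta_ge0 K_true.
have nx : ~~ desc x x by rewrite /desc eqxx andbF.
have E1 a : Ex (desc x) (fun s => c s * phi x s) (upd s x a) =
   (a%:R - p) * Ex (desc x) c (upd s x a).
  rewrite ExZ_at.
  apply: Ex_eq_at => // s' ss; rewrite mulrC /phi (desc_par ss) par_upd_self -/p ss //.
  by rewrite upd_same.
have E2 a : Ex (desc x) (fun s => c s * psi l x s) (upd s x a) =
   Ex (desc x) (fun s => post p (wlik l x s) * c s) (upd s x a).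
  by apply: Ex_eq_at => // s' ss; rewrite mulrC /psi (desc_par ss) par_upd_self.
have ik : indep (block x l.+1) (fun s => post p (wlik l x s) * c s).
  by apply: (indep_comp2 (fun w c => post p w * c)) ic; exact: wlik_indep_block.
rewrite !E1 !E2 !(lr l) //.
rewrite [p * Ex _ (fun s => expR _ * (post _ _ * _)) _]ExZ_at.
rewrite [(1 - p) * Ex _ (fun s => post _ _ * _) _]ExZ_at ExD_at.
transitivity (Ex (desc x) (fun s => p * (1 - p) * (expR (wlik l x s) * c s - c s)) (upd s x false)).
  congr (Ex _ _ _); apply/funext => t.
  have d0 := post_den_gt0 (wlik l x t) p0 p1.
  rewrite postE //; move: (wlik l x t) d0 => w d0; move: (c t) => ct.
  by field; rewrite gt_eqF.
by rewrite ExZ ExB /= mulr1n mulr0n; ring.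
Qed.

Lemma phi_mean x s : x \in V -> Ex (suffix x) (phi x) s = 0.
Proof.
move=> xV; rewrite Ex_suffix // Ex_indep_id //.
  rewrite /Q /phi !par_upd_self !upd_same.
  have := K_sum x (par s x); move: (K _ _ _) (K _ _ _) => p q pq; have -> : q = 1 - p by lra.
  by rewrite /=; ring.
move=> t t' tt; rewrite /phi tt ?(desc_par tt) // /desc eqxx andbF //.
Qed.

End PosteriorFunction.

(** * The logarithmic Sobolev inequality *)

Section EntropyContraction.
Context (R : realType) (b : nat) (K : vertex b -> bool -> bool -> R).
Hypothesis K_gt0 : forall v p a, 0 < K v p a.
Hypothesis K_sum : forall v p, K v p true + K v p false = 1.
Context (V : seq (vertex b)).
Hypothesis V_uniq : uniq V.
Hypothesis V_sorted : level_sorted V.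
Context (r : vertex b) (m : nat).
Hypothesis V_mem : forall v, (v \in V) = suffix r v && (size v <= size r + m)%N.
Context (beta : R) (u : vertex b -> R).
Hypothesis beta_ge0 : 0 <= beta.
Hypothesis K_true : forall v p, v != r -> v \in V -> K v p true = logis (u v + 2 * beta * spin R p).
Context (rho : R) (k0 : nat).
Hypothesis rho_ge0 : 0 <= rho.
Hypothesis k0_gt0 : (0 < k0)%N.
Hypothesis contracting : forall v, v \in V -> (size v + k0 <= size r + m)%N ->
  b%:R * theta beta * kap beta (u v) <= rho.
Implicit Types (v x y z : vertex b) (s : config b) (F G : config b -> R).
Implicit Types (P : pred (vertex b)).

Local Notation Ex := (Ex K V).
Local Notation Ent := (Ent K).
Local Notation psi := (psi K beta u).
Local Notation phi := (phi K).
Local Notation M := (Mb b beta).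
Local Notation S2 := (S2 b beta rho).

Definition lower x n : pred (vertex b) := fun v => suffix x v && (size x + n <= size v)%N.

Lemma Ex_block_lower x n F : Ex (suffix x) F = Ex (block x n) (Ex (lower x n) F).
Proof.
apply: Ex_split => //.
- by move=> v _; rewrite /block /lower -andb_orr ltnNge orNb andbT.
- by move=> v _ /andP[_ h] /andP[_ h']; move: h; rewrite ltnNge h'.
- move=> v w _ _ /andP[_ h] /isparent_size sv; apply/negP => /andP[_ h'].
  by move: h; rewrite sv ltnNge (leq_trans h') // leqW.
Qed.

(** Depth [l.+1] is the deepest level that [psi l x] reads, hence the [l.+2]. *)
Lemma psi_indep_lower l x n : (l.+2 <= n)%N -> indep (lower x n) (psi l x).
Proof.
move=> ln s s' ss.
have -> : psi l x s = post (K x (par s x) true) (wlik beta u l x s) by [].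
have -> : psi l x s' = post (K x (par s' x) true) (wlik beta u l x s') by [].
congr (post (K x _ true) _).
  apply: (@desc_par _ x s' s) => v nd; apply: ss; apply: contra nd => /andP[h1 h2].
  apply/andP; split => //; apply/eqP => E; move: h2; rewrite E -{2}[size x]addn0 leq_add2l leqn0.
  by move=> /eqP n0; move: ln; rewrite n0.
apply: (@wlik_indep _ _ beta u l x) => v; rewrite negbK => /andP[_ /eqP E].
by apply: ss; rewrite /lower E leq_add2l negb_and -ltnNge ln orbT.
Qed.

(** The constant of [entropy_scalar] for [s2 = 2 q^2] and for [e1] the exponent in [mgf]. *)
Definition eps_ent (q t0 : R) (i : nat) : R :=
  4 * (2 * q ^+ 2) + 2 / t0 +
  16 * (b%:R ^+ i * ((t0 * theta beta ^+ i) * expR (t0 * theta beta ^+ i * M) * (2 * q))).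

Lemma psi_mgf l i x s (q t : R) : 0 < q -> S2 l <= q ^+ 2 -> 0 <= t ->
  x \in V -> (size x + (i + l) + k0 <= size r + m)%N ->
  Ex (suffix x) (fun s => expR (t * `|psi (i + l) x s|)) s <=
  expR (b%:R ^+ i * ((t * theta beta ^+ i) * expR (t * theta beta ^+ i * M) * (2 * q))).
Proof.
move=> q0 hq t0 xV hx; move: s; apply: Ex_suffix_le => // s a.
apply: le_trans (mgf K_gt0 K_sum V_uniq V_sorted V_mem beta_ge0 K_true rho_ge0 k0_gt0 contracting a s q0 hq t0 xV hx).
by apply: Ex_le => // s'; rewrite ler_expR ler_wpM2l // psi_le_wlik.
Qed.

Lemma psi_square l x s : x \in V -> (size x + l + k0 <= size r + m)%N ->
  Ex (suffix x) (fun s => psi l x s ^+ 2) s <= S2 l.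
Proof.
move=> xV hx; move: s; apply: Ex_suffix_le => // s a.
apply: le_trans (second_moment K_gt0 K_sum V_uniq V_sorted V_mem beta_ge0 K_true rho_ge0 k0_gt0 contracting a s xV hx).
apply: Ex_le => // s'; rewrite -[X in X <= _]real_normK ?num_real // -[X in _ <= X]real_normK ?num_real //.
by rewrite lerXn2r ?nnegrE //; exact: psi_le_wlik.
Qed.

Lemma psi_mean l x s : x \in V -> (size x + l.+1 <= size r + m)%N -> Ex (suffix x) (psi l x) s = 0.
Proof.
move=> xV hx; rewrite -(phi_mean K_sum V_uniq V_sorted s xV).
have := psi_orth K_gt0 K_sum V_uniq V_sorted V_mem beta_ge0 K_true s xV hx (c := fun=> 1) _.
have -> : (fun s => 1 * psi l x s) = psi l x by apply/funext => ?; rewrite mul1r.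
have -> : (fun s => 1 * phi x s) = phi x by apply/funext => ?; rewrite mul1r.
exact.
Qed.

(** [psi] does not read the levels from [n] on, so [F] may first be averaged over them. The
    variational formula with [c * psi] is then used for small [c], of the sign of [X], through a
    second-order expansion, and for [|c| = t0] through [psi_mgf]; [entropy_scalar] combines the
    two. *)
Lemma cov_contraction l i x F s (q t0 : R) :
  0 < q -> S2 l <= q ^+ 2 -> S2 (i + l) <= q ^+ 2 -> 0 < t0 ->
  x \in V -> (size x + (i + l) + k0 <= size r + m)%N -> (forall s, 0 < F s) ->
  Ex (suffix x) (fun s => F s * psi (i + l) x s) s ^+ 2 <=
  eps_ent q t0 i * (Ex (suffix x) F s *
    Ent (seq.filter (block x (i + l).+2) V) (Ex (lower x (i + l).+2) F) s).
Proof.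
move=> q0 hq hq' t00 xV hx F0.
have hx1 : (size x + (i + l).+1 <= size r + m)%N by lia.
set n := (i + l).+2; set F' := Ex (lower x n) F; set H := Ent _ F' s.
have F'0 t : 0 < F' t by exact: Ex_gt0.
set X := Ex (suffix x) _ s; set a := Ex (suffix x) F s.
have a0 : 0 < a by exact: Ex_gt0.
have tU : topo (seq.filter (block x n) V) by exact: topo_Ex.
have H0 : 0 <= H by exact: Ent_ge0.
have key (c : R) : c * X <= H + a * ln (Ex (suffix x) (fun s => expR (c * psi (i + l) x s)) s).
  have := @Ent_variational _ _ K K_gt0 _ F' (fun s => c * psi (i + l) x s) s tU F'0.
  rewrite -/H; have ip := @psi_indep_lower (i + l) x n (leqnn _).
  have -> : Qs K (seq.filter (block x n) V) (fun s => expR (c * psi (i + l) x s)) s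
     = Ex (suffix x) (fun s => expR (c * psi (i + l) x s)) s.
    rewrite (Ex_block_lower x n) [Ex (lower x n) _]Ex_indep_id //.
    exact: (indep_comp (fun w => expR (c * w)) ip).
  have -> : Qs K (seq.filter (block x n) V) F' s = a by rewrite /a (Ex_block_lower x n).
  suff -> : Qs K (seq.filter (block x n) V) (fun s => F' s * (c * psi (i + l) x s)) s = c * X by [].
  rewrite /X ExZ_at (Ex_block_lower x n).
  have -> : (fun s => c * (F s * psi (i + l) x s)) = fun s => c * psi (i + l) x s * F s.
    by apply/funext => t; ring.
  rewrite [Ex (lower x n) _]Ex_pull; last exact: (indep_comp (fun w => c * w) ip).
  by congr (Ex _ _ _); apply/funext => t; rewrite mulrC.
have Xa : `|X| <= a.
  have h : `|X| <= Ex (suffix x) (fun s => `|F s * psi (i + l) x s|) s by exact: Qs_norm.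
  apply: le_trans h _; apply: Ex_le => // t.
  by rewrite normrM gtr0_norm // -[leRHS]mulr1 ler_pM2l //; exact: psi_le1.
rewrite -[X ^+ 2]real_normK ?num_real //.
apply: entropy_scalar => //.
- by rewrite mulr_gt0 // exprn_gt0.
- by rewrite !mulr_ge0 ?exprn_ge0 ?expR_ge0 ?theta_ge0 // ltW.
- move=> t t_ge0 t2.
  have sg : exists2 c : R, c * X = t * `|X| & `|c| = t.
    case: (leP 0 X) => X0; first by exists t; [rewrite (ger0_norm X0)|rewrite ger0_norm].
    by exists (- t); [rewrite (ltr0_norm X0) mulrN mulNr|rewrite normrN ger0_norm].
  have [c <- ct] := sg.
  apply: le_trans (key c) _; rewrite lerD2l ler_pM2l //.
  have pos : 0 < Ex (suffix x) (fun s => expR (c * psi (i + l) x s)) s.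
    by apply: Ex_gt0 => // ?; exact: expR_gt0.
  rewrite -ler_expR lnK ?posrE //; apply: le_trans (expR_ge1Dx _).
  apply: (@le_trans _ _ (Ex (suffix x) (fun s => 1 + c * psi (i + l) x s + 2 * c ^+ 2 * psi (i + l) x s ^+ 2) s)).
    apply: Ex_le => // s'; rewrite -mulrA -exprMn; apply: expR_le_quad.
    rewrite normrM ct; apply: le_trans t2; rewrite ler_piMr //; exact: psi_le1.
  rewrite !ExD !ExZ Ex_cst // psi_mean // mulr0 addr0 lerD2l -ct real_normK ?num_real //.
  have -> : c ^+ 2 * (2 * q ^+ 2) = 2 * c ^+ 2 * q ^+ 2 by ring.
  apply: ler_wpM2l; first by rewrite mulr_ge0 // sqr_ge0.
  by apply: le_trans hq'; apply: psi_square.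
- have sg : exists2 c : R, c * X = t0 * `|X| & `|c| = t0.
    case: (leP 0 X) => X0; first by exists t0; [rewrite (ger0_norm X0)|rewrite gtr0_norm].
    by exists (- t0); [rewrite (ltr0_norm X0) mulrN mulNr|rewrite normrN gtr0_norm].
  have [c <- ct] := sg.
  apply: le_trans (key c) _; rewrite lerD2l ler_pM2l //.
  have pos : 0 < Ex (suffix x) (fun s => expR (c * psi (i + l) x s)) s.
    by apply: Ex_gt0 => // ?; exact: expR_gt0.
  rewrite -ler_expR lnK ?posrE //; apply: le_trans (psi_mgf s q0 hq (ltW t00) xV hx).
  apply: Ex_le => // s'; rewrite ler_expR -ct -normrM; exact: ler_norm.
Qed.

End EntropyContraction.

Section BlockEntropy.
Context (R : realType) (b : nat) (K : vertex b -> bool -> bool -> R).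
Hypothesis K_gt0 : forall v p a, 0 < K v p a.
Hypothesis K_sum : forall v p, K v p true + K v p false = 1.
Context (V : seq (vertex b)).
Hypothesis V_uniq : uniq V.
Hypothesis V_sorted : level_sorted V.
Implicit Types (v w x y z : vertex b) (s : config b) (F G : config b -> R).

Local Notation Ex := (Ex K V).
Local Notation Ent := (Ent K).

(** The share of the vertex [z] in the decomposition [Ent_desc] of the entropy. *)
Definition Phi z F : config b -> R := Ent [:: z] (Ex (desc z) F).

Lemma Phi_indep z F : z \in V -> indep (fun v => suffix z v && (v \in V)) (Phi z F).
Proof.
move=> zV; set G := Ex (desc z) F.
have iG : indep (fun v => desc z v && (v \in V)) G by exact: Ex_indep_self.
have H G' : indep (fun v => desc z v && (v \in V)) G' ->
    indep (fun v => suffix z v && (v \in V)) (Qs K [:: z] G').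
  move=> iG'; have := @Qs_indep _ _ K (fun v => desc z v && (v \in V)) [:: z] G' iG' isT.
  move=> H; apply: indepW (H _) => [v /andP[sv vV]|v w].
    by rewrite inE; case: eqVneq => [->|nv]; rewrite ?orbT // orbF vV andbT /desc sv nv.
  rewrite inE => /eqP -> pw; apply/negP => /andP[/andP[/suffix_size sw _] _].
  by move: sw; rewrite (isparent_size pw) ltnn.
by apply: (indep_comp2 (fun a c => a - c * ln c)); apply: H => //; exact: (indep_comp (fun a => a * ln a)).
Qed.

Lemma Phi_ge0 z F s : (forall s, 0 < F s) -> 0 <= Phi z F s.
Proof. by move=> F0; apply: Ent_ge0 => // ?; exact: Ex_gt0. Qed.

Lemma desc_isparent z v w : desc z w -> isparent w v -> desc z v.
Proof.
move=> /andP[zw _] wv; apply/andP; split; first exact: suffix_trans zw (isparent_suffix wv).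
by apply/eqP => E; have := suffix_size zw; rewrite -E (isparent_size wv) ltnn.
Qed.

(** [Ent_desc] inside the block yields the entropy at [z] of an average over [desc z] and over the
    set [Q] of lower vertices that are not below [z]. Since [Q] commutes with [z], convexity moves
    it outside the entropy, and [Phi z F] is what remains. *)
Lemma Ent_block_le x n F s : (forall s, 0 < F s) ->
  Ent (seq.filter (block x n) V) (Ex (lower x n) F) s <=
  \sum_(z <- V | block x n z) Ex (suffix x) (Phi z F) s.
Proof.
move=> F0; set U := seq.filter _ _.
have uU : uniq U by exact: filter_uniq.
have sU : level_sorted U by exact: subseq_pairwise (filter_subseq _ _) V_sorted.
have F'0 t : 0 < Ex (lower x n) F t by exact: Ex_gt0.
apply: le_trans (Ent_desc K_gt0 K_sum s uU sU F'0) _.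
rewrite /U big_filter; rewrite [X in X <= _]big_seq_cond [X in _ <= X]big_seq_cond.
apply: ler_sum => z /andP[zV bz]; rewrite -/U.
have [sz nz] := andP bz.
set Q := fun v => lower x n v && ~~ desc z v.
have E1 : Qs K (seq.filter (desc z) U) (Ex (lower x n) F) = Ex Q (Ex (desc z) F).
  have -> : Qs K (seq.filter (desc z) U) (Ex (lower x n) F)
      = Ex (fun v => desc z v && block x n v) (Ex (lower x n) F).
    by rewrite /Ex /U -filter_predI.
  rewrite -(@Ex_split _ _ K V V_uniq V_sorted (fun v => desc z v || lower x n v)).
  - apply: Ex_split => //.
    + by move=> v _; rewrite /Q; case: (desc z v); rewrite ?orbT ?orbF ?andbT.
    + by move=> v _ /andP[_ /negP].
    + by move=> v w _ _ /andP[_ nv] wv; apply: contra nv => dw; exact: desc_isparent dw wv.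
  - move=> v _; case dv: (desc z v) => //=; rewrite /block /lower.
    have -> : suffix x v by case/andP: dv => zv _; exact: suffix_trans sz zv.
    by rewrite /= ltnNge orNb.
  - by move=> v _ /andP[_ /andP[_ h]] /andP[_]; rewrite leqNgt h.
  - move=> v w _ _ /andP[_ /andP[_ h]] /isparent_size sv; apply/negP => /andP[_ h'].
    by move: h; rewrite sv ltnNge (leq_trans h') // leqW.
rewrite E1.
have tQ : topo (seq.filter Q V) by exact: topo_Ex.
have comm G : Qs K [:: z] (Qs K (seq.filter Q V) G) = Qs K (seq.filter Q V) (Qs K [:: z] G).
  rewrite /= Qs_move //.
    by rewrite mem_filter negb_and /Q /lower leqNgt nz andbF.
  move=> w; rewrite mem_filter => /andP[/andP[/andP[sw lw] dw] wV]; split.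
    by apply/negP => /isparent_size E; move: nz; rewrite E ltnNge (leq_trans lw) // leqW.
  apply/negP => zw; move/negP: dw; apply; apply/andP; split; first exact: isparent_suffix.
  by apply/eqP => E; move: (isparent_size zw); rewrite E => /n_Sn.
apply: (@le_trans _ _ (Ex (block x n) (Ex Q (Phi z F)) s)).
  apply: Ex_le => // t.
  by apply: (Ent_convex K_gt0 t (isT : topo [:: z]) tQ comm) => t'; exact: Ex_gt0.
rewrite (Ex_block_lower K V_uniq V_sorted x n).
suff -> : Ex (lower x n) (Phi z F) = Ex Q (Phi z F) by [].
rewrite (@Ex_split _ _ K V V_uniq V_sorted _ Q (fun v => lower x n v && desc z v)).
- congr (Ex Q _); apply: Qs_indep_id => //.
  apply: indepW (Phi_indep F zV) => v /=; rewrite mem_filter => /andP[/andP[_ /andP[-> _]] ->] //.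
- by move=> v _; rewrite /Q; case: (desc z v); rewrite ?andbT ?andbF ?orbF.
- by move=> v _ /andP[_ /negP h] /andP[_].
- move=> v w _ _ /andP[_ nv] wv; rewrite negb_and; apply/orP; right.
  by apply: contra nv => dw; exact: desc_isparent dw wv.
Qed.

Lemma Ent_le_Phi F s : (forall s, 0 < F s) -> Ent V F s <= \sum_(z <- V) Qs K V (Phi z F) s.
Proof. by move=> F0; exact: Ent_desc. Qed.

Lemma Qs_suffix_absorb x F : x \in V -> Qs K V (Ex (suffix x) F) = Qs K V F.
Proof.
move=> xV; have H G : Qs K V G = Ex (fun v => ~~ suffix x v) (Ex (suffix x) G).
  have -> : Qs K V G = Ex xpredT G by rewrite /Ex filter_predT.
  apply: Ex_split => //.
  - by move=> v _; rewrite orNb.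
  - by move=> v _ /negP.
  - move=> v w _ _ nv wv; apply: contra nv => sw; exact: suffix_trans sw (isparent_suffix wv).
rewrite [LHS]H [RHS]H; congr (Ex (fun v => ~~ suffix x v) _); apply: Qs_indep_id => //; apply: Ex_indep_self => // v.
by rewrite /= mem_filter.
Qed.

(** If [A] and [B] are the values of the averaged function at the two spins, its variance is
    [p p' (A - B)^2] and its covariance with [phi] is [p p' (A - B)]; the inequality is
    [Ent_le_var]. *)
Lemma Phi_le x F s : x \in V -> (forall s, 0 < F s) ->
  Phi x F s <= Ex (suffix x) (fun s => F s * phi K x s) s ^+ 2 /
     (K x (par s x) true * K x (par s x) false * Ex (suffix x) F s).
Proof.
move=> xV F0; set G := Ex (desc x) F.
have G0 t : 0 < G t by exact: Ex_gt0.
apply: le_trans (Ent_le_var K_gt0 s (isT : topo [:: x]) G0) _.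
rewrite Ex_suffix // -/G /= {1 2}/Q.
have nx : ~~ desc x x by rewrite /desc eqxx andbF.
set p := K x (par s x) true; set p' := K x (par s x) false.
have pp : p' = 1 - p by have := K_sum x (par s x); rewrite -/p -/p'; lra.
have E1 a : Ex (desc x) (fun s => F s * phi K x s) (upd s x a) = (a%:R - p) * G (upd s x a).
  rewrite /G ExZ_at; apply: Ex_eq_at => // s' ss.
  by rewrite mulrC /phi (desc_par ss) par_upd_self -/p ss // upd_same.
rewrite !Ex_suffix // /Q !E1 -/p -/p' -/G /= mulr1n mulr0n.
move: (G (upd s x true)) (G (upd s x false)) (G0 (upd s x true)) (G0 (upd s x false)) => A B A0 B0.
have p0 : 0 < p by exact: K_gt0.
have p0' : 0 < p' by exact: K_gt0.
have d0 : 0 < p * A + p' * B by rewrite addr_gt0 // mulr_gt0.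
rewrite le_eqVlt; apply/orP; left; apply/eqP.
have n1 : p != 0 by rewrite gt_eqF.
have n2 : p' != 0 by rewrite gt_eqF.
have n3 : p * A + p' * B != 0 by rewrite gt_eqF.
move: n2 n3; rewrite pp => n2 n3.
by field; rewrite n1 n2 n3.
Qed.

End BlockEntropy.

(** The choice [c = X / (2 q)] replaces the true minimiser, the root of [p / q], which degenerates
    for [p = 0]. *)
Lemma sqr_le_of_scaled (R : realType) (X p q : R) : 0 <= X -> 0 <= p -> 0 < q ->
  (forall c, 0 < c -> X <= p / c + c * q) -> X ^+ 2 <= 4 * (p * q).
Proof.
move=> X0 p0 q0 h; case: (leP X 0) => [X1|X1].
  have -> : X = 0 by apply/eqP; rewrite eq_le X1.
  by rewrite expr0n /= mulr_ge0 // mulr_ge0 // ltW.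
have c0 : 0 < X / (2 * q) by rewrite divr_gt0 // mulr_gt0.
have := h _ c0.
have -> : p / (X / (2 * q)) + X / (2 * q) * q = (2 * (p * q)) / X + X / 2.
  by field; rewrite !gt_eqF.
move=> h1; have h2 : X / 2 <= 2 * (p * q) / X by lra.
move: h2; rewrite ler_pdivlMr // => h2.
by rewrite expr2; lra.
Qed.

(** * Forcing the spins of a block *)

Section LocalTerm.
Context (R : realType) (b : nat) (K : vertex b -> bool -> bool -> R).
Hypothesis K_gt0 : forall v p a, 0 < K v p a.
Hypothesis K_sum : forall v p, K v p true + K v p false = 1.
Context (V : seq (vertex b)).
Hypothesis V_uniq : uniq V.
Hypothesis V_sorted : level_sorted V.
Context (delta : R).
Hypothesis delta_gt0 : 0 < delta.
Hypothesis K_ge : forall v p a, delta <= K v p a.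
Implicit Types (v w x y z : vertex b) (s t : config b) (F G f k : config b -> R).
Implicit Types (l : seq (vertex b)) (P : pred (vertex b)).

Local Notation Ex := (Ex K V).
Local Notation Qs := (Qs K).

Lemma delta_le1 : delta <= 1.
Proof.
apply: le_trans (K_ge [::] true true) _.
by have := K_sum [::] true; have := K_gt0 [::] true false; lra.
Qed.

Lemma inv_delta_ge1 : 1 <= delta^-1.
Proof. by rewrite invf_ge1 // delta_le1. Qed.

(** Forcing the spin at [v] alters only the kernels of its children, each by a factor of at most
    [delta^-1]. *)
Lemma Qs_upd_le l k s v : v \notin l -> (forall s, 0 <= k s) ->
  Qs l (fun s => k (upd s v true)) s <= delta^-1 ^+ count (isparent v) l * Qs l k (upd s v true).
Proof.
move=> + k_ge0; elim: l s => [|w l IH] s; first by rewrite /= expr0 mul1r.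
rewrite inE negb_or => /andP[vw vl] /=; rewrite /Q.
have H a : K w (par s w) a * Qs l (fun s => k (upd s v true)) (upd s w a) <=
  delta^-1 ^+ (isparent v w + count (isparent v) l) *
   (K w (par (upd s v true) w) a * Qs l k (upd (upd s v true) w a)).
  have := IH (upd s w a) vl; rewrite [upd (upd s w a) v true]upd_comm 1?eq_sym //.
  set A := Qs l _ _; set B := Qs l k _ => AB.
  have B0 : 0 <= B by exact: Qs_ge0.
  have d0 : 0 <= delta^-1 ^+ count (isparent v) l by rewrite exprn_ge0 // invr_ge0 ltW.
  apply: (@le_trans _ _ (K w (par s w) a * (delta^-1 ^+ count (isparent v) l * B))); first by rewrite ler_pM2l.
  rewrite exprD mulrCA -!mulrA [X in _ <= X]mulrCA; apply: ler_wpM2l => //.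
  rewrite mulrA; apply: ler_wpM2r => //.
  rewrite par_upd; case: ifP => /= _; last by rewrite expr0 mul1r.
  rewrite expr1 mulrC ler_pdivlMr //.
  have := K_ge w true a; have := delta_gt0.
  have : K w (par s w) a <= 1.
    by apply: ltW; exact: K_lt1.
  by have := K_gt0 w (par s w) a; nra.
by have := lerD (H true) (H false); rewrite mulrDr.
Qed.

(** One factor for each child of the forced vertex and one for its own kernel. *)
Definition D0 : R := delta^-1 ^+ b.+1.

Lemma D0_ge1 : 1 <= D0.
Proof. by apply: exprn_ege1; exact: inv_delta_ge1. Qed.

Lemma count_children v l : uniq l -> (count (isparent v) l <= b)%N.
Proof.
move=> ul; rewrite -size_filter -[X in (_ <= X)%N](size_enum_ord b) -(size_map (fun i : 'I_b => i :: v)).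
apply: uniq_leq_size; first exact: filter_uniq.
move=> w; rewrite mem_filter => /andP[]; case: w => //= i w /eqP -> _.
by apply/mapP; exists i => //; rewrite mem_enum.
Qed.

Lemma Qs_upd_mem_le l k s v : uniq l -> v \in l -> (forall s, 0 <= k s) ->
  Qs l (fun s => k (upd s v true)) s <= D0 * Qs l k s.
Proof.
move=> + vl k_ge0; case/splitPr: vl => l1 l2 ul.
have vl2 : v \notin l2 by move: ul; rewrite cat_uniq /= => /and3P[_ _ /andP[]].
have ul2 : uniq l2 by move: ul; rewrite cat_uniq /= => /and3P[_ _ /andP[]].
rewrite !Qs_cat !Qs_cons.
have -> : D0 * Qs l1 (Q K v (Qs l2 k)) s = Qs l1 (fun s => D0 * Q K v (Qs l2 k) s) s by rewrite QsZ.
apply: Qs_le => // t; rewrite /Q.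
have d1 := inv_delta_ge1; have d0 : 0 <= delta^-1 by lra.
have H a : Qs l2 (fun s => k (upd s v true)) (upd t v a) <= delta^-1 ^+ b * Qs l2 k (upd t v true).
  apply: le_trans (Qs_upd_le _ vl2 k_ge0) _; rewrite upd_upd.
  apply: ler_wpM2r; first exact: Qs_ge0.
  by apply: ler_weXn2l => //; exact: count_children.
apply: (@le_trans _ _ (K v (par t v) true * (delta^-1 ^+ b * Qs l2 k (upd t v true)) +
   K v (par t v) false * (delta^-1 ^+ b * Qs l2 k (upd t v true)))).
  by apply: lerD; rewrite ler_pM2l.
rewrite -mulrDl K_sum mul1r /D0 exprSr -mulrA ler_wpM2l ?exprn_ge0 // mulrC ler_pdivlMr // mulrC.
apply: (@le_trans _ _ (K v (par t v) true * Qs l2 k (upd t v true))).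
  by apply: ler_wpM2r => //; exact: Qs_ge0.
by rewrite lerDl mulr_ge0 ?(ltW (K_gt0 _ _ _)) //; exact: Qs_ge0.
Qed.

(** After this substitution a function no longer reads the spins of [l]. It replaces a conditional
    expectation and has the merit of telescoping into changes of a single spin. *)
Fixpoint setall l s : config b := if l is v :: l' then upd (setall l' s) v true else s.

Lemma setall_indep P l F : (forall v, P v -> v \in l) -> indep P (fun s => F (setall l s)).
Proof.
move=> h s s' ss; congr F; apply/funext => w; case wl : (w \in l).
  elim: l {h ss} wl => //= v l IH; rewrite inE /upd; case: eqVneq => //= _ /IH; exact.
have nP : ~~ P w by apply/negP => /h; rewrite wl.
elim: l {h} wl => [|v l IH] /=; first by rewrite ss.
by rewrite inE /upd; case: eqVneq => //= _ /IH.
Qed.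

Lemma Ex_setall_le P l k s : {subset l <= seq.filter P V} -> (forall s, 0 <= k s) ->
  Ex P (fun s => k (setall l s)) s <= D0 ^+ size l * Ex P k s.
Proof.
have d1 := D0_ge1; have d0 : 0 <= D0 by lra.
elim: l k => [|v l IH] k sub k_ge0 /=; first by rewrite expr0 mul1r.
have sub' : {subset l <= seq.filter P V} by move=> w wl; apply: sub; rewrite inE wl orbT.
apply: le_trans (IH (fun s => k (upd s v true)) sub' (fun s => k_ge0 _)) _.
rewrite exprSr -mulrA ler_wpM2l 1?exprn_ge0 //.
by apply: (@Qs_upd_mem_le (seq.filter P V) k s v); rewrite ?filter_uniq //; apply: sub; rewrite inE eqxx.
Qed.

(** The comparison is with a plus at [v]: the gradient vanishes if the spin is a plus already, and
    is the difference across a flip otherwise. *)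
Definition grad f v s : R := f s - f (upd s v true).

(** One spin is forced at a time. Each change costs [|f^2 - g^2| <= D^2 / c + c (f^2 + g^2) / 2]
    with [D = |f - g|], and each spin forced before it costs a factor [D0]; [c] is optimised in
    [local_square]. *)
Lemma local_telescope P l f s (c : R) : {subset l <= seq.filter P V} -> (forall s, 0 < f s) -> 0 < c ->
  Ex P (fun s => `|f s ^+ 2 - f (setall l s) ^+ 2|) s <=
  D0 ^+ size l * ((\sum_(v <- l) Ex P (fun s => grad f v s ^+ 2) s) / c +
    c * ((size l)%:R * Ex P (fun s => f s ^+ 2) s)).
Proof.
have d1 := D0_ge1; have d0 : 0 <= D0 by lra.
move=> + f0 c0; elim: l => [_|v l IH sub] /=.
  rewrite big_nil mul0r mul0r mulr0 addr0 mulr0.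
  rewrite (_ : (fun s => _) = fun=> 0) ?Ex_cst //.
  by apply/funext => t; rewrite subrr normr0.
have sub' : {subset l <= seq.filter P V} by move=> w wl; apply: sub; rewrite inE wl orbT.
have {}IH := IH sub'.
set k := fun s => `|f s ^+ 2 - f (upd s v true) ^+ 2|.
have k_ge0 t : 0 <= k t by exact: normr_ge0.
apply: (@le_trans _ _ (Ex P (fun s => `|f s ^+ 2 - f (setall l s) ^+ 2|) s + Ex P (fun s => k (setall l s)) s)).
  by rewrite ExD_at; apply: Ex_le => // t; exact: ler_distD.
have h1 := @Ex_setall_le P l k s sub' k_ge0.
set E2 := Ex P (fun s => f s ^+ 2) s.
set Dv := Ex P (fun s => grad f v s ^+ 2) s.
have E20 : 0 <= E2 by apply: Ex_ge0 => // t; exact: sqr_ge0.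
have Dv0 : 0 <= Dv by apply: Ex_ge0 => // t; exact: sqr_ge0.
have h2 : Ex P k s <= D0 * (Dv / c + c * E2).
  have h3 : Ex P (fun s => f (upd s v true) ^+ 2) s <= D0 * E2.
    apply: (@Qs_upd_mem_le (seq.filter P V) (fun s => f s ^+ 2)); rewrite ?filter_uniq //.
      by apply: sub; rewrite inE eqxx.
    by move=> t; exact: sqr_ge0.
  apply: (@le_trans _ _ (Ex P (fun s => c^-1 * grad f v s ^+ 2 + (c / 2 * f s ^+ 2 + c / 2 * f (upd s v true) ^+ 2)) s)).
    apply: Ex_le => // t; rewrite /k subr_sqr normrM [X in _ * X]gtr0_norm ?addr_gt0 // -/(grad f v t).
    have := f0 t; have := f0 (upd t v true); move: (f t) (f (upd t v true)) => A B B0 A0.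
    rewrite -[X in _ <= c^-1 * X + _]real_normK ?num_real //; move: (`|_|) => D.
    rewrite -(ler_pM2l c0) !mulrDr !mulrA mulfV ?gt_eqF // mul1r.
    have := sqr_ge0 (2 * D - c * (A + B)); have := sqr_ge0 (c * (A - B)).
    by rewrite !expr2; lra.
  rewrite ExD ExD !ExZ -/Dv -/E2.
  have -> : D0 * (Dv / c + c * E2) = D0 * (c^-1 * Dv) + (c / 2 * (D0 * E2) + c / 2 * (D0 * E2)).
    by field; rewrite gt_eqF.
  have : c / 2 * Ex P (fun s => f (upd s v true) ^+ 2) s <= c / 2 * (D0 * E2).
    by apply: ler_wpM2l => //; lra.
  have : c / 2 * E2 <= c / 2 * (D0 * E2) by apply: ler_wpM2l; [lra|rewrite ler_peMl].
  have : c^-1 * Dv <= D0 * (c^-1 * Dv) by rewrite ler_peMl // mulr_ge0 // invr_ge0 ltW.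
  lra.
rewrite big_cons exprSr -/Dv.
set Al := \sum_(j <- l) _ in IH *; move: IH; rewrite -/E2 => IH.
have Al0 : 0 <= Al by apply: sumr_ge0 => j _; apply: Ex_ge0 => // t; exact: sqr_ge0.
have dn0 : 0 <= D0 ^+ size l by rewrite exprn_ge0.
have h4 : D0 ^+ size l * Ex P k s <= D0 ^+ size l * (D0 * (Dv / c + c * E2)) by exact: ler_wpM2l.
have h5 : D0 ^+ size l * (Al / c + c * ((size l)%:R * E2)) <=
   D0 ^+ size l * (D0 * (Al / c + c * ((size l)%:R * E2))).
  apply: ler_wpM2l => //; rewrite ler_peMl // addr_ge0 // ?divr_ge0 ?(ltW c0) //.
  by rewrite mulr_ge0 ?(ltW c0) // mulr_ge0.
have -> : D0 ^+ size l * D0 * ((Dv + Al) / c + c * ((size l).+1%:R * E2)) =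
   D0 ^+ size l * (D0 * (Al / c + c * ((size l)%:R * E2))) +
   D0 ^+ size l * (D0 * (Dv / c + c * E2)).
  by rewrite -natr1; ring.
by apply: lerD (le_trans IH h5) (le_trans h1 h4).
Qed.

Lemma local_square P l f s : {subset l <= seq.filter P V} -> (forall s, 0 < f s) -> (0 < size l)%N ->
  Ex P (fun s => `|f s ^+ 2 - f (setall l s) ^+ 2|) s ^+ 2 <=
  4 * (D0 ^+ size l) ^+ 2 * (size l)%:R *
   ((\sum_(v <- l) Ex P (fun s => grad f v s ^+ 2) s) * Ex P (fun s => f s ^+ 2) s).
Proof.
move=> sub f0 l0.
have d1 := D0_ge1; have d0 : 0 < D0 by lra.
have dn0 : 0 < D0 ^+ size l by rewrite exprn_gt0.
set A := \sum_(j <- l) _; set E2 := Ex P (fun s => f s ^+ 2) s.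
have E20 : 0 < E2 by apply: Ex_gt0 => // t; rewrite exprn_gt0.
have A0 : 0 <= A by apply: sumr_ge0 => j _; apply: Ex_ge0 => // t; exact: sqr_ge0.
have -> : 4 * (D0 ^+ size l) ^+ 2 * (size l)%:R * (A * E2) =
   4 * ((D0 ^+ size l * A) * (D0 ^+ size l * ((size l)%:R * E2))) by ring.
apply: sqr_le_of_scaled.
- by apply: Ex_ge0 => // t; exact: normr_ge0.
- by rewrite mulr_ge0 // ltW.
- by rewrite !mulr_gt0 // ltr0n.
- move=> c c0; apply: le_trans (local_telescope s sub f0 c0) _.
  by rewrite -/A -/E2 le_eqVlt; apply/orP; left; apply/eqP; ring.
Qed.

End LocalTerm.

Section LogSobolev.
Context (R : realType) (b : nat) (K : vertex b -> bool -> bool -> R).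
Hypothesis K_gt0 : forall v p a, 0 < K v p a.
Hypothesis K_sum : forall v p, K v p true + K v p false = 1.
Context (V : seq (vertex b)).
Hypothesis V_uniq : uniq V.
Hypothesis V_sorted : level_sorted V.
Context (r : vertex b) (m : nat).
Hypothesis V_mem : forall v, (v \in V) = suffix r v && (size v <= size r + m)%N.
Context (beta : R) (u : vertex b -> R).
Hypothesis beta_ge0 : 0 <= beta.
Hypothesis K_true : forall v p, v != r -> v \in V -> K v p true = logis (u v + 2 * beta * spin R p).
Context (rho : R) (k0 : nat).
Hypothesis rho_ge0 : 0 <= rho.
Hypothesis k0_gt0 : (0 < k0)%N.
Hypothesis contracting : forall v, v \in V -> (size v + k0 <= size r + m)%N ->
  b%:R * theta beta * kap beta (u v) <= rho.
Implicit Types (v x y z : vertex b) (s : config b) (F G : config b -> R).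
Implicit Types (P : pred (vertex b)).

Context (delta : R).
Hypothesis delta_gt0 : 0 < delta.
Hypothesis K_ge : forall v p a, delta <= K v p a.

Local Notation Ex := (Ex K V).
Local Notation Ent := (Ent K).
Local Notation Phi := (Phi K V).
Local Notation M := (Mb b beta).
Local Notation S2 := (S2 b beta rho).
Local Notation D0 := (D0 b delta).
Local Notation eps_ent := (eps_ent b beta).

Lemma K_prod_ge v p : delta / 2 <= K v p true * K v p false.
Proof.
have := K_sum v p; have := K_ge v p true; have := K_ge v p false; have := delta_gt0.
move: (K _ _ _) (K _ _ _) => p1 p2 d0 h1 h2 h3.
have [h|h] := leP p1 2^-1.
  have : p1 * 2^-1 <= p1 * p2 by apply: ler_wpM2l; lra.
  lra.
have : 2^-1 * p2 <= p1 * p2 by apply: ler_wpM2r; lra.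
lra.
Qed.

Lemma Phi_step l i NB x f s (q t0 : R) : let N := (i + l + k0).+1 in
  0 < q -> S2 l <= q ^+ 2 -> S2 (i + l) <= q ^+ 2 -> 0 < t0 ->
  x \in V -> (size (seq.filter (block x N) V) <= NB)%N -> (forall s, 0 < f s) ->
  Phi x (fun s => f s ^+ 2) s <=
  (2 / delta) * (8 * (4 * (D0 ^+ NB) ^+ 2 * NB%:R) *
       (\sum_(v <- V | block x N v) Ex (suffix x) (fun s => grad f v s ^+ 2) s) +
     2 * eps_ent q t0 i * (\sum_(z <- V | block x N z) Ex (suffix x) (Phi z (fun s => f s ^+ 2)) s)).
Proof.
move=> N q0 hq hq' t00 xV hNB f0; set F := fun s => f s ^+ 2.
have F0 t : 0 < F t by rewrite exprn_gt0.
apply: le_trans (Phi_le K_gt0 K_sum V_uniq V_sorted s xV F0) _.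
set a := Ex (suffix x) F s.
have a0 : 0 < a by exact: Ex_gt0.
set X := Ex (suffix x) _ s; set pp := K x _ true * _.
have d0 := delta_gt0.
have pp0 : delta / 2 <= pp by exact: K_prod_ge.
set lx := seq.filter (block x N) V in hNB *.
set A := \sum_(v <- V | _) _; set B := \sum_(v <- V | _) _.
have e0 : 0 <= eps_ent q t0 i.
  rewrite !addr_ge0 // ?divr_ge0 ?(ltW t00) // ?mulr_ge0 ?exprn_ge0 ?expR_ge0 ?theta_ge0 // ltW //.
have D1 : 1 <= D0 := D0_ge1 K_gt0 K_sum delta_gt0 K_ge.
have dn n : 0 <= D0 ^+ n by apply: exprn_ge0; lra.
have A0 : 0 <= A by apply: sumr_ge0 => v _; apply: Ex_ge0 => // t; exact: sqr_ge0.
have B0 : 0 <= B by apply: sumr_ge0 => v _; apply: Ex_ge0 => // t; exact: Phi_ge0.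
set CL := 4 * _ * _.
set Y := Ex (suffix x) (fun s => `|F s - F (setall lx s)|) s.
have Y0 : 0 <= Y by apply: Ex_ge0 => // t; exact: normr_ge0.
have hY : Y ^+ 2 <= CL * (A * a).
  have sub : {subset lx <= seq.filter (suffix x) V}.
    by move=> v; rewrite !mem_filter => /andP[/andP[-> _] ->].
  have l0 : (0 < size lx)%N.
    have : x \in lx by rewrite mem_filter /block suffix_refl xV -[X in (X < _)%N]addn0 ltn_add2l.
    by move: (lx) => -[].
  apply: le_trans (local_square K_gt0 K_sum V_uniq delta_gt0 K_ge s sub f0 l0) _.
  rewrite /lx big_filter -/A -/a; apply: ler_wpM2r; first by rewrite mulr_ge0 // ltW.
  rewrite /CL; apply: ler_pM => //.
  - by rewrite mulr_ge0 // sqr_ge0.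
  - by rewrite ler_pM2l // ler_sqr ?nnegrE ?dn //; exact: ler_weXn2l.
  - by rewrite ler_nat.
suff hX : X ^+ 2 <= a * (8 * CL * A + 2 * eps_ent q t0 i * B).
  rewrite ler_pdivrMr; last by rewrite mulr_gt0 //; apply: lt_le_trans pp0; lra.
  set S := 8 * CL * A + _ in hX *.
  have S0 : 0 <= S.
    rewrite addr_ge0 // mulr_ge0 //; first by rewrite mulr_ge0 // mulr_ge0 // mulr_ge0 // sqr_ge0.
    by rewrite mulr_ge0.
  apply: le_trans hX _.
  have -> : 2 / delta * S * (pp * a) = (a * S) * (pp * (2 / delta)) by ring.
  by rewrite ler_peMr ?mulr_ge0 ?(ltW a0) // mulrA ler_pdivlMr // mul1r; lra.
have Fphi c (k : config b -> R) : (forall t, `|k t| <= c) ->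
   `|Ex (suffix x) (fun s => (F s - F (setall lx s)) * k s) s| <= c * Y.
  move=> kc; have h : `|Ex (suffix x) (fun s => (F s - F (setall lx s)) * k s) s| <=
    Ex (suffix x) (fun s => `|(F s - F (setall lx s)) * k s|) s by exact: Qs_norm.
  apply: le_trans h _; rewrite /Y ExZ_at; apply: Ex_le => // t.
  by rewrite normrM mulrC ler_wpM2r.
have phi1 t : `|phi K x t| <= 1.
  rewrite /phi; have := K_gt0 x (par t x) true; have := K_lt1 K_gt0 K_sum x (par t x) true.
  by move: (K _ _ _) => p *; case: (t x); rewrite ?mulr1n ?mulr0n ler_norml; apply/andP; split; lra.
have [deep|shallow] := leqP (size x + (i + l) + k0) (size r + m); last first.
  have E : X = Ex (suffix x) (fun s => (F s - F (setall lx s)) * phi K x s) s.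
    have -> : (fun s => (F s - F (setall lx s)) * phi K x s) =
       fun s => F s * phi K x s - F (setall lx s) * phi K x s by apply/funext => t; rewrite mulrBl.
    rewrite ExB; have -> : Ex (suffix x) (fun s => F (setall lx s) * phi K x s)
        = fun s => F (setall lx s) * Ex (suffix x) (phi K x) s.
      apply: Qs_pull; apply: setall_indep => v; rewrite /= !mem_filter => /andP[sv vV].
      rewrite /block sv vV andbT /=; move: vV; rewrite V_mem => /andP[_ vm].
      by rewrite /N addnS ltnS; apply: leq_trans vm _; apply: ltnW; rewrite addnA.
    by rewrite phi_mean // mulr0 subr0.
  have h1 : `|X| <= 1 * Y by rewrite E; exact: Fphi.
  have h2 : X ^+ 2 <= Y ^+ 2.
    by rewrite -[X ^+ 2]real_normK ?num_real // lerXn2r ?nnegrE //; rewrite mul1r in h1.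
  have h3 : 0 <= a * (2 * eps_ent q t0 i * B) by rewrite mulr_ge0 ?(ltW a0) // mulr_ge0 // mulr_ge0.
  have h4 : 0 <= CL * (A * a) by apply: le_trans hY; exact: sqr_ge0.
  by rewrite mulrDr; lra.
have hx1 : (size x + (i + l).+1 <= size r + m)%N by apply: leq_trans deep; rewrite addnS -addn1 leq_add2l.
have ic : indep (block x (i + l).+1) (fun s => F (setall lx s)).
  apply: setall_indep => v /andP[sv hv]; rewrite mem_filter /block sv /= V_mem.
  rewrite (leq_trans hv) ?leq_add2l ?ltnS ?leq_addr //=; apply/andP; split.
    by apply: suffix_trans sv; move: xV; rewrite V_mem => /andP[].
  by apply: ltnW; apply: leq_trans hv _.
set psx := psi K beta u (i + l) x.
have psi1 t : `|psx t| <= 1 by exact: psi_le1.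
have E : X = Ex (suffix x) (fun s => (F s - F (setall lx s)) * (phi K x s - psx s)) s
   + Ex (suffix x) (fun s => F s * psx s) s.
  have -> : (fun s => (F s - F (setall lx s)) * (phi K x s - psx s)) =
     fun s => F s * phi K x s - F s * psx s - (F (setall lx s) * phi K x s - F (setall lx s) * psx s).
    by apply/funext => t; ring.
  rewrite !ExB -(psi_orth K_gt0 K_sum V_uniq V_sorted V_mem beta_ge0 K_true s xV hx1 ic) -/X -/psx; ring.
set X1 := Ex (suffix x) _ s in E; set X2 := Ex (suffix x) _ s in E.
have h1 : `|X1| <= 2 * Y.
  apply: Fphi => t; apply: le_trans (ler_normB _ _) _.
  by have := phi1 t; have := psi1 t; lra.
have h2 : X1 ^+ 2 <= 4 * Y ^+ 2.
  rewrite -[X1 ^+ 2]real_normK ?num_real //.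
  have -> : 4 * Y ^+ 2 = (2 * Y) ^+ 2 by ring.
  by rewrite lerXn2r ?nnegrE // mulr_ge0.
have h3 : X2 ^+ 2 <= eps_ent q t0 i * (a * B).
  apply: le_trans (cov_contraction K_gt0 K_sum V_uniq V_sorted V_mem beta_ge0 K_true rho_ge0 k0_gt0 contracting s q0 hq hq' t00 xV deep F0) _.
  rewrite ler_wpM2l // -/a ler_pM2l //.
  (* This block has [(i + l).+2] levels, at most [N] because [0 < k0]. *)
  apply: le_trans (Ent_block_le K_gt0 K_sum V_uniq V_sorted x _ s F0) _.
  rewrite /B [leLHS]big_mkcond [leRHS]big_mkcond /=; apply: ler_sum => z _.
  have P0 : 0 <= Ex (suffix x) (Phi z F) s by apply: Ex_ge0 => // t; exact: Phi_ge0.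
  case: ifP; case: ifP => // /negP nb bz; exfalso; apply: nb.
  case/andP: bz => sz hz; apply/andP; split => //; apply: leq_trans hz _.
  by rewrite leq_add2l ltnS -addn1 leq_add2l.
have h4 : X ^+ 2 <= 2 * X1 ^+ 2 + 2 * X2 ^+ 2.
  by rewrite E; have := sqr_ge0 (X1 - X2); rewrite !expr2; lra.
rewrite mulrDr; move: hY h2 h3 h4; move: (Y ^+ 2) (X ^+ 2) (X1 ^+ 2) (X2 ^+ 2) => *; lra.
Qed.

(** Such [x] are the suffixes [drop j z] with [j < N]: the vertex [z] and its nearest ancestors. *)
Lemma count_ancestors N z : (count (fun x => block x N z) V <= N)%N.
Proof.
rewrite -size_filter -[X in (_ <= X)%N](size_iota 0 N) -(size_map (fun j => drop j z)).
apply: uniq_leq_size; first exact: filter_uniq.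
move=> x; rewrite mem_filter => /andP[/andP[/suffixP[t ->] h] _].
apply/mapP; exists (size t); last by rewrite drop_size_cat.
by rewrite mem_iota /=; move: h; rewrite size_cat addnC ltn_add2l.
Qed.

Lemma sum_block_le N (g : vertex b -> R) : (forall z, 0 <= g z) ->
  \sum_(x <- V) \sum_(z <- V | block x N z) g z <= N%:R * \sum_(z <- V) g z.
Proof.
move=> g0; have -> : \sum_(x <- V) \sum_(z <- V | block x N z) g z =
    \sum_(z <- V) \sum_(x <- V | block x N z) g z.
  by rewrite (exchange_big_dep xpredT).
rewrite mulr_sumr; apply: ler_sum => z _.
rewrite big_const_seq iter_addr addr0 -[_ *+ count _ _]mulr_natl ler_wpM2r // ler_nat.
exact: count_ancestors.
Qed.

(** Sums [Phi_step] over [x]. Every vertex is counted in at most [N] blocks, so the far parts add up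
    to at most half of the sum [S] itself and are absorbed on the left. *)
Lemma LSI_sum l i NB f s (q t0 : R) : let N := (i + l + k0).+1 in
  0 < q -> S2 l <= q ^+ 2 -> S2 (i + l) <= q ^+ 2 -> 0 < t0 ->
  (forall x, x \in V -> (size (seq.filter (block x N) V) <= NB)%N) -> (forall s, 0 < f s) ->
  (2 / delta) * (2 * eps_ent q t0 i) * N%:R <= 2^-1 ->
  Ent V (fun s => f s ^+ 2) s <=
  2 * ((2 / delta) * (8 * (4 * (D0 ^+ NB) ^+ 2 * NB%:R)) * N%:R) *
    \sum_(v <- V) Qs K V (fun s => grad f v s ^+ 2) s.
Proof.
move=> N q0 hq hq' t00 hNB f0 heps; set F := fun s => f s ^+ 2.
have F0 t : 0 < F t by rewrite exprn_gt0.
apply: le_trans (Ent_le_Phi K_gt0 K_sum V_uniq V_sorted s F0) _.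
set S := \sum_(z <- V) _; set D := \sum_(v <- V) _.
set c1 := 8 * (4 * (D0 ^+ NB) ^+ 2 * NB%:R); set c2 := 2 * eps_ent q t0 i.
have d0 := delta_gt0.
have D1 : 1 <= D0 := D0_ge1 K_gt0 K_sum delta_gt0 K_ge.
have g0 z : 0 <= Qs K V (Phi z F) s by apply: Qs_ge0 => // t; exact: Phi_ge0.
have g1 v : 0 <= Qs K V (fun s => grad f v s ^+ 2) s by apply: Qs_ge0 => // t; exact: sqr_ge0.
have c10 : 0 <= 2 / delta * c1.
  apply: mulr_ge0; first by rewrite divr_ge0 ?(ltW d0).
  by rewrite /c1 mulr_ge0 // mulr_ge0 // mulr_ge0 // sqr_ge0.
have c20 : 0 <= 2 / delta * c2.
  apply: mulr_ge0; first by rewrite divr_ge0 ?(ltW d0).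
  rewrite /c2 mulr_ge0 //.
  rewrite !addr_ge0 // ?divr_ge0 ?(ltW t00) // ?mulr_ge0 ?exprn_ge0 ?expR_ge0 ?theta_ge0 // ltW //.
suff : S <= (2 / delta * c1) * (N%:R * D) + (2 / delta * c2) * (N%:R * S).
  have S0 : 0 <= S by apply: sumr_ge0.
  have : 2 / delta * c2 * N%:R * S <= 2^-1 * S by exact: ler_wpM2r.
  by move: (2 / delta * c1) (2 / delta * c2) => *; lra.
apply: (@le_trans _ _ (\sum_(x <- V) ((2 / delta * c1) * (\sum_(v <- V | block x N v) Qs K V (fun s => grad f v s ^+ 2) s)
   + (2 / delta * c2) * (\sum_(z <- V | block x N z) Qs K V (Phi z F) s)))).
  rewrite /S [leLHS]big_seq [leRHS]big_seq; apply: ler_sum => x xV.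
  apply: (@le_trans _ _ (Qs K V (fun s => (2 / delta * c1) * (\sum_(v <- V | block x N v) Ex (suffix x) (fun s => grad f v s ^+ 2) s)
   + (2 / delta * c2) * (\sum_(z <- V | block x N z) Ex (suffix x) (Phi z F) s)) s)).
    apply: Qs_le => // t; apply: le_trans (@Phi_step l i NB x f t q t0 q0 hq hq' t00 xV (hNB x xV) f0) _.
    by rewrite -/c1 -/c2 mulrDr !mulrA.
  rewrite QsD !QsZ !Qs_sum le_eqVlt; apply/orP; left; apply/eqP.
  by congr (_ * _ + _ * _); apply: eq_bigr => v _; rewrite Qs_suffix_absorb.
rewrite big_split /= -!mulr_sumr; apply: lerD; apply: ler_wpM2l => //; exact: sum_block_le.
Qed.

End LogSobolev.

(** * Choice of the depth and of the constants *)

Lemma exists_expr_le (R : realType) (x e : R) : 0 <= x < 1 -> 0 < e -> exists n, x ^+ n <= e.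
Proof.
move=> /andP[x0 x1] e0; have h : `|x| < 1 by rewrite ger0_norm.
have /cvgrPdist_le /(_ e e0) [n _ /(_ n (leqnn n))] := cvg_expr h.
by rewrite /= sub0r normrN ger0_norm ?exprn_ge0 // => ?; exists n.
Qed.

Lemma exists_natmul_ge (R : realType) (x y : R) : 0 < x -> exists n : nat, y <= x * n%:R.
Proof.
move=> x0; exists (Num.bound `|y / x|).
rewrite mulrC -ler_pdivrMr //; apply: le_trans (ler_norm _) _.
by apply: ltW; apply: archi_boundP; exact: normr_ge0.
Qed.

Lemma size_block_le (b : nat) (V : seq (vertex b)) (x : vertex b) N : uniq V ->
  (size (seq.filter (block x N) V) <= #|{: N.-bseq 'I_b}|)%N.
Proof.
move=> uV; rewrite cardE -(size_map (fun w : N.-bseq 'I_b => val w ++ x)).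
apply: uniq_leq_size; first exact: filter_uniq.
move=> v; rewrite mem_filter => /andP[/andP[/suffixP[t ->] h] _].
have st : (size t <= N)%N by move: h; rewrite size_cat addnC ltn_add2l => /ltnW.
by apply/mapP; exists (Bseq st); rewrite ?mem_enum.
Qed.

(** Uses [y^3 / 6 <= expR y] at [y = lam * l / 4], whose cube beats [l^2]; the constant [64 * 24] is
    [4^3 * 6 * 4]. *)
Lemma sqr_expR_decay (R : realType) (c lam : R) : 0 < lam -> exists n : nat, forall l : nat, (n < l)%N ->
  c * (l%:R ^+ 2 * expR (- (lam * l%:R / 4))) <= 4^-1.
Proof.
move=> lam0; have [n hn] := @exists_natmul_ge R (lam ^+ 3) (c * (64 * 24)) (exprn_gt0 3 lam0).
exists n => l nl; have l0 : (0 : R) < l%:R by rewrite ltr0n; apply: leq_ltn_trans nl.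
have h5 : c * (64 * 24) <= lam ^+ 3 * l%:R.
  by apply: le_trans hn _; rewrite ler_pM2l ?exprn_gt0 // ler_nat ltnW.
move: (l%:R : R) l0 h5 => {nl}L l0 h5 {hn n l}.
set y := lam * L / 4; have y0 : 0 < y by rewrite divr_gt0 // mulr_gt0.
have h3 := @expR_ge1Dxn R y 2 (ltW y0).
have e0 := expR_gt0 y.
rewrite expRN mulrA ler_pdivrMr //.
have h4 : y ^+ 3 / 6 <= expR y by apply: le_trans h3; rewrite -[leLHS]add0r lerD.
have h6 : c * L ^+ 2 <= 4^-1 * (y ^+ 3 / 6).
  have -> : 4^-1 * (y ^+ 3 / 6) = (lam ^+ 3 * L) / (64 * 24) * L ^+ 2.
    by rewrite /y; field.
  by rewrite ler_pM2r ?exprn_gt0 // ler_pdivlMr.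
by apply: le_trans h6 _; rewrite ler_pM2l.
Qed.

Lemma geometric_expR (R : realType) (rho : R) : 0 <= rho -> rho < 1 ->
  exists2 lam : R, 0 < lam & forall n, rho ^+ n <= expR (- (lam * n%:R)).
Proof.
move=> r0 r1; set r := Num.max rho 2^-1.
have r_gt0 : 0 < r by rewrite lt_max invr_gt0 ltr0n orbT.
have r_lt1 : r < 1 by rewrite gt_max r1 /=; lra.
exists (- ln r) => [|n]; first by rewrite oppr_gt0 ln_lt0 // r_gt0.
rewrite mulNr opprK expRM_natr lnK ?posrE //.
by rewrite lerXn2r ?nnegrE ?(ltW r_gt0) // le_max lexx.
Qed.

(** [L], [ti] and [B] stand for [l], [theta^i] and [b^i]. The term [2 / t0] with [t0 = A * L] has no
    exponential decay; with [N] replaced by [2 * L], the value [A = 128 / delta] makes its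
    contribution exactly [1/8], and the two exponentially small terms contribute at most [1/4]. *)
Lemma eps_bound (R : realType) (delta A C0 M lam L N B ti q : R) :
  0 < delta -> A = 128 / delta -> 0 < C0 -> 0 < lam -> 1 <= L -> 0 <= N -> N <= 2 * L ->
  0 <= B -> 0 <= ti -> ti <= 1 -> A * ti * M <= lam / 4 -> q = Num.sqrt C0 * expR (- (lam * L / 2)) ->
  ((4 / delta) * 2 * 8 * C0 + (4 / delta) * 2 * 16 * B * A * 2 * Num.sqrt C0) *
    (L ^+ 2 * expR (- (lam * L / 4))) <= 4^-1 ->
  (2 / delta) * (2 * (4 * (2 * q ^+ 2) + 2 / (A * L) + 16 * (B * (A * L * ti * expR (A * L * ti * M) * (2 * q))))) * N <= 2^-1.
Proof.
move=> d0 AE C00 lam0 l1 N0 Nl B0 ti0 ti1 hiM qdef key.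
have l0 : 0 < L by apply: lt_le_trans l1.
have A0 : 0 < A by rewrite AE divr_gt0 ?ltr0n.
have sC0 : 0 < Num.sqrt C0 by rewrite sqrtr_gt0.
have q0 : 0 < q by rewrite qdef mulr_gt0 // expR_gt0.
have qE : q ^+ 2 = C0 * expR (- (lam * L)).
  rewrite qdef exprMn sqr_sqrtr ?(ltW C00) // -expRM_natl; congr (_ * expR _); by field.
set E := expR (- (lam * L / 4)) in key *.
have E0 : 0 < E by exact: expR_gt0.
set T1 := 4 * (2 * q ^+ 2); set T3 := (X in _ + _ + X); set T2 := 2 / (A * L).
have hT1 : T1 <= 8 * C0 * (L * E).
  rewrite /T1 qE; have -> : 4 * (2 * (C0 * expR (- (lam * L)))) = 8 * C0 * expR (- (lam * L)) by ring.
  rewrite ler_pM2l ?mulr_gt0 //; apply: (@le_trans _ _ E); last by rewrite ler_peMl // ltW.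
  by rewrite ler_expR; have : 0 < lam * L by [exact: mulr_gt0]; lra.
have hT3 : T3 <= 16 * B * A * 2 * Num.sqrt C0 * (L * E).
  have hexp : expR (A * L * ti * M) * expR (- (lam * L / 2)) <= E.
    rewrite -expRD ler_expR.
    have : A * L * ti * M <= lam / 4 * L.
      have -> : A * L * ti * M = A * ti * M * L by ring.
      by apply: ler_wpM2r => //; exact: ltW.
    by lra.
  have -> : T3 = (16 * B * A * 2 * Num.sqrt C0 * L) * (ti * (expR (A * L * ti * M) * expR (- (lam * L / 2)))).
    by rewrite /T3 qdef; ring.
  rewrite [leRHS]mulrA; apply: ler_wpM2l; first by rewrite !mulr_ge0 ?(ltW A0) ?(ltW sC0) // ltW.
  by rewrite -[leRHS]mul1r; apply: ler_pM => //; rewrite mulr_ge0 ?expR_ge0.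
have T10 : 0 <= T1 by rewrite /T1 mulr_ge0 // mulr_ge0 // sqr_ge0.
have T20 : 0 <= T2 by rewrite divr_ge0 // ltW // mulr_gt0.
have T30 : 0 <= T3.
  rewrite /T3 mulr_ge0 // ?mulr_ge0 // ?expR_ge0 //; do ?exact: ltW.
have e2 : 4 / delta * (2 * L) * T2 = 8^-1.
  by rewrite /T2 AE; field; rewrite !gt_eqF.
have p0 : 0 <= 4 / delta by rewrite divr_ge0 // ltW.
have -> : 2 / delta * (2 * (T1 + T2 + T3)) * N = 4 / delta * (T1 + T2 + T3) * N by ring.
apply: (@le_trans _ _ (4 / delta * (T1 + T2 + T3) * (2 * L))).
  by apply: ler_wpM2l => //; rewrite mulr_ge0 // !addr_ge0.
have -> : 4 / delta * (T1 + T2 + T3) * (2 * L) = 8^-1 + 4 / delta * (2 * L) * (T1 + T3).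
  by rewrite -e2; ring.
have p1 : 0 <= 4 / delta * (2 * L) by rewrite mulr_ge0 // mulr_ge0 // ltW.
have := ler_wpM2l p1 (lerD hT1 hT3).
have -> : 4 / delta * (2 * L) * (8 * C0 * (L * E) + 16 * B * A * 2 * Num.sqrt C0 * (L * E)) =
  (4 / delta * 2 * 8 * C0 + 4 / delta * 2 * 16 * B * A * 2 * Num.sqrt C0) * (L ^+ 2 * E) by ring.
move: key; lra.
Qed.

Lemma S2_le (R : realType) (b : nat) (beta rho C lam L : R) n' : 0 <= beta -> 
  expR (Mb b beta) * (expR (Mb b beta) * Mb b beta) <= C -> rho ^+ n' <= expR (- (lam * L)) ->
  S2 b beta rho n' <= C * expR (- (lam * L)).
Proof.
move=> b0 hC hr; rewrite /S2; have := @Mb_ge0 R b beta b0.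
set M := Mb b beta in hC *; move=> M0.
have -> : expR M * (expR M * (rho ^+ n' * M)) = (expR M * (expR M * M)) * rho ^+ n' by ring.
have h : 0 <= expR M * (expR M * M) by rewrite !mulr_ge0 // expR_ge0.
apply: (le_trans (ler_wpM2l h hr)); apply: ler_wpM2r => //; exact: expR_ge0.
Qed.

Lemma exists_large n i k : exists l, (n < l)%N /\ (i + l + k < l * 2)%N.
Proof. exists (n + i + k).+1; lia. Qed.

(** The order of the choices matters: [A] depends on [delta] only, then [i] is taken so large that
    [A * theta^i * M <= lam / 4], and [l] comes last, when [b^i] is already a constant. *)
Lemma contraction_constants (R : realType) (b k0 : nat) (beta delta rho : R) :
  0 <= beta -> 0 < delta -> 0 <= rho -> rho < 1 ->
  exists i l : nat, exists q t0 : R,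
    [/\ 0 < q, S2 b beta rho l <= q ^+ 2, S2 b beta rho (i + l) <= q ^+ 2, 0 < t0 &
     (2 / delta) * (2 * eps_ent b beta q t0 i) * (i + l + k0).+1%:R <= 2^-1].
Proof.
move=> b0 d0 r0 r1.
set M := Mb b beta; have M0 : 0 <= M by exact: Mb_ge0.
have th0 := theta_ge0 b0; have th1 := theta_lt1 beta.
have [lam lam0 rE] := geometric_expR r0 r1.
set C0 := expR M * (expR M * M) + 1.
have C00 : 0 < C0 by rewrite ltr_pwDr // !mulr_ge0 // expR_ge0.
have [A AE] : exists A, A = 128 / delta by eexists.
have A0 : 0 < A by rewrite AE divr_gt0 ?ltr0n.
have M10 : 0 < M + 1 by rewrite ltr_pwDr.
have [i hi] : exists i, theta beta ^+ i <= lam / 4 / (A * (M + 1)).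
  apply: exists_expr_le; first by rewrite th0 th1.
  by rewrite divr_gt0 ?divr_gt0 // mulr_gt0.
have hiM : A * theta beta ^+ i * M <= lam / 4.
  apply: (@le_trans _ _ (theta beta ^+ i * (A * (M + 1)))).
    rewrite -mulrA mulrCA; apply: ler_wpM2l; first exact: exprn_ge0.
    by apply: ler_wpM2l; [exact: ltW|rewrite lerDl].
  by rewrite -ler_pdivlMr // mulr_gt0.
have [n hn] := @sqr_expR_decay R ((4 / delta) * 2 * 8 * C0 + (4 / delta) * 2 * 16 * b%:R ^+ i * A * 2 * Num.sqrt C0) lam lam0.
have [l [ln lik]] := exists_large n i k0.
have l1 : (1 : R) <= l%:R by rewrite ler1n; apply: leq_trans ln.
have l0 : (0 : R) < l%:R by exact: lt_le_trans l1.
set q := Num.sqrt C0 * expR (- (lam * l%:R / 2)).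
have q0 : 0 < q by rewrite mulr_gt0 ?sqrtr_gt0 // expR_gt0.
have S2q n' : (l <= n')%N -> S2 b beta rho n' <= q ^+ 2.
  move=> ll; have -> : q ^+ 2 = C0 * expR (- (lam * l%:R)).
    rewrite exprMn sqr_sqrtr ?(ltW C00) // -expRM_natl; congr (_ * expR _); by field.
  apply: S2_le => //; first by rewrite /C0 lerDl.
  by apply: le_trans (rE n') _; rewrite ler_expR lerN2 ler_pM2l // ler_nat.
exists i, l, q, (A * l%:R); split => //.
- exact: S2q.
- by apply: S2q; rewrite leq_addl.
- exact: mulr_gt0.
rewrite /eps_ent -/M; apply: (@eps_bound R delta A C0 M lam l%:R) => //.
- by rewrite mulrC -natrM ler_nat.
- exact: exprn_ge0.
- by apply: exprn_ile1 => //; exact: ltW.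
exact: hn.
Qed.

Theorem tree_LSI (R : realType) (b k0 : nat) (beta delta rho : R) :
  0 <= beta -> 0 < delta -> 0 <= rho -> rho < 1 -> (0 < k0)%N ->
  exists2 C : R, 0 < C &
  forall (K : vertex b -> bool -> bool -> R) (V : seq (vertex b)) (r : vertex b) (m : nat) (u : vertex b -> R),
    (forall v p a, delta <= K v p a) -> (forall v p, K v p true + K v p false = 1) ->
    uniq V -> level_sorted V -> (forall v, (v \in V) = suffix r v && (size v <= size r + m)%N) ->
    (forall v p, v != r -> v \in V -> K v p true = logis (u v + 2 * beta * spin R p)) ->
    (forall v, v \in V -> (size v + k0 <= size r + m)%N -> b%:R * theta beta * kap beta (u v) <= rho) ->
    forall (f : config b -> R) s, (forall s, 0 < f s) ->
      Ent K V (fun s => f s ^+ 2) s <= C * \sum_(v <- V) Qs K V (fun s => grad f v s ^+ 2) s.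
Proof.
move=> b0 d0 r0 r1 k0_gt0.
have [i [l [q [t0 [q0 hq hq' t00 heps]]]]] := @contraction_constants R b k0 beta delta rho b0 d0 r0 r1.
set NB := #|{: (i + l + k0).+1.-bseq 'I_b}|.
set C := 2 * ((2 / delta) * (8 * (4 * (D0 b delta ^+ NB) ^+ 2 * NB%:R)) * (i + l + k0).+1%:R).
exists (`|C| + 1); first by rewrite ltr_pwDr.
move=> K V r m u K_ge K_sum uV sV V_mem K_true contr f s f0.
have K_gt0 v p a : 0 < K v p a by exact: lt_le_trans (K_ge v p a).
apply: le_trans (LSI_sum K_gt0 K_sum uV sV V_mem b0 K_true r0 k0_gt0 contr d0 K_ge s q0 hq hq' t00 (NB := NB) _ f0 heps) _.
  by move=> x _; exact: size_block_le.
rewrite -/C; apply: ler_wpM2r.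
  by apply: sumr_ge0 => v _; apply: Qs_ge0 => // t; exact: sqr_ge0.
by apply: le_trans (ler_norm _) _; rewrite lerDl.
Qed.

(** * Derivatives and limits of finite sums *)

Section DerivativeHelpers.
Context (R : realType).
Implicit Types (f g : R -> R) (x y a c : R).

Lemma is_derive_add f g x a c : is_derive x 1 f a -> is_derive x 1 g c ->
  is_derive x 1 (fun y => f y + g y) (a + c).
Proof. by move=> h1 h2; exact: (is_deriveD h1 h2). Qed.

Lemma is_derive_mul f g x a c : is_derive x 1 f a -> is_derive x 1 g c ->
  is_derive x 1 (fun y => f y * g y) (f x * c + g x * a).
Proof. by move=> h1 h2; exact: (is_deriveM h1 h2). Qed.

Lemma is_derive_const x c : is_derive x 1 (fun=> c) 0.
Proof. exact: is_derive_cst. Qed.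

Lemma is_derive_scale f x a c : is_derive x 1 f a -> is_derive x 1 (fun y => c * f y) (c * a).
Proof.
move=> h; have := is_derive_mul (is_derive_const x c) h.
by rewrite mulr0 addr0.
Qed.

Lemma is_derive_bigsum (I : Type) (s : seq I) (f : I -> R -> R) (d : I -> R) x :
  (forall i, is_derive x 1 (f i) (d i)) ->
  is_derive x 1 (fun y => \sum_(i <- s) f i y) (\sum_(i <- s) d i).
Proof.
move=> h; elim: s => [|i s IH].
  have -> : (fun y => \sum_(i <- [::]) f i y) = fun=> 0 by apply/funext => y; rewrite big_nil.
  by rewrite big_nil; exact: is_derive_const.
have -> : (fun y => \sum_(j <- i :: s) f j y) = fun y => f i y + \sum_(j <- s) f j y.
  by apply/funext => y; rewrite big_cons.
by rewrite big_cons; exact: is_derive_add.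
Qed.

Lemma is_derive_continuous f x a : is_derive x 1 f a -> {for x, continuous f}.
Proof.
move=> h; apply: differentiable_continuous; apply/derivable1_diffP.
exact: (@ex_derive _ _ _ _ _ _ _ h).
Qed.

Lemma is_derive_nonincreasing f (d : R -> R) : (forall x, is_derive x 1 f (d x)) ->
  (forall x, 0 <= x -> d x <= 0) -> forall x, 0 <= x -> f x <= f 0.
Proof.
move=> h dle x x0.
apply: (@ler0_derive1_nincry R f 0) => // [y|].
- rewrite in_itv /= andbT => y0; rewrite derive1E (@derive_val _ _ _ _ _ _ _ (h y)).
  by apply: dle; exact: ltW.
- by apply: continuous_subspaceT => y; exact: (is_derive_continuous (h y)).
Qed.

Lemma cvgn_bigsum (I : Type) (s : seq I) (f : I -> R ^nat) (l : I -> R) :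
  (forall i, (f i n @[n --> \oo] --> l i)%classic) ->
  ((\sum_(i <- s) f i n)%R @[n --> \oo] --> (\sum_(i <- s) l i)%R)%classic.
Proof.
move=> h; elim: s => [|i s IH].
  under eq_fun do rewrite big_nil.
  by rewrite big_nil; exact: cvg_cst.
under eq_fun do rewrite big_cons.
by rewrite big_cons; exact: cvgD.
Qed.

End DerivativeHelpers.

(** * Finite reversible Markov chains *)

Section MatrixExponential.
Context (R : realType) (X : finType) (A : X -> X -> R).
Implicit Types (f g : X -> R) (x y : X).

Definition mxop f x := \sum_y A x y * f y.

(** The same series as in [heat_kernel]; power series are reached through the coefficients
    [coef]. *)
Definition expsol f (t : R) x := limn (series (fun k => exp_coeff t k * iter k mxop f x)).

Let B : R := \sum_x \sum_y `|A x y|.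
Let nrm f : R := \sum_x `|f x|.

Let B_ge0 : 0 <= B.
Proof. by apply: sumr_ge0 => x _; apply: sumr_ge0. Qed.

Let le_nrm f x : `|f x| <= nrm f.
Proof. by rewrite /nrm (bigD1 x) //= lerDl sumr_ge0. Qed.

Lemma iter_mxop_bound f k x : `|iter k mxop f x| <= B ^+ k * nrm f.
Proof.
elim: k x => [|k IH] x; first by rewrite expr0 mul1r.
rewrite iterS {1}/mxop; apply: le_trans (ler_norm_sum _ _ _) _.
apply: (@le_trans _ _ (\sum_y `|A x y| * (B ^+ k * nrm f))).
  by apply: ler_sum => y _; rewrite normrM ler_wpM2l.
rewrite -mulr_suml exprS -mulrA ler_wpM2r //.
  by apply: mulr_ge0; [exact: exprn_ge0|exact: sumr_ge0].
by rewrite /B [leRHS](bigD1 x) //= lerDl; apply: sumr_ge0 => z _; exact: sumr_ge0.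
Qed.

Let coef f x : R ^nat := fun k => (k`!%:R)^-1 * iter k mxop f x.

Let expsolE f t x : expsol f t x = limn (pseries (coef f x) t).
Proof.
rewrite /expsol /pseries; congr (limn (series _)); apply/funext => k.
by rewrite /exp_coeff /coef /=; ring.
Qed.

Let coef_cvg f x (t : R) : cvgn (pseries (coef f x) t).
Proof.
apply: normed_cvg; rewrite /normed_series_of /=.
apply: (@series_le_cvg _ _ (fun k => nrm f * exp_coeff (B * `|t|) k)).
- by move=> k.
- by move=> k; rewrite mulr_ge0 ?sumr_ge0 // exp_coeff_ge0 // mulr_ge0.
- move=> k; rewrite /coef !normrM normrX /exp_coeff /= exprMn.
  rewrite ger0_norm ?invr_ge0 //.
  have := iter_mxop_bound f k x.
  move: (`|iter _ _ _ _|) => a ha.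
  rewrite [leRHS](_ : _ = (k`!%:R)^-1 * (B ^+ k * nrm f) * `|t| ^+ k); last ring.
  by rewrite ler_wpM2r ?exprn_ge0 // ler_wpM2l ?invr_ge0.
- apply: is_cvg_seriesZ; exact: is_cvg_series_exp_coeff.
Qed.

Let coef_diffs f x : pseries_diffs (coef f x) = coef (mxop f) x.
Proof.
apply/funext => k; rewrite /pseries_diffs /coef -iterSr factS natrM invfM.
by rewrite mulrA mulrA mulfV ?mul1r // pnatr_eq0.
Qed.

Lemma expsol_cvg f (t : R) x : cvgn (series (fun k => exp_coeff t k * iter k mxop f x)).
Proof.
have -> : series (fun k => exp_coeff t k * iter k mxop f x) = pseries (coef f x) t.
  by congr series; apply/funext => k; rewrite /exp_coeff /coef /=; ring.
exact: coef_cvg.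
Qed.

Lemma expsol_derive f (t : R) x : is_derive t (1:R) (fun t => expsol f t x) (expsol (mxop f) t x).
Proof.
have := @pseries_snd_diffs R (coef f x) (`|t| + 1) t.
rewrite !coef_diffs => h.
rewrite expsolE.
have -> : (fun t => expsol f t x) = (fun t => limn (pseries (coef f x) t)).
  by apply/funext => ?; exact: expsolE.
apply: h; try exact: coef_cvg.
by rewrite [ltRHS]ger0_norm ?addr_ge0 // ltrDl.
Qed.

Lemma expsol_sum f (t : R) x : expsol (mxop f) t x = mxop (expsol f t) x.
Proof.
rewrite expsolE /mxop; apply/cvg_lim => //.
have -> : pseries (coef (mxop f) x) t = fun n => \sum_y A x y * pseries (coef f y) t n.
  apply/funext => n; rewrite /pseries /series /=.
  transitivity (\sum_(0 <= k < n) \sum_y A x y * (coef f y k * t ^+ k)).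
    apply: eq_bigr => k _; rewrite /coef -iterSr iterS {1}/mxop mulr_sumr mulr_suml.
    by apply: eq_bigr => y _; ring.
  by rewrite exchange_big; apply: eq_bigr => y _; rewrite mulr_sumr.
apply: cvgn_bigsum => y; apply: cvgMl_tmp; rewrite expsolE.
exact: coef_cvg.
Qed.

Lemma expsol0 f x : expsol f 0 x = f x.
Proof.
rewrite expsolE; apply/cvg_lim => //.
apply: (@cvg_near_cst _ _ _ _ _ _); exists 1%N => // n /= n1.
rewrite /pseries /series /= big_ltn // big1_seq => [|k].
  by rewrite expr0 mulr1 addr0 /coef invr1 mul1r.
by rewrite mem_index_iota => /andP[_ /andP[k0 _]]; rewrite expr0n gtn_eqF // mulr0.
Qed.

Lemma expsol_ge0 f (t : R) x : (forall x y, 0 <= A x y) -> (forall x, 0 <= f x) -> 0 <= t ->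
  0 <= expsol f t x.
Proof.
move=> A0 f0 t0; rewrite expsolE; apply: limr_ge; first exact: coef_cvg.
near=> n; rewrite /pseries /series /=; apply: sumr_ge0 => k _.
rewrite mulr_ge0 ?exprn_ge0 // mulr_ge0 ?invr_ge0 //.
elim: k x => [|k IH] x //; rewrite iterS /mxop; apply: sumr_ge0 => y _; exact: mulr_ge0.
Unshelve. all: by end_near.
Qed.

End MatrixExponential.

Section Reversible.
Context (R : realType) (X : finType) (A : X -> X -> R) (pi : X -> R).
Hypothesis A_row : forall x, \sum_y A x y = 0.
Hypothesis A_off : forall x y, x != y -> 0 <= A x y.
Hypothesis A_rev : forall x y, pi x * A x y = pi y * A y x.
Hypothesis pi_gt0 : forall x, 0 < pi x.
Hypothesis pi_sum : \sum_x pi x = 1.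
Implicit Types (f g w : X -> R) (x y : X).

Local Notation L := (mxop A).

Definition mean f : R := \sum_x pi x * f x.

Lemma mean_self_adjoint f g : mean (fun x => f x * L g x) = mean (fun x => L f x * g x).
Proof.
rewrite /mean /mxop.
under eq_bigr do rewrite mulr_sumr mulr_sumr.
under [RHS]eq_bigr do rewrite mulr_suml mulr_sumr.
rewrite exchange_big; apply: eq_bigr => y _; apply: eq_bigr => x _.
transitivity (pi x * A x y * (f x * g y)); first ring.
by rewrite A_rev; ring.
Qed.

Lemma mean_L f : mean (L f) = 0.
Proof.
have := mean_self_adjoint (fun=> 1) f.
have -> : (fun x => 1 * L f x) = L f by apply/funext => x; rewrite mul1r.
move=> ->; rewrite /mean big1 // => x _.
by rewrite /mxop (eq_bigr (A x)) ?A_row ?mul0r ?mulr0 // => y _; rewrite mulr1.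
Qed.

(** Expanding the square leaves two further terms, which vanish by stationarity ([mean_L]) and by
    the zero row sums. *)
Lemma dirichletE f :
  mean (fun x => f x * L f x) = - (2^-1 * \sum_x \sum_y pi x * A x y * (f y - f x) ^+ 2).
Proof.
have -> : \sum_x \sum_y pi x * A x y * (f y - f x) ^+ 2 =
   mean (L (fun y => f y ^+ 2)) + mean (fun x => f x ^+ 2 * \sum_y A x y)
   - 2 * mean (fun x => f x * L f x).
  rewrite /mean /mxop mulr_sumr -big_split /= -sumrB; apply: eq_bigr => x _.
  rewrite !mulr_sumr -big_split /= -sumrB; apply: eq_bigr => y _; ring.
rewrite mean_L; have -> : mean (fun x => f x ^+ 2 * \sum_y A x y) = 0.
  by rewrite /mean big1 // => x _; rewrite A_row !mulr0.
by lra.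
Qed.

Lemma dirichlet_le0 f : mean (fun x => f x * L f x) <= 0.
Proof.
rewrite dirichletE oppr_le0 mulr_ge0 ?invr_ge0 //.
apply: sumr_ge0 => x _; apply: sumr_ge0 => y _; case: (eqVneq x y) => [->|xy].
  by rewrite subrr expr0n mulr0.
by rewrite mulr_ge0 ?sqr_ge0 // mulr_ge0 ?A_off // ltW.
Qed.

Lemma is_derive_mean (F : R -> X -> R) (D : X -> R) (t : R) :
  (forall x, is_derive t (1:R) (fun t => F t x) (D x)) ->
  is_derive t (1:R) (fun t => mean (F t)) (mean D).
Proof. by move=> h; apply: is_derive_bigsum => x; exact: is_derive_scale. Qed.

Lemma is_derive_mean_square (F : R -> X -> R) (t : R) :
  (forall x, is_derive t (1:R) (fun t => F t x) (L (F t) x)) ->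
  is_derive t (1:R) (fun t => mean (fun x => F t x ^+ 2)) (2 * mean (fun x => F t x * L (F t) x)).
Proof.
move=> h; have -> : 2 * mean (fun x => F t x * L (F t) x) =
    mean (fun x => F t x * L (F t) x + F t x * L (F t) x).
  by rewrite /mean mulr_sumr; apply: eq_bigr => x _; ring.
apply: (is_derive_mean (F := fun t x => F t x ^+ 2)) => x.
have := is_derive_mul (h x) (h x).
by under eq_fun do rewrite -expr2.
Qed.

Lemma expsol_L f (t : R) x : is_derive t (1:R) (fun t => expsol A f t x) (L (expsol A f t) x).
Proof. by rewrite -expsol_sum; exact: expsol_derive. Qed.

Lemma L_linear f g c x : L (fun y => f y + c * g y) x = L f x + c * L g x.
Proof. by rewrite /mxop mulr_sumr -big_split /=; apply: eq_bigr => y _; ring. Qed.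

(** The difference of two solutions starts at zero, and its second moment is nonincreasing since the
    Dirichlet form has a sign. *)
Lemma flow_unique (F G : R -> X -> R) :
  (forall t x, is_derive t (1:R) (fun t => F t x) (L (F t) x)) ->
  (forall t x, is_derive t (1:R) (fun t => G t x) (L (G t) x)) ->
  F 0 = G 0 -> forall t x, 0 <= t -> F t x = G t x.
Proof.
move=> hF hG FG t x t0.
pose D t x := F t x + (-1) * G t x.
have hD s y : is_derive s (1:R) (fun s => D s y) (L (D s) y).
  rewrite /D L_linear; apply: is_derive_add => //; exact: is_derive_scale.
have h := is_derive_nonincreasing (fun s => is_derive_mean_square (hD s)) _ t0.
have {}h : mean (fun x => D t x ^+ 2) <= mean (fun x => D 0 x ^+ 2).
  by apply: h => s _; have := dirichlet_le0 (D s); lra.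
have D0 : mean (fun x => D 0 x ^+ 2) = 0.
  by rewrite /mean big1 // => y _; rewrite /D FG mulN1r subrr expr0n /= mulr0.
rewrite D0 in h.
have : pi x * D t x ^+ 2 <= 0.
  apply: le_trans h; rewrite /mean (bigD1 x) //= lerDl; apply: sumr_ge0 => y _.
  by rewrite mulr_ge0 ?sqr_ge0 // ltW.
rewrite pmulr_rle0 // => h2; have /eqP : D t x ^+ 2 = 0 by apply/eqP; rewrite eq_le h2 sqr_ge0.
by rewrite sqrf_eq0 /D => /eqP; lra.
Qed.

(** A multiple [M] of the identity makes all entries of the matrix nonnegative, hence also all terms
    of its exponential series. Multiplied by [expR (- M * s)], that flow solves the original
    equation, so uniqueness identifies it. *)
Lemma flow_ge0 f (t : R) x : (forall x, 0 <= f x) -> 0 <= t -> 0 <= expsol A f t x.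
Proof.
move=> f0 t0.
pose M : R := \sum_x `|A x x|.
pose A' x y := A x y + (if x == y then M else 0).
have A'0 y z : 0 <= A' y z.
  rewrite /A'; case: (eqVneq y z) => [->|yz]; last by rewrite addr0 A_off.
  rewrite /M (bigD1 z) //=; have : 0 <= \sum_(i | i != z) `|A i i| by apply: sumr_ge0.
  have := ler_norm (- A z z); rewrite normrN; lra.
have E g y : mxop A' g y = L g y + M * g y.
  rewrite /mxop /A'; under eq_bigr do rewrite mulrDl.
  rewrite big_split /=; congr (_ + _); rewrite (bigD1 y) //= eqxx big1 ?addr0 // => z zy.
  by rewrite eq_sym (negbTE zy) mul0r.
pose G (s : R) y := expR (- M * s) * expsol A' f s y.
have hG s y : is_derive s (1:R) (fun s => G s y) (L (G s) y).
  have h1 : is_derive s (1:R) (fun s => expR (- M * s)) (- M * expR (- M * s)).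
    have h0 : is_derive s (1:R) (fun s : R => - M * s) (- M * 1).
      by apply: is_derive_scale; exact: is_derive_id.
    have := is_derive1_comp (is_derive_expR (- M * s)) h0.
    by rewrite mulr1 => k; apply: (is_derive_eq k); rewrite mulrC.
  have h2 : is_derive s (1:R) (fun s => expsol A' f s y) (mxop A' (expsol A' f s) y).
    by rewrite -expsol_sum; exact: expsol_derive.
  apply: (is_derive_eq (is_derive_mul h1 h2)).
  rewrite E /G /mxop; have -> : \sum_z A y z * (expR (- M * s) * expsol A' f s z) =
     expR (- M * s) * \sum_z A y z * expsol A' f s z.
    by rewrite mulr_sumr; apply: eq_bigr => z _; ring.
  by ring.
rewrite (flow_unique (fun s y => expsol_L f s y) hG _ _ t0).
  by rewrite mulr_ge0 ?expR_ge0 // expsol_ge0.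
by apply/funext => y; rewrite /G expsol0 mulr0 expR0 mul1r expsol0.
Qed.

Lemma flow_mean f (t : R) : 0 <= t -> mean (expsol A f t) = mean f.
Proof.
move=> t0.
have h s : is_derive s (1:R) (fun s => mean (expsol A f s)) 0.
  rewrite -(mean_L (expsol A f s)); apply: is_derive_mean => x; exact: expsol_L.
have E0 : mean (expsol A f 0) = mean f by congr mean; apply/funext => x; exact: expsol0.
apply/eqP; rewrite -E0 eq_le; apply/andP; split.
  exact: (is_derive_nonincreasing h).
rewrite -lerN2; apply: (@is_derive_nonincreasing _ (fun s => - mean (expsol A f s)) (fun=> 0)) => // s.
by have := is_derive_scale (-1) (h s); rewrite mulr0; under eq_fun do rewrite mulN1r.
Qed.

Hypothesis X_pi_le1 : forall x, pi x <= 1.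

(* Jensen's inequality for the tilted measure w^2 mu / mean (w^2) turns the logarithmic Sobolev inequality into a closed differential inequality for mean (w^2). *)
Lemma entropy_square_ge w : (forall x, 0 < w x) -> mean w = 1 ->
  mean (fun x => w x ^+ 2) * ln (mean (fun x => w x ^+ 2)) <=
  mean (fun x => w x ^+ 2 * ln (w x ^+ 2)) - mean (fun x => w x ^+ 2) * ln (mean (fun x => w x ^+ 2)).
Proof.
move=> w0 w1; set v := mean (fun x => w x ^+ 2).
have x0 : exists x : X, True.
  apply: contrapT => nx; have := pi_sum; rewrite big1; first by lra.
  by move=> x _; exfalso; apply: nx; exists x.
have v0 : 0 < v.
  case: x0 => x _; rewrite /v /mean (bigD1 x) //=; apply: ltr_wpDr; last by rewrite mulr_gt0 // exprn_gt0.
  by apply: sumr_ge0 => y _; rewrite mulr_ge0 ?sqr_ge0 // ltW.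
suff : v * ln v <= mean (fun x => w x ^+ 2 * ln (w x)).
  have -> : mean (fun x => w x ^+ 2 * ln (w x ^+ 2)) = 2 * mean (fun x => w x ^+ 2 * ln (w x)).
    rewrite /mean mulr_sumr; apply: eq_bigr => x _; rewrite lnXn // mulr2n; ring.
  by lra.
have -> : v * ln v = mean (fun x => w x ^+ 2 * (ln v + 1) - v * w x).
  rewrite /mean; under eq_bigr do rewrite mulrBr.
  rewrite sumrB; have -> : \sum_x pi x * (v * w x) = v * mean w.
    by rewrite /mean mulr_sumr; apply: eq_bigr => x _; ring.
  have -> : \sum_x pi x * (w x ^+ 2 * (ln v + 1)) = v * (ln v + 1).
    by rewrite /v /mean mulr_suml; apply: eq_bigr => x _; ring.
  by rewrite w1; ring.
apply: ler_sum => x _; rewrite ler_pM2l //.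
have := @expR_ge1Dx R (ln v - ln (w x)); rewrite expRB !lnK ?posrE // => h.
have : w x ^+ 2 * (1 + (ln v - ln (w x))) <= w x ^+ 2 * (v / w x).
  by apply: ler_wpM2l => //; exact: sqr_ge0.
have -> : w x ^+ 2 * (v / w x) = v * w x by field; rewrite gt_eqF.
by lra.
Qed.

(** With [v] the mean of [w^2], the hypothesis and [entropy_square_ge] give
    [v' <= - (2 / c) v ln v]. Thus [expR (2 / c * s) * ln (v s)] is nonincreasing, and it starts at
    a value of at most [ln (1 / pi x0)]. *)
Lemma L2_decay (c : R) (x0 : X) (t : R) : 0 < c ->
  (forall w, (forall x, 0 < w x) ->
     mean (fun x => w x ^+ 2 * ln (w x ^+ 2)) - mean (fun x => w x ^+ 2) * ln (mean (fun x => w x ^+ 2)) <= c * - mean (fun x => w x * L w x)) ->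
  0 <= t -> expR (- (2 / c * t)) * ln (pi x0)^-1 <= 2^-1 ->
  mean (fun x => (expsol A (fun y => (y == x0)%:R / pi x0) t x - 1) ^+ 2) <=
  8 * (expR (- (2 / c * t)) * ln (pi x0)^-1).
Proof.
move=> c0 LSI t0 small.
set f := fun s => expsol A (fun y => (y == x0)%:R / pi x0) s.
have f_ge0 s x : 0 <= s -> 0 <= f s x by move=> s0; apply: flow_ge0 => // y; rewrite divr_ge0 // ltW.
have f1 s : 0 <= s -> mean (f s) = 1.
  move=> s0; rewrite flow_mean // /mean (bigD1 x0) //= eqxx mul1r mulfV ?gt_eqF // big1 ?addr0 // => y.
  by move=> /negbTE ->; rewrite mul0r mulr0.
(* At time 0 the density [f] vanishes off [x0], and logarithms ask for positivity. Averaging with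
   the constant 1 preserves the equation and the mean, and divides the centred second moment by
   4. *)
pose w s x := 2^-1 + 2^-1 * f s x.
have w_gt0 s x : 0 <= s -> 0 < w s x by move=> s0; have := f_ge0 s x s0; rewrite /w; lra.
have w1 s : 0 <= s -> mean (w s) = 1.
  move=> s0; rewrite /mean /w; under eq_bigr do rewrite mulrDr.
  rewrite big_split /= -mulr_suml pi_sum.
  have -> : \sum_x pi x * (2^-1 * f s x) = 2^-1 * mean (f s).
    by rewrite /mean mulr_sumr; apply: eq_bigr => x _; ring.
  by rewrite f1 //; lra.
have hw s x : is_derive s (1:R) (fun s => w s x) (L (w s) x).
  rewrite /w L_linear.
  have -> : L (fun=> 2^-1) x = 0 by rewrite /mxop -mulr_suml A_row mul0r.
  apply: (is_derive_add (is_derive_const s (2^-1 : R))).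
  by apply: is_derive_scale; exact: expsol_L.
pose v s := mean (fun x => w s x ^+ 2).
have hv s : is_derive s (1:R) v (2 * mean (fun x => w s x * L (w s) x)) by exact: is_derive_mean_square.
have vE s : 0 <= s -> mean (fun x => (f s x - 1) ^+ 2) = 4 * (v s - 1).
  move=> s0; have h1 := w1 s s0.
  have -> : mean (fun x => (f s x - 1) ^+ 2) = 4 * (v s - 2 * mean (w s) + \sum_x pi x).
    rewrite /v /mean /w mulr_sumr -sumrB -big_split /= mulr_sumr; apply: eq_bigr => x _.
    by field.
  by rewrite h1 pi_sum; lra.
have v1 s : 0 <= s -> 1 <= v s.
  move=> s0; have : 0 <= mean (fun x => (f s x - 1) ^+ 2).
    by apply: sumr_ge0 => x _; rewrite mulr_ge0 ?sqr_ge0 // ltW.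
  by rewrite vE //; lra.
(* Needed for negative [s] as well, because [G] is differentiated on the whole line. There [w] may
   change sign, but its mean is still 1. *)
have vpos s : 0 < v s.
  have h : 0 <= v s by apply: sumr_ge0 => x _; rewrite mulr_ge0 ?sqr_ge0 // ltW.
  rewrite lt_neqAle h andbT; apply/negP => /eqP v0.
  have hz x : w s x = 0.
    have : pi x * w s x ^+ 2 <= v s.
      rewrite /v /mean (bigD1 x) //= lerDl; apply: sumr_ge0 => y _.
      by rewrite mulr_ge0 ?sqr_ge0 // ltW.
    rewrite -v0 pmulr_rle0 // => h2; apply/eqP; rewrite -sqrf_eq0; apply/eqP/le_anti.
    by rewrite h2 sqr_ge0.
  have dm : is_derive s (1:R) (fun s => mean (w s)) (mean (L (w s))) by apply: is_derive_mean => x; exact: hw.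
  have : mean (w s) = 1.
    have hh r : is_derive r (1:R) (fun r => mean (w r)) 0.
      by rewrite -(mean_L (w r)); apply: is_derive_mean => x; exact: hw.
    by rewrite (is_derive_0_is_cst s 0 hh) w1.
  by rewrite /mean big1 => [|x _]; [lra|rewrite hz mulr0].
pose G s := expR (2 / c * s) * ln (v s).
pose dG s := expR (2 / c * s) * ((v s)^-1 * (2 * mean (fun x => w s x * L (w s) x)))
   + ln (v s) * (2 / c * expR (2 / c * s)).
have hG s : is_derive s (1:R) G (dG s).
  apply: is_derive_mul.
    have h0 : is_derive s (1:R) (fun s : R => 2 / c * s) (2 / c * 1).
      by apply: is_derive_scale; exact: is_derive_id.
    have := is_derive1_comp (is_derive_expR (2 / c * s)) h0.
    by rewrite mulr1 => k; apply: (is_derive_eq k); rewrite mulrC.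
  have := is_derive1_comp (is_derive1_ln (vpos s)) (hv s).
  by move=> k; apply: (is_derive_eq k).
have dG_le0 s : 0 <= s -> dG s <= 0.
  move=> s0.
  have h1 := LSI (w s) (fun x => w_gt0 s x s0).
  have h2 := entropy_square_ge (fun x => w_gt0 s x s0) (w1 s s0).
  rewrite -/(v s) in h1 h2.
  have h3 : v s * ln (v s) <= c * - mean (fun x => w s x * L (w s) x) by apply: le_trans h2 h1.
  have -> : dG s = expR (2 / c * s) * (2 / (c * v s)) *
     (v s * ln (v s) - c * - mean (fun x => w s x * L (w s) x)).
    by rewrite /dG; field; rewrite !gt_eqF.
  rewrite mulr_ge0_le0 //; last by rewrite subr_le0.
  by rewrite mulr_ge0 ?expR_ge0 // divr_ge0 // mulr_ge0 // ltW.
have Gt := is_derive_nonincreasing hG dG_le0 t0.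
have v0 : v 0 <= (pi x0)^-1.
  have := vE 0 (lexx 0).
  have -> : mean (fun x => (f 0 x - 1) ^+ 2) = (pi x0)^-1 - 1.
    have E : (fun x => (f 0 x - 1) ^+ 2) = fun x => (x == x0)%:R * ((pi x0)^-1 * ((pi x0)^-1 - 2)) + 1.
      apply/funext => x; rewrite /f expsol0; case: eqP => _ /=; rewrite ?mulr0n ?mulr1n; ring.
    rewrite E /mean; under eq_bigr do rewrite mulrDr mulr1.
    rewrite big_split /= pi_sum (bigD1 x0) //= eqxx mul1r big1 ?addr0; last first.
      by move=> y /negbTE ->; rewrite mul0r mulr0.
    by field; rewrite gt_eqF.
  have : 1 <= (pi x0)^-1 by rewrite invf_ge1.
  by lra.
have lnvt : ln (v t) <= expR (- (2 / c * t)) * ln (pi x0)^-1.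
  have E : ln (v t) = expR (- (2 / c * t)) * G t by rewrite /G mulrA mulrC -[_ * expR _]mulrC expRxMexpNx_1 mulr1.
  rewrite E ler_wpM2l ?expR_ge0 //; apply: le_trans Gt _; rewrite /G mulr0 expR0 mul1r.
  by rewrite ler_ln ?posrE ?invr_gt0.
rewrite vE //.
set y := expR _ * _ in small lnvt *.
have y0 : 0 <= y by apply: le_trans lnvt; rewrite ln_ge0 // v1.
have : v t <= expR y by rewrite -[v t]lnK ?posrE // ler_expR.
have yy : `|y| <= 2^-1 by rewrite ger0_norm.
(* This gives [v t - 1 <= y + 2 y^2 <= 2 y]; the 8 of the conclusion is this 2 times the 4 in
   [vE]. *)
have := expR_le_quad yy.
have : y ^+ 2 <= 2^-1 * y by rewrite expr2; apply: ler_wpM2r.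
lra.
Qed.

Lemma iter_L_sym k x y : pi x * iter k L (fun z => (z == y)%:R) x = pi y * iter k L (fun z => (z == x)%:R) y.
Proof.
have H f g : mean (fun z => f z * iter k L g z) = mean (fun z => iter k L f z * g z).
  by elim: k f g => [|k IH] f g //; rewrite iterSr IH iterS mean_self_adjoint.
have E f z : mean (fun x => (x == z)%:R * f x) = pi z * f z.
  rewrite /mean (bigD1 z) //= eqxx mul1r big1 ?addr0 // => w /negbTE ->.
  by rewrite mul0r mulr0.
have := H (fun z => (z == x)%:R) (fun z => (z == y)%:R).
rewrite E => ->; rewrite -E; congr mean; apply/funext => z; exact: mulrC.
Qed.

(** Reversibility of the semigroup. As a function of the end point [y], the density of the chain
    started at [x] is itself a flow of the generator, to which [L2_decay] applies. *)
Lemma expsol_sym (t : R) x y :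
  expsol A (fun z => (z == y)%:R) t x / pi y = expsol A (fun z => (z == x)%:R / pi x) t y.
Proof.
rewrite /expsol; have -> : (fun k => exp_coeff t k * iter k L (fun z => (z == x)%:R / pi x) y) =
  fun k => (pi y)^-1 * (exp_coeff t k * iter k L (fun z => (z == y)%:R) x).
  apply/funext => k.
  have E f c z : iter k L (fun z => f z * c) z = iter k L f z * c.
    elim: k z => [|k IH] z //=; rewrite {1}/mxop mulr_suml; apply: eq_bigr => u _.
    by rewrite IH mulrA.
  rewrite E; have := iter_L_sym k x y.
  move: (iter _ _ _ _) (iter _ _ _ _) => a1 a2 e.
  have -> : a1 = pi x * a2 / pi y by rewrite e; field; rewrite gt_eqF.
  by field; rewrite !gt_eqF.
rewrite mulrC; apply/esym; apply/cvg_lim => //.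
have -> : series (fun k => (pi y)^-1 * (exp_coeff t k * iter k L (fun z => (z == y)%:R) x)) =
  fun n => (pi y)^-1 * series (fun k => exp_coeff t k * iter k L (fun z => (z == y)%:R) x) n.
  by apply/funext => n; rewrite /series /= mulr_sumr.
apply: cvgMl_tmp; exact: expsol_cvg.
Qed.

End Reversible.

(** * The finite-volume measure and its dynamics *)

Section SubtreeCombinatorics.
Context (b : nat).
Implicit Types (u v w x : vertex b) (k : nat).

(** A recursive enumeration of the subtree, along which big operators split into the root and the
    [b] child subtrees. *)
Fixpoint tlist k x : seq (vertex b) :=
  x :: (if k is k'.+1 then flatten [seq tlist k' (i :: x) | i <- enum 'I_b] else [::]).

Lemma mem_tlist k x v : (v \in tlist k x) = suffix x v && (size v <= size x + k)%N.
Proof.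
elim: k x v => [|k IH] x v /=.
  rewrite addn0 inE; apply/eqP/andP => [->|[h1 h2]]; first by rewrite suffix_refl.
  exact: suffix_eq_size h1 h2.
rewrite inE; apply/orP/andP => [[/eqP ->|]|[sv hv]].
- by rewrite suffix_refl leq_addr.
- move=> /flattenP[l /mapP[i _ ->]]; rewrite IH => /andP[h1 h2]; split.
    by apply: suffix_trans h1; exact: suffix_cons.
  by rewrite addnS -addSn.
- have [->|nv] := eqVneq v x; first by left.
  right; have [i iv] : exists i, suffix (i :: x) v by apply: child_suffix; rewrite /desc sv.
  apply/flattenP; exists (tlist k (i :: x)); first by apply/mapP; exists i => //; rewrite mem_enum.
  by rewrite IH iv /= addSn -addnS.
Qed.

Lemma tlist_uniq k x : uniq (tlist k x).
Proof.
elim: k x => [|k IH] x //=; apply/andP; split.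
  apply/negP => /flattenP[l /mapP[i _ ->]]; rewrite mem_tlist => /andP[h _].
  by move: h; rewrite (negbTE (suffix_consN _ _)).
elim: (enum 'I_b) (enum_uniq 'I_b) => //= i l IHl /andP[il ul].
rewrite cat_uniq IH IHl // andbT /=; apply/hasPn => v /flattenP[l' /mapP[j jl ->]].
rewrite !mem_tlist => /andP[jv _]; apply/negP => /andP[iv _].
by move/negP: il; apply; rewrite (child_suffix_inj iv jv).
Qed.

Lemma mem_complete_subtree x k v :
  (v \in complete_subtree x k) = suffix x v && (size v <= size x + k)%N.
Proof.
apply/imfsetP/andP => /= [[w _ ->]|[/suffixP[t ->] h]].
  by rewrite suffix_suffix size_cat addnC leq_add2l; split => //; exact: size_bseq.
have st : (size t <= k)%N by move: h; rewrite size_cat addnC leq_add2l.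
by exists (Bseq st).
Qed.

Lemma perm_tlist k x : perm_eq (complete_subtree x k) (tlist k x).
Proof.
apply: uniq_perm; [exact: fset_uniq|exact: tlist_uniq|] => v.
by rewrite mem_tlist -mem_complete_subtree.
Qed.

Lemma big_complete_subtreeS (T : Type) (idx : T) (op : Monoid.com_law idx) k x (F : vertex b -> T) :
  \big[op/idx]_(v <- complete_subtree x k.+1) F v =
  op (F x) (\big[op/idx]_(i < b) \big[op/idx]_(v <- complete_subtree (i :: x) k) F v).
Proof.
rewrite (perm_big _ (perm_tlist k.+1 x)) /= big_cons big_flatten big_map /=; congr (op _ _).
rewrite big_enum /=; apply: eq_bigr => i _.
by rewrite [RHS](perm_big _ (perm_tlist k (i :: x))).
Qed.

Lemma big_complete_subtree0 (T : Type) (idx : T) (op : Monoid.com_law idx) x (F : vertex b -> T) :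
  \big[op/idx]_(v <- complete_subtree x 0) F v = F x.
Proof. by rewrite (perm_big _ (perm_tlist 0 x)) /= big_seq1. Qed.

Lemma childP u v : reflect (exists i, v = i :: u) (child u v).
Proof. by apply: (iffP existsP) => -[i E]; exists i; apply/eqP; rewrite ?E. Qed.

Lemma in_neighbors u v : (v \in neighbors u) = tree_adj u v.
Proof.
apply/imfsetP/idP => /= [[w]|uv]; first by rewrite inE => /andP[_ ?] ->.
exists v => //; rewrite inE /= uv andbT.
case/orP: uv => /childP[i E]; rewrite E inE /=; last by rewrite eqxx.
by apply/orP; right; apply/mapP; exists i => //; rewrite mem_enum.
Qed.

Lemma in_bdry (W : {pred vertex b}) (A : {fset vertex b}) v :
  reflect ((exists2 u, u \in A & tree_adj u v) /\ (v \in W) /\ v \notin A) (v \in bdry W A).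
Proof.
apply: (iffP idP).
  move=> /imfsetP /= [w]; rewrite inE => /andP[/bigfcupP[u /andP[uA _] uw] /andP[wW wA]] ->.
  by split => //; exists u => //; rewrite -in_neighbors.
move=> [[u uA uv] [vW vA]]; apply/imfsetP; exists v => //=.
have h : v \in (\bigcup_(u0 <- A) neighbors u0)%fset.
  by apply/bigfcupP; exists u; rewrite ?uA ?in_neighbors.
by rewrite inE vW vA; apply/andP; split.
Qed.

Lemma card_neighbors u : (#|` neighbors u| <= b.+1)%N.
Proof.
have sub : (neighbors u `<=` [fset v in behead u :: [seq i :: u | i <- enum 'I_b]])%fset.
  by apply/fsubsetP => v; rewrite !inE => /andP[].
apply: leq_trans (fsubset_leq_card sub) _; rewrite card_fseq.
by apply: leq_trans (size_undup _) _; rewrite /= size_map size_enum_ord.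
Qed.

End SubtreeCombinatorics.

Section Energy.
Context (R : realType) (b : nat) (W : {pred vertex b}) (h : R).
Implicit Types (u v w x r : vertex b) (A T : {fset vertex b}) (s : config b).

Local Notation sp := (spin R).

Lemma spin_norm a : `|sp a| = 1.
Proof. by case: a; rewrite /spin ?normrN normr1. Qed.

(** Only edges that touch [A] contribute to the difference, and both ends of such an edge lie in [A]
    or its boundary, since all vertices concerned are in [W]. Detailed balance and the DLR equations
    both rest on this. *)
Lemma energy_diff A T s s' : (A `<=` T)%fset -> (forall v, v \in T -> v \in W) ->
  (forall v, v \notin A -> s v = s' v) ->
  energy W h T s - energy W h T s' = energy W h A s - energy W h A s'.
Proof.
move=> AT TW ss; rewrite /energy.
set B := (T `|` bdry W T)%fset; set B0 := (A `|` bdry W A)%fset.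
have B0B : (B0 `<=` B)%fset.
  apply/fsubsetP => v; rewrite !in_fsetU => /orP[vA|]; first by rewrite (fsubsetP AT).
  move=> /in_bdry[[u uA uv] [vW vA]]; case vT: (v \in T) => //=.
  by apply/in_bdry; split; [exists u => //; exact: (fsubsetP AT)|rewrite vT].
have BW v : v \in B -> v \in W by rewrite in_fsetU => /orP[/TW|/in_bdry[_ []]].
pose dl u v : R := sp (s u) * sp (s v) - sp (s' u) * sp (s' v).
have edges (D : {fset vertex b}) : \sum_(u <- D) \sum_(v <- D | child u v) sp (s u) * sp (s v) -
    \sum_(u <- D) \sum_(v <- D | child u v) sp (s' u) * sp (s' v) =
    \sum_(u <- D) \sum_(v <- D) (if child u v then dl u v else 0).
  rewrite -sumrB; apply: eq_bigr => u _; rewrite -sumrB big_mkcond /=.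
  by apply: eq_bigr => v _.
have dl0 u v : u \notin A -> v \notin A -> dl u v = 0.
  by move=> uA vA; rewrite /dl !ss // subrr.
have inB0 u v : u \in B -> v \in B -> child u v -> (u \in A) || (v \in A) -> (u \in B0) /\ (v \in B0).
  move=> uB vB cuv /orP[uA|vA]; split; rewrite in_fsetU ?uA ?vA //.
    case vA: (v \in A) => //=; apply/in_bdry; rewrite vA; split; last by rewrite BW.
    by exists u => //; rewrite /tree_adj cuv.
  case uA: (u \in A) => //=; apply/in_bdry; rewrite uA; split; last by rewrite BW.
  by exists v => //; rewrite /tree_adj cuv orbT.
have key : \sum_(u <- B) \sum_(v <- B) (if child u v then dl u v else 0) =
    \sum_(u <- B0) \sum_(v <- B0) (if child u v then dl u v else 0).
  rewrite -[LHS](@big_fset_incl _ _ _ _ B0 B) //; last first.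
    move=> u uB uB0; rewrite big_seq big1 // => v vB; case: ifP => // cuv; apply: dl0.
      by apply: contra uB0 => uA; rewrite in_fsetU uA.
    by apply: contra uB0 => vA; have [] := inB0 u v uB vB cuv _; rewrite ?vA ?orbT.
  rewrite big_seq [RHS]big_seq; apply: eq_bigr => u uB0.
  rewrite -[LHS](@big_fset_incl _ _ _ _ B0 B) // => v vB vB0; case: ifP => // cuv.
  have uB := fsubsetP B0B _ uB0; apply: dl0.
    by apply: contra vB0 => uA; have [] := inB0 u v uB vB cuv _; rewrite ?uA.
  by apply: contra vB0 => vA; rewrite in_fsetU vA.
have fld : \sum_(u <- T) sp (s u) - \sum_(u <- T) sp (s' u) = \sum_(u <- A) sp (s u) - \sum_(u <- A) sp (s' u).
  rewrite -!sumrB -[LHS](@big_fset_incl _ _ _ _ A T) // => v _ vA.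
  by rewrite ss // subrr.
have e1 := edges B; have e2 := edges B0; rewrite key in e1.
rewrite -e2 in e1.
set x1 := \sum_(u <- B) _ in e1 *; set x2 := \sum_(u <- B) _ in e1 *.
set x3 := \sum_(u <- B0) _ in e1 *; set x4 := \sum_(u <- B0) _ in e1 *.
set y1 := \sum_(u <- T) _ in fld *; set y2 := \sum_(u <- T) _ in fld *.
set y3 := \sum_(u <- A) _ in fld *; set y4 := \sum_(u <- A) _ in fld *.
transitivity (x1 - x2 + h * (y1 - y2)); first ring.
by rewrite e1 fld; ring.
Qed.

(** The square counts ordered pairs among [x] and its at most [b.+1] neighbors, an overcount of the
    edges. *)
Lemma energy_single_bound x s : `|energy W h [fset x]%fset s| <= (b.+2 ^ 2)%:R + `|h|.
Proof.
rewrite /energy; set B := (_ `|` _)%fset.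
have cB : (#|` B| <= b.+2)%N.
  rewrite /B cardfsU; apply: leq_trans (leq_subr _ _) _; rewrite cardfs1 add1n ltnS.
  apply: leq_trans (card_neighbors x); apply: fsubset_leq_card; apply/fsubsetP => v.
  by move=> /in_bdry[[u]]; rewrite inE => /eqP -> uv _; rewrite in_neighbors.
apply: le_trans (ler_normD _ _) _; apply: lerD; last first.
  by rewrite big_seq_fset1 normrM spin_norm mulr1.
apply: (@le_trans _ _ (\sum_(u <- B) \sum_(v <- B) 1)).
  apply: le_trans (ler_norm_sum _ _ _) _; apply: ler_sum => u _.
  apply: le_trans (ler_norm_sum _ _ _) _; rewrite big_mkcond; apply: ler_sum => v _.
  by case: ifP => // _; rewrite normrM !spin_norm mulr1.
have e1 (D : {fset vertex b}) (c : R) : \sum_(v <- D) c = (#|` D|)%:R * c.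
  by rewrite big_const_seq count_predT iter_addr addr0 mulr_natl.
by rewrite !e1 mulr1 -natrM ler_nat expnS expn1; apply: leq_mul.
Qed.

(** The parent of [r], if any, is outside [W], so the boundary consists of the children of the
    leaves alone. *)
Lemma energy_subtree r m s :
  (forall v, v \in complete_subtree r m.+1 -> v \in W) -> (forall v, isparent v r -> v \notin W) ->
  energy W h (complete_subtree r m) s =
  \sum_(v <- complete_subtree r m) (h * sp (s v) + \sum_(i < b) sp (s v) * sp (s (i :: v))).
Proof.
move=> TW rW; rewrite /energy; set T := complete_subtree r m.
have -> : (T `|` bdry W T)%fset = complete_subtree r m.+1.
  apply/fsetP => v; rewrite in_fsetU [in RHS]mem_complete_subtree; apply/orP/andP => [[|]|[sv hv]].
  - by rewrite /T mem_complete_subtree => /andP[-> h1]; split => //; apply: leq_trans h1 _; rewrite leq_add2l.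
  - move=> /in_bdry[[u uT uv] [vW vT]]; move: uT; rewrite mem_complete_subtree => /andP[su hu].
    case/orP: uv => /childP[i E].
      by rewrite E (suffix_trans su) ?suffix_cons //= addnS ltnS.
    case: (eqVneq u r) => [ur|ur].
      by move: (rW v); rewrite -ur E /= eqxx vW => /(_ isT).
    have sv : suffix r v by apply: suffix_isparent su ur _; rewrite E /= eqxx.
    by split => //; move: hu; rewrite E /= => h1; apply: ltnW; apply: leq_trans h1 _; rewrite leq_add2l.
  - rewrite /T mem_complete_subtree sv /=; case: leqP => [?|h1]; [by left|right].
    have svm : size v = (size r + m).+1 by apply/eqP; rewrite eqn_leq -addnS hv addnS.
    apply/in_bdry; split; last first.
      by split; [apply: TW; rewrite mem_complete_subtree sv|rewrite mem_complete_subtree sv -ltnNge].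
    case: v sv hv h1 svm => // i u sv hv h1 [su].
    exists u; last by rewrite /tree_adj; apply/orP; left; apply/childP; exists i.
    rewrite mem_complete_subtree su leqnn andbT.
    apply: (@suffix_isparent _ _ _ (i :: u)) => //=; apply/eqP => E.
    by move: su; rewrite -E /= => su; exfalso; clear -su; lia.
set B := complete_subtree r m.+1.
have TB : (T `<=` B)%fset.
  apply/fsubsetP => v; rewrite !mem_complete_subtree => /andP[-> h1] /=.
  by apply: leq_trans h1 _; rewrite leq_add2l.
rewrite big_split /= mulr_sumr addrC; congr (_ + _).
rewrite -(@big_fset_incl _ _ _ _ T B) //; last first.
  move=> u; rewrite !mem_complete_subtree => /andP[su hu]; rewrite su /= -ltnNge => hu'.
  rewrite big_seq_cond big1 // => v /andP[]; rewrite mem_complete_subtree => /andP[_ hv] /childP[i E].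
  by move: hv; rewrite E /= addnS ltnS leqNgt hu'.
rewrite big_seq [RHS]big_seq; apply: eq_bigr => u; rewrite mem_complete_subtree => /andP[su hu].
rewrite -big_filter -[RHS]big_enum /= -[RHS](big_map (fun i : 'I_b => i :: u) xpredT (fun v => sp (s u) * sp (s v))).
apply: perm_big; apply: uniq_perm.
- by rewrite filter_uniq // fset_uniq.
- by rewrite map_inj_uniq ?enum_uniq // => i j [].
move=> v; rewrite mem_filter; apply/andP/mapP => [[/childP[i ->] _]|[i _ ->]].
  by exists i; rewrite ?mem_enum.
split; first by apply/childP; exists i.
by rewrite mem_complete_subtree (suffix_trans su) ?suffix_cons //= addnS ltnS.
Qed.

End Energy.

Section Expansion.
Context (R : realType) (b : nat) (K : vertex b -> bool -> bool -> R).
Hypothesis K_gt0 : forall v p a, 0 < K v p a.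

Lemma Qs_indicator (l : seq (vertex b)) (eta s : config b) : uniq l -> topo l ->
  (forall v, v \notin l -> s v = eta v) ->
  Qs K l (fun t => (all (fun v => t v == eta v) l)%:R) s = \prod_(v <- l) K v (par eta v) (eta v).
Proof.
elim: l s => [|v l IH] s; first by rewrite big_nil.
rewrite cons_uniq /topo pairwise_cons => /andP[vl ul] /andP[/allP tv tl] ss.
have -> : (fun t : config b => (all (fun v => t v == eta v) (v :: l))%:R : R) =
  fun t => (t v == eta v)%:R * (all (fun v => t v == eta v) l)%:R.
  by apply/funext => t; rewrite /= -natrM mulnb.
rewrite Qs_cons Qs_pull; last first.
  by move=> t t' tt; rewrite tt.
have pe : par s v = par eta v.
  case: v {vl ss} tv ss => //= i x tv ss; apply: ss.
  rewrite inE negb_or neq_cons; apply/negP => /tv; by rewrite /= eqxx.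
have h a : a = eta v -> Qs K l (fun t => (all (fun v => t v == eta v) l)%:R) (upd s v a) =
    \prod_(w <- l) K w (par eta w) (eta w).
  move=> ->; apply: IH => // w wl; rewrite /upd; case: eqP => [->//|/eqP wv].
  by apply: ss; rewrite inE negb_or wv.
rewrite /Q !upd_same big_cons pe.
case E : (eta v); rewrite ?E in h *.
  by rewrite (h true) //= mul1r mul0r mulr0 addr0.
by rewrite (h false) //= mul1r mul0r mulr0 add0r.
Qed.

Lemma glue_in (A : {fset vertex b}) (s : config b) (xi : {ffun A -> bool}) (v : A) : glue s xi (val v) = xi v.
Proof. by rewrite /glue valK. Qed.

Lemma glue_out (A : {fset vertex b}) (s : config b) (xi : {ffun A -> bool}) v : v \notin A -> glue s xi v = s v.
Proof. by move=> vA; rewrite /glue insubN. Qed.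

Lemma glue_restrict (A : {fset vertex b}) (s t : config b) :
  (forall v, v \notin A -> t v = s v) -> glue s [ffun v : A => t (val v)] = t.
Proof.
move=> ts; apply/funext => v; case vA : (v \in A); last by rewrite glue_out ?vA // ts ?vA.
have := glue_in s [ffun v : A => t (val v)] [` vA]%fset.
by rewrite ffunE.
Qed.

(** Writes [F] as a combination of indicators of the configurations that agree with [s] off [A], and
    evaluates each by [Qs_indicator]. *)
Lemma Qs_expand (A : {fset vertex b}) (l : seq (vertex b)) F s : perm_eq l A -> topo l ->
  Qs K l F s = \sum_(xi : {ffun A -> bool})
    (\prod_(v <- l) K v (par (glue s xi) v) (glue s xi v)) * F (glue s xi).
Proof.
move=> pl tl.
have ul : uniq l by rewrite (perm_uniq pl) fset_uniq.
have memA v : (v \in l) = (v \in A) by exact: perm_mem.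
transitivity (Qs K l (fun t => \sum_(xi : {ffun A -> bool})
   F (glue s xi) * (all (fun v => t v == glue s xi v) l)%:R) s).
  apply: Qs_eq_at => // t ts.
  have tA : forall v, v \notin A -> t v = s v by move=> v vA; apply: ts; rewrite memA.
  rewrite (bigD1 [ffun v : A => t (val v)]) //= glue_restrict // big1.
    rewrite addr0 (_ : all _ _); first by rewrite mulr1.
    by apply/allP => v _.
  move=> xi nxi; rewrite (_ : all _ _ = false) ?mulr0 //.
  apply/negP => /allP h; move/negP: nxi; apply; apply/eqP/ffunP => v.
  have h1 : val v \in l by rewrite memA; exact: valP.
  by rewrite ffunE; have /= /eqP -> := h _ h1; rewrite glue_in.
rewrite Qs_sum; apply: eq_bigr => xi _.
rewrite QsZ mulrC Qs_indicator // => v; rewrite memA => vA.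
by rewrite glue_out.
Qed.

End Expansion.

(** * Gibbs weights as products of edge kernels *)

Section ProductFormula.
Context (R : realType) (b : nat) (beta h : R) (fld : vertex b -> R).
Implicit Types (v x : vertex b) (s : config b).

Local Notation sp := (spin R).

(** Read off from [edge_weight] at [p = a = true]. *)
Definition edge_const (u : R) : R := expR (beta + u / 2 - gfun beta u / 2) / logis (u + 2 * beta).

Lemma edge_const_gt0 u : 0 < edge_const u.
Proof. by rewrite divr_gt0 ?expR_gt0 ?logis_gt0. Qed.

Lemma logisN (x : R) : logis (- x) = logis x * expR (- x).
Proof.
rewrite logisE logisE expRN; have := expR_gt0 x; move: (expR x) => e e0.
have n0 : e != 0 by rewrite gt_eqF.
have n1 : 1 + e != 0 by rewrite gt_eqF //; lra.
have n2 : e + 1 != 0 by rewrite gt_eqF //; lra.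
by field; rewrite ?n0 ?n1 ?n2.
Qed.

(** Summing the left side over [a] gives, up to a constant, the message
    [expR (sp p * gfun beta u / 2)] to the parent; the remaining factor is the law of the child
    given the parent. *)
Lemma edge_weight (u : R) (p a : bool) :
  expR (beta * (sp p * sp a) + u * sp a / 2) =
  edge_const u * expR (sp p * gfun beta u / 2) * logis (sp a * (u + 2 * beta * sp p)).
Proof.
have L0 := logis_gt0 (u + 2 * beta); have Lm0 := logis_gt0 (u - 2 * beta).
have hm : logis (u - 2 * beta) = logis (u + 2 * beta) * expR (gfun beta u - 2 * beta).
  have := @gfun_bayes_spin R beta u true; rewrite !mul1r mulr1 => ->.
  by rewrite -mulrA -expRD [X in expR X](_ : _ = 0) ?expR0 ?mulr1 //; ring.
have F3 (L e1 e2 e3 : R) : 0 < L -> e1 / L * e2 * (L * e3) = e1 * e2 * e3.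
  by move=> L_gt0; field; rewrite gt_eqF.
rewrite /edge_const; case: p; case: a; rewrite /spin ?mul1r ?mulr1 ?mulN1r ?mulrN1 ?opprK.
- by rewrite mulrAC divfK ?gt_eqF // -expRD; congr expR; field.
- by rewrite logisN F3 // -!expRD; congr expR; field.
- by rewrite hm F3 // -!expRD; congr expR; field.
- by rewrite logisN hm -[logis _ * _ * _]mulrA F3 // -!expRD; congr expR; field.
Qed.

(* The logarithm of the weight of the subtree of x cut at depth k, where the
   leaves only keep half of their effective field. *)
Fixpoint Hrec (k : nat) x s : R :=
  if k is k'.+1 then beta * h * sp (s x) + \sum_(i < b) (beta * (sp (s x) * sp (s (i :: x))) + Hrec k' (i :: x) s)
  else fld x * sp (s x) / 2.

Fixpoint wrec (k : nat) x s : R :=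
  if k is k'.+1 then \prod_(i < b) (logis (sp (s (i :: x)) * (fld (i :: x) + 2 * beta * sp (s x))) * wrec k' (i :: x) s)
  else 1.

(** Edges are eliminated from the leaves upwards by [edge_weight]; the messages that arrive at a
    vertex, with its external field, make up half of its effective field, by the recursion for
    [fld]. *)
Lemma Hrec_wrec k x :
  (forall v, suffix x v -> (size v < size x + k)%N -> fld v = 2 * beta * h + \sum_(i < b) gfun beta (fld (i :: v))) ->
  exists2 C : R, 0 < C & forall s, expR (Hrec k x s) = C * expR (fld x * sp (s x) / 2) * wrec k x s.
Proof.
elim: k x => [|k IH] x hf; first by exists 1 => // s; rewrite /= mul1r mulr1.
have HC i : exists C : R, 0 < C /\ forall s, expR (Hrec k (i :: x) s) =
    C * expR (fld (i :: x) * sp (s (i :: x)) / 2) * wrec k (i :: x) s.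
  have [|C C0 hC] := IH (i :: x); last by exists C.
  move=> v sv hv; apply: hf; first by apply: suffix_trans sv; exact: suffix_cons.
  by rewrite addnS -addSn.
have [C hC] := choice HC.
exists (\prod_(i < b) (C i * edge_const (fld (i :: x)))).
  by apply: prodr_gt0 => i _; rewrite mulr_gt0 ?edge_const_gt0 //; have [] := hC i.
move=> s; rewrite /= expRD expR_sum.
have -> : fld x = 2 * beta * h + \sum_(i < b) gfun beta (fld (i :: x)).
  by apply: hf; rewrite ?suffix_refl // addnS ltnS leq_addr.
have -> : (2 * beta * h + \sum_(i < b) gfun beta (fld (i :: x))) * sp (s x) / 2 =
  beta * h * sp (s x) + \sum_(i < b) sp (s x) * gfun beta (fld (i :: x)) / 2.
  by rewrite -mulr_suml -mulr_sumr; field.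
rewrite expRD expR_sum mulrCA -[RHS]mulrA; congr (_ * _).
rewrite -!big_split /=; apply: eq_bigr => i _.
have [_ hi] := hC i; rewrite expRD hi.
transitivity (C i * wrec k (i :: x) s * (expR (beta * (sp (s x) * sp (s (i :: x)))) * expR (fld (i :: x) * sp (s (i :: x)) / 2))).
  by ring.
by rewrite -expRD edge_weight; ring.
Qed.

(** The root takes no parent term, since its parent, if any, does not interact with the volume. *)
Definition chain_kernel r v (p a : bool) : R :=
  if v == r then logis (sp a * fld v) else logis (sp a * (fld v + 2 * beta * sp p)).

Lemma prod_chain_kernel r k x s : suffix r x ->
  \prod_(v <- complete_subtree x k) chain_kernel r v (par s v) (s v) =
  chain_kernel r x (par s x) (s x) * wrec k x s.
Proof.
elim: k x => [|k IH] x rx; first by rewrite big_complete_subtree0 mulr1.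
rewrite big_complete_subtreeS; congr (_ * _); apply: eq_bigr => i _.
rewrite IH ?(suffix_trans rx) ?suffix_cons // /chain_kernel ifN //.
by apply/eqP => E; move: rx; rewrite -E (negbTE (suffix_consN _ _)).
Qed.

Lemma Hrec_chain r k :
  (forall v, suffix r v -> (size v < size r + k)%N -> fld v = 2 * beta * h + \sum_(i < b) gfun beta (fld (i :: v))) ->
  exists2 C : R, 0 < C &
    forall s, expR (Hrec k r s) = C * \prod_(v <- complete_subtree r k) chain_kernel r v (par s v) (s v).
Proof.
move=> hf; have [C C0 hC] := Hrec_wrec hf.
exists (C * (expR (fld r / 2) / logis (fld r))).
  by rewrite mulr_gt0 // divr_gt0 ?expR_gt0 ?logis_gt0.
move=> s; rewrite hC prod_chain_kernel ?suffix_refl // /chain_kernel eqxx.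
have L0 := logis_gt0 (fld r).
have -> : expR (fld r * sp (s r) / 2) = expR (fld r / 2) / logis (fld r) * logis (sp (s r) * fld r).
  case: (s r); rewrite /spin ?mul1r ?mulr1 ?mulN1r ?mulrN1; first by rewrite divfK // gt_eqF.
  by rewrite logisN mulrA divfK ?gt_eqF // -expRD; congr expR; field.
by ring.
Qed.

End ProductFormula.

Section VertexList.
Context (b : nat) (r : vertex b) (m : nat).

Definition vlist : seq (vertex b) := sort (fun v w => size v <= size w)%N (complete_subtree r m).

Lemma perm_vlist : perm_eq vlist (complete_subtree r m).
Proof. by rewrite perm_sort. Qed.

Lemma vlist_uniq : uniq vlist.
Proof. by rewrite (perm_uniq perm_vlist) fset_uniq. Qed.

Lemma vlist_sorted : level_sorted vlist.
Proof.
rewrite /level_sorted -sorted_pairwise; last by move=> ? ? ?; exact: leq_trans.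
by apply: sort_sorted => v w; exact: leq_total.
Qed.

Lemma mem_vlist v : (v \in vlist) = suffix r v && (size v <= size r + m)%N.
Proof. by rewrite (perm_mem perm_vlist) mem_complete_subtree. Qed.

Lemma vlist_topo : topo vlist.
Proof. exact/level_sorted_topo/vlist_sorted. Qed.

End VertexList.

Section FiniteVolume.
Context (R : realType) (b : nat) (beta h : R) (tau : config b) (r : vertex b) (m : nat).
Implicit Types (v x : vertex b) (s : config b).

Local Notation sp := (spin R).
Local Notation T := (complete_subtree r m).
Local Notation W := (mem (complete_subtree r m.+1)).
Local Notation Om := (Omega r m).

(* The effective field on a vertex from the part of the tree below it and the boundary condition. *)
Fixpoint efield (k : nat) x : R :=
  2 * beta * h + (if k is k'.+1 then \sum_(i < b) gfun beta (efield k' (i :: x))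
                  else \sum_(i < b) 2 * beta * sp (tau (i :: x))).

Definition fld v : R := efield (size r + m - size v) v.

Lemma fld_rec v : (size v < size r + m)%N ->
  fld v = 2 * beta * h + \sum_(i < b) gfun beta (fld (i :: v)).
Proof.
move=> hv; rewrite /fld /=.
have -> : (size r + m - size v)%N = (size r + m - (size v).+1).+1 by lia.
by [].
Qed.

Lemma fld_leaf v : size v = (size r + m)%N ->
  fld v = 2 * beta * h + \sum_(i < b) 2 * beta * sp (tau (i :: v)).
Proof. by move=> hv; rewrite /fld hv subnn. Qed.

Local Notation K := (chain_kernel beta fld r).

Lemma chain_kernel_gt0 v p a : 0 < K v p a.
Proof. by rewrite /chain_kernel; case: ifP => _; exact: logis_gt0. Qed.

Lemma chain_kernel_sum v p : K v p true + K v p false = 1.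
Proof. by rewrite /chain_kernel /spin; case: ifP => _; rewrite !mul1r !mulN1r logis_sum. Qed.

(** Half of the effective field of a leaf is exactly the external field plus the edges to the
    boundary spins, so the cut at the leaves reproduces the full energy. *)
Lemma Hrec_energy k x s : suffix r x -> (size x + k = size r + m)%N ->
  (forall v, v \notin T -> s v = tau v) ->
  Hrec beta h fld k x s =
  beta * \sum_(v <- complete_subtree x k) (h * sp (s v) + \sum_(i < b) sp (s v) * sp (s (i :: v))).
Proof.
move=> + + stau; elim: k x => [|k IH] x rx hx.
  rewrite big_complete_subtree0 /= fld_leaf -?hx ?addn0 //.
  have -> : \sum_(i < b) 2 * beta * sp (tau (i :: x)) = 2 * beta * \sum_(i < b) sp (s (i :: x)).
    rewrite mulr_sumr; apply: eq_bigr => i _; rewrite stau // mem_complete_subtree /= -hx addn0.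
    by rewrite ltnn andbF.
  by rewrite -mulr_sumr; field.
rewrite big_complete_subtreeS /= mulrDr mulrDr mulrA -addrA; congr (_ + _).
rewrite big_split /= [in RHS]mulr_sumr [in RHS]mulr_sumr; congr (_ + _).
apply: eq_bigr => i _; rewrite IH //; first by rewrite (suffix_trans rx) ?suffix_cons.
by rewrite /= addSn -addnS.
Qed.

Lemma fullc_out (xi : Om) v : v \notin T -> fullc tau xi v = tau v.
Proof. exact: glue_out. Qed.

Lemma energy_Hrec s : (forall v, v \notin T -> s v = tau v) ->
  beta * energy W h T s = Hrec beta h fld m r s.
Proof.
move=> stau; rewrite Hrec_energy ?suffix_refl // energy_subtree // => v /isparent_size sr.
apply/negP => vW; have : v \in complete_subtree r m.+1 by exact: vW.
by rewrite mem_complete_subtree => /andP[/suffix_size]; rewrite sr ltnn.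
Qed.

Definition weight (xi : Om) : R :=
  \prod_(v <- vlist r m) K v (par (fullc tau xi) v) (fullc tau xi v).

Lemma Qs_weight (F : config b -> R) :
  Qs K (vlist r m) F tau = \sum_(xi : Om) weight xi * F (fullc tau xi).
Proof. exact: (Qs_expand chain_kernel_gt0 _ _ (perm_vlist r m) (vlist_topo r m)). Qed.

Lemma weight_sum : \sum_(xi : Om) weight xi = 1.
Proof.
have := Qs_weight (fun=> 1); rewrite Qs_cst; last exact: chain_kernel_sum.
by move=> ->; apply: eq_bigr => xi _; rewrite mulr1.
Qed.

(** Both sides are proportional by [Hrec_chain]; as the kernel weights already sum to 1, the
    partition function is the proportionality constant. *)
Lemma mu_weight (xi : Om) : mu beta h tau xi = weight xi.
Proof.
have [C C0 hC] : exists2 C : R, 0 < C & forall xi : Om, expR (beta * energy W h T (fullc tau xi)) = C * weight xi.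
  have [C C0 hC] := @Hrec_chain R b beta h fld r m (fun v _ hv => fld_rec hv).
  exists C => // zeta; rewrite energy_Hrec; last by move=> v; exact: fullc_out.
  by rewrite hC; congr (_ * _); apply: perm_big; rewrite perm_sym perm_vlist.
rewrite /mu /gibbs ifT; last by apply/asboolP => v; exact: fullc_out.
rewrite hC; have -> : \sum_(zeta : {ffun T -> bool}) expR (beta * energy W h T (glue tau zeta)) = C.
  transitivity (\sum_(zeta : Om) C * weight zeta); first by apply: eq_bigr => zeta _; exact: hC.
  by rewrite -mulr_sumr weight_sum mulr1.
by rewrite mulrAC mulfV ?mul1r // gt_eqF.
Qed.

Lemma mu_gt0 (xi : Om) : 0 < mu beta h tau xi.
Proof. by rewrite mu_weight; apply: prodr_gt0 => v _; exact: chain_kernel_gt0. Qed.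

Lemma mu_sum : \sum_(xi : Om) mu beta h tau xi = 1.
Proof. by rewrite -weight_sum; apply: eq_bigr => xi _; exact: mu_weight. Qed.

Lemma mu_ge (delta : R) (xi : Om) : 0 <= delta -> (forall v p a, delta <= K v p a) ->
  delta ^+ #|` T| <= mu beta h tau xi.
Proof.
move=> d0 hK; rewrite mu_weight /weight.
have -> : #|` T| = size (vlist r m) by rewrite (perm_size (perm_vlist r m)).
elim: (vlist r m) => [|v l IH]; first by rewrite big_nil expr0.
by rewrite big_cons exprS; apply: ler_pM => //; exact: exprn_ge0.
Qed.

Definition rate (s : Om) (x : T) : R :=
  gibbs W beta h [fset val x]%fset (fullc tau s) (fullc tau (flip s x)).

Lemma fullc_flip (s : Om) (x : T) : fullc tau (flip s x) = upd (fullc tau s) (val x) (~~ fullc tau s (val x)).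
Proof.
apply/funext => v; rewrite /upd; case: (boolP (v \in T)) => vT; last first.
  rewrite !(@fullc_out _ v) // ifN //; apply: contraNneq vT => ->; exact: valP.
rewrite (_ : fullc tau (flip s x) v = flip s x [` vT]%fset); last exact: (glue_in tau _ [` vT]%fset).
rewrite ffunE -[v == val x]/(val [` vT]%fset == val x) val_eqE.
by case: (eqVneq [` vT]%fset x) => [->|_]; rewrite -(glue_in tau s).
Qed.

(** Numerator and terms of the normalising sum lie between the exponentials of minus and plus [beta]
    times the bound of [energy_single_bound]; the sum has two terms. *)
Definition rate_const : R := expR (- (2 * beta * ((b.+2 ^ 2)%:R + `|h|))) / 2.

Lemma rateE (s : Om) (x : T) : rate s x = expR (beta * energy W h [fset val x]%fset (fullc tau (flip s x))) /
  \sum_(xi : {ffun [fset val x]%fset -> bool}) expR (beta * energy W h [fset val x]%fset (glue (fullc tau s) xi)).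
Proof.
rewrite /rate /gibbs ifT //; apply/asboolP => v; rewrite inE => vx.
by rewrite fullc_flip upd_other.
Qed.

Lemma rate_ge (s : Om) (x : T) : 0 <= beta -> rate_const <= rate s x.
Proof.
move=> b0; rewrite rateE /rate_const.
set E := (b.+2 ^ 2)%:R + `|h|.
have bd t : expR (- (beta * E)) <= expR (beta * energy W h [fset val x]%fset t) <= expR (beta * E).
  have /ler_normlP[h1 h2] := energy_single_bound W h (val x) t.
  by rewrite !ler_expR -mulrN !ler_wpM2l // lerNl.
have -> : - (2 * beta * E) = - (beta * E) - beta * E by ring.
rewrite expRB -mulrA -invfM; apply: ler_pM; rewrite ?expR_ge0 //.
- by have /andP[] := bd (fullc tau (flip s x)).
have S0 : 0 < \sum_(xi : {ffun [fset val x]%fset -> bool}) expR (beta * energy W h [fset val x]%fset (glue (fullc tau s) xi)).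
  rewrite (bigD1 [ffun=> true]) //= ltr_pwDl ?expR_gt0 //; apply: sumr_ge0 => xi _; exact: expR_ge0.
have E0 : 0 < expR (beta * E) * 2 by rewrite mulr_gt0 ?expR_gt0.
rewrite lef_pV2 ?posrE //.
apply: (@le_trans _ _ (\sum_(xi : {ffun [fset val x]%fset -> bool}) expR (beta * E))).
  by apply: ler_sum => xi _; have /andP[] := bd (glue (fullc tau s) xi).
rewrite sumr_const card_ffun card_bool -cardfE cardfs1 expn1 mulr2n; lra.
Qed.

End FiniteVolume.

(** * The Glauber generator and its logarithmic Sobolev inequality *)

Section GlauberChain.
Context (R : realType) (b : nat) (beta h : R) (tau : config b) (r : vertex b) (m : nat).

Local Notation sp := (spin R).
Local Notation T := (complete_subtree r m).
Local Notation W := (mem (complete_subtree r m.+1)).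
Local Notation Om := (Omega r m).
Local Notation rate := (@rate R b beta h tau r m).
Local Notation mu := (@mu R b beta h tau r m).

Lemma flipK (s : Om) (x : T) : flip (flip s x) x = s.
Proof. by apply/ffunP => y; rewrite !ffunE; case: (y == x); rewrite ?negbK. Qed.

Lemma flip_neq (s : Om) (x : T) : flip s x != s.
Proof. by apply/eqP => /ffunP /(_ x); rewrite ffunE eqxx; case: (s x). Qed.

Lemma flip_other (s : Om) (x : T) v : v \notin [fset val x]%fset -> fullc tau (flip s x) v = fullc tau s v.
Proof. by rewrite inE => vx; rewrite fullc_flip upd_other. Qed.

Lemma glue_flip (s : Om) (x : T) xi : glue (A := [fset val x]%fset) (fullc tau (flip s x)) xi = glue (fullc tau s) xi.
Proof.
apply/funext => v; rewrite /Defs.glue; case: insubP => [//|/=] vx.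
by rewrite flip_other.
Qed.

Lemma rate_gt0 (s : Om) (x : T) : 0 < rate s x.
Proof.
rewrite rateE divr_gt0 ?expR_gt0 // (bigD1 [ffun=> true]) //= ltr_pwDl ?expR_gt0 //.
by apply: sumr_ge0 => xi _; exact: expR_ge0.
Qed.

(** The normalising sum of the rate ignores the spin at [x], and a flip at [x] changes the energy of
    [T] by as much as the energy of [x] alone ([energy_diff]). *)
Lemma rate_balance (s : Om) (x : T) : mu s * rate s x = mu (flip s x) * rate (flip s x) x.
Proof.
rewrite !rateE flipK.
under [X in _ = _ * (_ / X)]eq_bigr do rewrite glue_flip.
rewrite /Defs.mu /gibbs !ifT; last 2 first.
- by apply/asboolP => v; exact: fullc_out.
- by apply/asboolP => v; exact: fullc_out.
have E : expR (beta * energy W h T (fullc tau s)) * expR (beta * energy W h [fset val x]%fset (fullc tau (flip s x))) =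
  expR (beta * energy W h T (fullc tau (flip s x))) * expR (beta * energy W h [fset val x]%fset (fullc tau s)).
  have := @energy_diff R b W h [fset val x]%fset T (fullc tau s) (fullc tau (flip s x)).
  move=> /(_ _ _ _) H; rewrite -!expRD -!mulrDr; congr (expR (beta * _)).
  have {H} : energy W h T (fullc tau s) - energy W h T (fullc tau (flip s x)) =
    energy W h [fset val x]%fset (fullc tau s) - energy W h [fset val x]%fset (fullc tau (flip s x)).
    apply: H; last by move=> v vx; rewrite flip_other.
      by rewrite fsub1set; exact: valP.
    by move=> v; rewrite !mem_complete_subtree => /andP[-> /=]; rewrite addnS => /leqW.
  by move=> H; lra.
rewrite mulrACA E [RHS]mulrACA; congr (_ * _).
Qed.

Definition glauber_mx (s t : Om) : R := \sum_(x : T) rate s x * ((t == flip s x)%:R - (t == s)%:R).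

Lemma mxop_glauber_mx (f : Om -> R) s : mxop glauber_mx f s = \sum_(x : T) rate s x * (f (flip s x) - f s).
Proof.
rewrite /mxop /glauber_mx; under eq_bigr do rewrite mulr_suml.
rewrite exchange_big /=; apply: eq_bigr => x _.
under eq_bigr do rewrite -mulrA; rewrite -mulr_sumr; congr (_ * _).
under eq_bigr do rewrite mulrBl; rewrite sumrB.
rewrite (bigD1 (flip s x)) //= eqxx mul1r big1 => [|t /negbTE ->]; last by rewrite mul0r.
by rewrite addr0 (bigD1 s) //= eqxx mul1r big1 ?addr0 // => t /negbTE ->; rewrite mul0r.
Qed.

Lemma generatorE : @generator R b beta h tau r m = mxop glauber_mx.
Proof. by apply/funext => f; apply/funext => s; rewrite mxop_glauber_mx. Qed.

Lemma glauber_mx_row s : \sum_t glauber_mx s t = 0.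
Proof.
have := mxop_glauber_mx (fun=> 1) s; rewrite /mxop; under eq_bigr do rewrite mulr1.
by move=> ->; rewrite big1 // => x _; rewrite subrr mulr0.
Qed.

Lemma glauber_mx_off s t : s != t -> 0 <= glauber_mx s t.
Proof.
move=> st; apply: sumr_ge0 => x _; rewrite [t == s]eq_sym (negbTE st) subr0.
by rewrite mulr_ge0 // ltW // rate_gt0.
Qed.

Lemma glauber_mx_rev s t : mu s * glauber_mx s t = mu t * glauber_mx t s.
Proof.
case: (eqVneq s t) => [-> //|st]; rewrite /glauber_mx !mulr_sumr; apply: eq_bigr => x _.
rewrite (negbTE st) [t == s]eq_sym (negbTE st) !subr0.
case: (eqVneq t (flip s x)) => [->|nt]; first by rewrite flipK eqxx !mulr1 rate_balance.
case: (eqVneq s (flip t x)) => [E|_]; last by rewrite !mulr0.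
by case/eqP: nt; rewrite E flipK.
Qed.

Lemma mu_le1 (s : Om) : mu s <= 1.
Proof.
rewrite -(mu_sum beta h tau r m) (bigD1 s) //= lerDl; apply: sumr_ge0 => t _.
by apply: ltW; exact: mu_gt0.
Qed.

Lemma glauber_dirichlet (w : Om -> R) :
  - mean mu (fun s => w s * mxop glauber_mx w s) =
  2^-1 * \sum_s mu s * \sum_(x : T) rate s x * (w (flip s x) - w s) ^+ 2.
Proof.
rewrite (dirichletE glauber_mx_row glauber_mx_rev) opprK; congr (_ * _); apply: eq_bigr => s _.
under eq_bigr do rewrite -mulrA; rewrite -mulr_sumr; congr (_ * _).
have := mxop_glauber_mx (fun t => (w t - w s) ^+ 2) s; rewrite /mxop => ->.
by apply: eq_bigr => x _; rewrite subrr expr0n subr0.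
Qed.

Definition restr (s : config b) : Om := [ffun v : T => s (val v)].

Lemma restr_fullc (xi : Om) : restr (fullc tau xi) = xi.
Proof. by apply/ffunP => v; rewrite ffunE; exact: glue_in. Qed.

Lemma restr_upd (xi : Om) (x : T) : fullc tau xi (val x) = false ->
  restr (upd (fullc tau xi) (val x) true) = flip xi x.
Proof. by move=> E; rewrite -[RHS]restr_fullc fullc_flip E. Qed.

Local Notation K := (chain_kernel beta (fld beta h tau r m) r).

Lemma Qs_mean (F : Om -> R) : Qs K (vlist r m) (fun s => F (restr s)) tau = mean mu F.
Proof.
by rewrite Qs_weight; apply: eq_bigr => xi _; rewrite restr_fullc mu_weight.
Qed.

(** At a minus, [grad] is the difference across the flip, whose rate is at least [rate_const]; at a
    plus it vanishes. The factor 2 undoes the half in the Dirichlet form. *)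
Lemma glauber_LSI (C : R) : 0 <= beta -> 0 < C ->
  (forall f, (forall s, 0 < f s) ->
     Ent K (vlist r m) (fun s => f s ^+ 2) tau <=
     C * \sum_(v <- vlist r m) Qs K (vlist r m) (fun s => grad f v s ^+ 2) tau) ->
  forall w : Om -> R, (forall x, 0 < w x) ->
   mean mu (fun x => w x ^+ 2 * ln (w x ^+ 2)) - mean mu (fun x => w x ^+ 2) * ln (mean mu (fun x => w x ^+ 2)) <=
   (2 * C / rate_const b beta h) * - mean mu (fun x => w x * mxop glauber_mx w x).
Proof.
move=> b0 C0 H w w0; have := H (fun s => w (restr s)) (fun s => w0 _).
rewrite /Ent -(Qs_mean (fun x => w x ^+ 2 * ln (w x ^+ 2))) -(Qs_mean (fun x => w x ^+ 2)).
move=> /le_trans; apply; rewrite glauber_dirichlet.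
have c0 : 0 < rate_const b beta h by rewrite divr_gt0 // expR_gt0.
have -> (x : R) : 2 * C / rate_const b beta h * (2^-1 * x) = C * (x / rate_const b beta h).
  by field; rewrite gt_eqF.
rewrite ler_pM2l // ler_pdivlMr //.
rewrite (perm_big _ (perm_vlist r m)) big_seq_fsetE /=.
have -> : \sum_s mu s * (\sum_(x : T) rate s x * (w (flip s x) - w s) ^+ 2) =
  \sum_(x : T) \sum_s mu s * (rate s x * (w (flip s x) - w s) ^+ 2).
  by rewrite exchange_big; apply: eq_bigr => s _; rewrite mulr_sumr.
rewrite mulr_suml; apply: ler_sum => x _; rewrite Qs_weight mulr_suml.
apply: ler_sum => s _; rewrite -mu_weight -mulrA ler_pM2l ?mu_gt0 // /grad restr_fullc mulrC.
case E : (fullc tau s (val x)).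
  have -> : upd (fullc tau s) (val x) true = fullc tau s.
    by apply/funext => v; rewrite /upd; case: eqVneq => [->|].
  by rewrite restr_fullc subrr expr0n mulr0 mulr_ge0 ?sqr_ge0 // ltW // rate_gt0.
rewrite restr_upd // -sqrrN opprB; apply: ler_wpM2r; first exact: sqr_ge0.
exact: rate_ge.
Qed.

Lemma fld_bound v : 0 <= beta -> `|fld beta h tau r m v| <= 2 * beta * (`|h| + b%:R).
Proof.
move=> b0; rewrite /fld.
have sumb (F : 'I_b -> R) : (forall i, `|F i| <= 2 * beta) -> `|\sum_i F i| <= 2 * beta * b%:R.
  move=> hF; apply: le_trans (ler_norm_sum _ _ _) _.
  apply: le_trans (ler_sum _ (fun i _ => hF i)) _.
  by rewrite sumr_const card_ord mulr_natr.
have hh : `|2 * beta * h| = 2 * beta * `|h| by rewrite normrM ger0_norm // mulr_ge0.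
case: (size r + m - size v)%N => [|k] /=; rewrite mulrDr; apply: le_trans (ler_normD _ _) _; rewrite hh lerD2l;
  apply: sumb => i.
  by rewrite normrM spin_norm mulr1 ger0_norm // mulr_ge0.
exact: gfun_bound.
Qed.

Lemma chain_kernel_ge v p a : 0 <= beta ->
  logis (- (2 * beta * (`|h| + b%:R + 1))) <= K v p a.
Proof.
move=> b0; have /ler_normlP[h1 h2] := @fld_bound v b0.
have hb2 : 0 <= 2 * beta by rewrite mulr_ge0.
rewrite /chain_kernel; case: ifP => _; apply: logis_le; rewrite mulrDr mulr1;
  case: a; case: p; rewrite /spin ?mul1r ?mulN1r ?mulr1 ?mulrN1; lra.
Qed.

End GlauberChain.

(** * Mixing times *)

Section FirstTime.
Context (R : realType).

(** The infimum of the admissible times is attained by continuity, and it is positive because the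
    bound fails at time 0; mixing times are minima over positive times. *)
Lemma first_time (I : finType) (d : I -> R -> R) (c t1 : R) :
  (forall i, continuous (d i)) -> 0 <= t1 -> (forall i, d i t1 <= c) -> (exists i, c < d i 0) ->
  exists t, [/\ 0 < t, t <= t1, forall i, d i t <= c & forall u, 0 < u -> (forall i, d i u <= c) -> t <= u].
Proof.
move=> dc t10 dt1 [i0 hi0].
pose S := [set u : R | 0 <= u /\ forall i, d i u <= c]%classic.
have S1 : S t1 by [].
have lbS : lbound S 0 by move=> u [].
have hS : has_inf S by split; [exists t1|exists 0].
have St : forall i, d i (inf S) <= c.
  move=> i; rewrite leNgt; apply/negP => ci.
  have := dc i (inf S) => /cvgrPdist_lt /(_ (d i (inf S) - c)).
  rewrite subr_gt0 => /(_ ci) /nbhs_ballP[e e0 he].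
  have [u Su ue] := inf_adherent e0 hS.
  have := ge_inf hS.2 Su => iu.
  have := he u; rewrite /ball /= => /(_ _).
  rewrite ltr_distlC => H.
  have /H : inf S - e < u < inf S + e by rewrite ue andbT; lra.
  by move=> /ltr_normlW; case: Su => _ /(_ i); lra.
have t0 : 0 <= inf S by apply: lb_le_inf => //; exists t1.
exists (inf S); split => //.
- rewrite lt_neqAle t0 andbT; apply/eqP => E.
  by have := St i0; rewrite -E leNgt hi0.
- by apply: ge_inf => //; exists 0.
by move=> u u0 hu; apply: ge_inf; [exists 0|split => //; exact: ltW].
Qed.

Lemma continuous_bigsum (I : Type) (s : seq I) (f : I -> R -> R) :
  (forall i, continuous (f i)) -> continuous (fun t => \sum_(i <- s) f i t).
Proof.
move=> fc; elim: s => [|i s IH] t.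
  have -> : (fun t => \sum_(i <- [::]) f i t) = fun=> 0 by apply/funext => u; rewrite big_nil.
  exact: cvg_cst.
have -> : (fun t => \sum_(j <- i :: s) f j t) = (fun t => f i t + \sum_(j <- s) f j t).
  by apply/funext => u; rewrite big_cons.
by apply: cvgD; [exact: fc|exact: IH].
Qed.

End FirstTime.

Section Mean.
Context (R : realType) (X : finType) (pi : X -> R).
Hypothesis pi_gt0 : forall x, 0 < pi x.
Hypothesis pi_sum : \sum_x pi x = 1.

Lemma mean_norm_ge0 (g : X -> R) : 0 <= mean pi (fun x => `|g x|).
Proof. by apply: sumr_ge0 => x _; rewrite mulr_ge0 // ltW. Qed.

Lemma mean_norm_sqr (g : X -> R) : mean pi (fun x => `|g x|) ^+ 2 <= mean pi (fun x => g x ^+ 2).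
Proof.
set a := mean pi (fun x => `|g x|).
have : 0 <= \sum_x pi x * (`|g x| - a) ^+ 2 by apply: sumr_ge0 => x _; rewrite mulr_ge0 ?sqr_ge0 // ltW.
have -> c : \sum_x pi x * (`|g x| - c) ^+ 2 =
    mean pi (fun x => g x ^+ 2) - 2 * c * mean pi (fun x => `|g x|) + c ^+ 2 * \sum_x pi x.
  rewrite /mean !mulr_sumr -sumrB -big_split /=; apply: eq_bigr => x _.
  by rewrite sqrrB real_normK ?num_real //; ring.
rewrite -/a pi_sum; lra.
Qed.

Lemma mean_norm_delta (x0 : X) : mean pi (fun x => `|(x == x0)%:R / pi x0 - 1|) = 2 * (1 - pi x0).
Proof.
have h : \sum_(x | x != x0) pi x = 1 - pi x0 by have := pi_sum; rewrite (bigD1 x0) //= => <-; ring.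
rewrite /mean (bigD1 x0) //= eqxx mulr1n.
under eq_bigr => x /negbTE -> do rewrite mul0r sub0r normrN1 mulr1.
have p1 : pi x0 <= 1 by rewrite -subr_ge0 -h; apply: sumr_ge0 => x _; exact: ltW.
have p0 := pi_gt0 x0.
rewrite h ger0_norm; last by rewrite subr_ge0 mul1r invf_ge1.
by field; rewrite gt_eqF.
Qed.

End Mean.

Section Mixing.
Context (R : realType) (b : nat) (beta h : R) (tau : config b) (r : vertex b) (m : nat).
Local Notation T := (complete_subtree r m).
Local Notation Om := (Omega r m).
Local Notation mu := (@Defs.mu R b beta h tau r m).
Local Notation glauber_mx := (@glauber_mx R b beta h tau r m).

Definition reldens (s : Om) (t : R) (eta : Om) : R := expsol glauber_mx (fun x => (x == s)%:R / mu s) t eta.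

Lemma densityE t (s eta : Om) : Defs.density beta h tau t s eta = reldens s t eta.
Proof.
rewrite /Defs.density /reldens -expsol_sym; last 2 first.
- exact: glauber_mx_rev.
- exact: mu_gt0.
by rewrite /heat_kernel generatorE.
Qed.

Definition L1gap (s : Om) (t : R) : R := mean mu (fun x => `|reldens s t x - 1|).
Definition L2gap (s : Om) (t : R) : R := mean mu (fun x => (reldens s t x - 1) ^+ 2).

Lemma L1_distance_le t c : 0 <= c -> Lp_distance beta h tau r m 1 t <= c <-> forall s, L1gap s t <= c.
Proof.
move=> c0; have E s : Lp_norm beta h tau 1 (fun eta => Defs.density beta h tau t s eta - 1) = L1gap s t.
  rewrite /Lp_norm invr1 powRr1; last by apply: sumr_ge0 => x _; rewrite mulr_ge0 ?powR_ge0 // ltW // mu_gt0.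
  by apply: eq_bigr => x _; rewrite powRr1 // densityE.
rewrite /Lp_distance; split=> [/bigmax_leP[_ H] s|H]; first by rewrite -E H.
by apply/bigmax_leP; split => // s _; rewrite E.
Qed.

Lemma L2_distance_le t c : 0 <= c -> Lp_distance beta h tau r m 2 t <= c <-> forall s, L2gap s t <= c ^+ 2.
Proof.
move=> c0; have p0 s : 0 <= L2gap s t by apply: sumr_ge0 => x _; rewrite mulr_ge0 ?sqr_ge0 // ltW // mu_gt0.
have E s : Lp_norm beta h tau 2 (fun eta => Defs.density beta h tau t s eta - 1) = Num.sqrt (L2gap s t).
  rewrite /Lp_norm powR12_sqrt; last by apply: sumr_ge0 => x _; rewrite mulr_ge0 ?powR_ge0 // ltW // mu_gt0.
  by congr Num.sqrt; apply: eq_bigr => x _; rewrite powR_mulrn // densityE real_normK ?num_real.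
have E' s : (Num.sqrt (L2gap s t) <= c) = (L2gap s t <= c ^+ 2).
  by rewrite -[in LHS](ger0_norm c0) -sqrtr_sqr ler_sqrt // sqr_ge0.
rewrite /Lp_distance; split=> [/bigmax_leP[_ H] s|H]; first by rewrite -E' -E H.
by apply/bigmax_leP; split => // s _; rewrite E E'.
Qed.

Lemma dens_continuous s x : continuous (fun t => reldens s t x).
Proof. by move=> t; apply: is_derive_continuous; exact: expsol_derive. Qed.

Lemma d1_continuous s : continuous (L1gap s).
Proof.
apply: continuous_bigsum => x t; apply: cvgMr; apply: cvg_norm.
by apply: cvgB; [exact: dens_continuous|exact: cvg_cst].
Qed.

Lemma d2_continuous s : continuous (L2gap s).
Proof.
apply: continuous_bigsum => x t; apply: cvgMr.
have H : {for t, continuous (fun t => reldens s t x - 1)}.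
  by apply: cvgB; [exact: dens_continuous|exact: cvg_cst].
have -> : (fun t => (reldens s t x - 1) ^+ 2) = (fun t => (reldens s t x - 1) * (reldens s t x - 1)).
  by apply/funext => u; rewrite expr2.
exact: cvgM.
Qed.

Lemma root_in : r \in T. 
Proof. by rewrite mem_complete_subtree suffix_refl leq_addr. Qed.

(** The gap at time 0 is [2 * (1 - mu s)], and of two distinct configurations one has probability at
    most one half. *)
Lemma exists_d1_ge1 : exists s, 1 <= L1gap s 0.
Proof.
have E s : L1gap s 0 = 2 * (1 - mu s).
  rewrite -(mean_norm_delta (mu_gt0 beta h tau (m := m)) (mu_sum beta h tau r m)).
  by apply: eq_bigr => x _; rewrite /reldens expsol0.
pose s : Om := [ffun=> true]; pose x : T := [` root_in]%fset.
have : mu s + mu (flip s x) <= 1.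
  rewrite -(mu_sum beta h tau r m) (bigD1 s) //= lerD2l (bigD1 (flip s x)) ?flip_neq //= lerDl.
  by apply: sumr_ge0 => y _; rewrite ltW // mu_gt0.
case: (lerP (mu s) 2^-1) => hs H.
  by exists s; rewrite E; lra.
by exists (flip s x); rewrite E; lra.
Qed.

Lemma mixing_times (t1 : R) : 0 <= t1 -> (forall s, L2gap s t1 <= (expR 1)^-1 ^+ 2) ->
  exists T1 T2 : R, [/\ is_mixing_time beta h tau r m 1 T1, is_mixing_time beta h tau r m 2 T2,
    T1 <= T2 & T2 <= t1].
Proof.
move=> t10 ht1; set c : R := (expR 1)^-1.
have c0 : 0 <= c by rewrite invr_ge0 expR_ge0.
have c1 : c < 1 by rewrite invf_lt1 ?expR_gt0 // expR_gt1.
have d12 s t : L2gap s t <= c ^+ 2 -> L1gap s t <= c.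
  move=> H; rewrite -(@ler_pXn2r _ 2) ?nnegrE //; last by apply: mean_norm_ge0 => y; exact: mu_gt0.
  apply: le_trans H; apply: mean_norm_sqr; last exact: mu_sum.
  by move=> y; exact: mu_gt0.
have [s0 hs0] := exists_d1_ge1.
have [T2 [T2_gt0 T2_le T2_in T2_min]] := first_time d2_continuous t10 ht1 (ex_intro (fun i => _ < _) s0 (ltac:(
  by rewrite ltNge; apply/negP => /d12; lra) : c ^+ 2 < L2gap s0 0)).
have [T1 [T1_gt0 T1_le T1_in T1_min]] := first_time d1_continuous (ltW T2_gt0) (fun s => d12 s T2 (T2_in s))
  (ex_intro (fun i => _ < _) s0 (lt_le_trans c1 hs0 : c < L1gap s0 0)).
exists T1, T2; split => //; split => //.
- exact/L1_distance_le.
- by move=> u u0 H; apply: T1_min => //; exact/(L1_distance_le u c0).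
- exact/L2_distance_le.
- by move=> u u0 H; apply: T2_min => //; exact/(L2_distance_le u c0).
Qed.

End Mixing.

(** The bound [mu s >= delta^n] gives [ln (1 / mu s) <= n * ka], so [L2_decay] needs a time of order
    [ln n] to bring this down to a constant. *)
Theorem mixing_of_contraction (R : realType) (b : nat) (beta h : R) (tau : config b) (rho : R) (k0 : nat) :
  0 <= beta -> 0 <= rho -> rho < 1 -> (0 < k0)%N ->
  (forall r m v, v \in complete_subtree r m -> (size v + k0 <= size r + m)%N ->
     b%:R * theta beta * kap beta (fld beta h tau r m v) <= rho) ->
  exists C : R, forall (r : vertex b) (m : nat),
    let n := #|` complete_subtree r m| in
    (2 <= n)%N ->
    exists T1 T2 : R,
      [/\ is_mixing_time beta h tau r m 1 T1,
          is_mixing_time beta h tau r m 2 T2,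
          T1 <= T2 & T2 <= C * ln (n%:R : R)].
Proof.
move=> b0 r0 r1 k0_gt0 contr.
have [delta [d0 d1 dK]] : exists delta : R, [/\ 0 < delta, delta < 1 &
    forall r m v p a, delta <= chain_kernel beta (fld beta h tau r m) r v p a].
  exists (logis (- (2 * beta * (`|h| + b%:R + 1)))); split; [exact: logis_gt0|exact: logis_lt1|].
  by move=> r m v p a; exact: chain_kernel_ge.
have [C C0 HC] := tree_LSI b b0 d0 r0 r1 k0_gt0.
set rc := rate_const b beta h.
have rc0 : 0 < rc by rewrite divr_gt0 // expR_gt0.
set c := 2 * C / rc; have c0 : 0 < c by rewrite divr_gt0 // mulr_gt0.
set ka := - ln delta; have ka0 : 0 < ka by rewrite oppr_gt0 ln_lt0 // d0.
(* At time [t1] the exponential in [L2_decay] is [expR (- B) / n]; with this [B] its product with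
   [n * ka] is [expR (- 2) / 8] times [ka / (ka + 1)]. The 8 cancels that of [L2_decay], and
   [expR (- 2)] is the square of the mixing threshold. *)
have [B [B0 BE]] : exists B : R, 0 <= B /\ expR B = 8 * (expR 2 * (ka + 1)).
  have E1 : 1 <= expR 2 * (ka + 1).
    rewrite -[leLHS]mulr1; apply: ler_pM => //; last lra.
    by have := @expR_ge1Dx R 2; lra.
  exists (ln (8 * (expR 2 * (ka + 1)))); split; first by apply: ln_ge0; lra.
  by rewrite lnK // posrE; lra.
(* The additive constant [B] is absorbed through [ln 2 <= ln n], hence the condition [2 <= n]. *)
exists (c / 2 * (1 + B / ln 2)) => r m n n2.
have n0 : 0 < n%:R :> R by rewrite ltr0n; apply: leq_trans n2.
have ln2 : 0 < ln 2 :> R by rewrite ln_gt0 // ltr1n.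
have lnn : ln 2 <= ln n%:R :> R by rewrite ler_ln ?posrE // ler_nat.
set t1 := c / 2 * (ln n%:R + B).
have lnn0 : 0 <= ln n%:R :> R by apply: le_trans lnn; exact: ltW.
have t10 : 0 <= t1 by rewrite mulr_ge0 // ?addr_ge0 // divr_ge0 // ltW.
have t1C : t1 <= c / 2 * (1 + B / ln 2) * ln n%:R.
  rewrite /t1 -[leRHS]mulrA; apply: ler_wpM2l; first by rewrite divr_ge0 // ltW.
  rewrite mulrDl mul1r lerD2l -mulrA ler_peMr //.
  by rewrite mulrC ler_pdivlMr // mul1r.
have [s|T1 [T2 [h1 h2 h3 h4]]] := mixing_times t10 (beta := beta) (h := h) (tau := tau) (r := r) (m := m);
  last by exists T1, T2; split => //; apply: le_trans h4 _.
have LSI : forall w : Omega r m -> R, (forall x, 0 < w x) -> _ := glauber_LSI b0 C0 (fun f f0 => HC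
  (chain_kernel beta (fld beta h tau r m) r) (vlist r m) r m (fld beta h tau r m) (dK r m)
  (@chain_kernel_sum _ _ _ _ _ _ _) (vlist_uniq r m) (vlist_sorted r m) (@mem_vlist _ r m)
  (fun v p vr _ => ltac:(by rewrite /chain_kernel (negbTE vr) /spin mul1r))
  (fun v vV hv => contr r m v (ltac:(by rewrite -(perm_mem (perm_vlist r m)))) hv) f tau f0).
have small : expR (- (2 / c * t1)) * ln (mu beta h tau s)^-1 <= expR (- 2) / 8.
  have -> : 2 / c * t1 = ln n%:R + B by rewrite /t1; field; rewrite gt_eqF.
  rewrite opprD expRD expRN lnK ?posrE // [expR (- B)]expRN BE lnV ?posrE ?mu_gt0 //.
  have : - ln (mu beta h tau s) <= n%:R * ka.
    have := mu_ge s (ltW d0) (dK r m); rewrite -/n => H.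
    have : ln (delta ^+ n) <= ln (mu beta h tau s) by rewrite ler_ln ?posrE ?exprn_gt0 // mu_gt0.
    rewrite lnXn // /ka mulrN lerN2. by rewrite mulr_natl.
  have e2 := expR_gt0 (2 : R); rewrite expRN.
  have k1 : 0 < ka + 1 by lra.
  move=> H; apply: (@le_trans _ _ ((n%:R^-1 / (8 * (expR 2 * (ka + 1)))) * (n%:R * ka))).
    by rewrite ler_pM2l // divr_gt0 ?invr_gt0 // !mulr_gt0.
  have -> : n%:R^-1 / (8 * (expR 2 * (ka + 1))) * (n%:R * ka) = (expR 2)^-1 / 8 * (ka / (ka + 1)).
    by field; rewrite !gt_eqF.
  by rewrite ler_piMr ?divr_ge0 ?invr_ge0 ?(ltW e2) // ler_pdivrMr // mul1r lerDl.
have e21 : expR (- 2) <= 1 :> R by rewrite -[leRHS]expR0 ler_expR; lra.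
have := L2_decay (@glauber_mx_row _ _ beta h tau r m) (@glauber_mx_off _ _ beta h tau r m) (@glauber_mx_rev _ _ beta h tau r m)
  (@mu_gt0 _ _ beta h tau r m) (mu_sum beta h tau r m) (@mu_le1 _ _ beta h tau r m) (x0 := s) c0 LSI t10.
have sm2 : expR (- (2 / c * t1)) * ln (mu beta h tau s)^-1 <= 2^-1 by lra.
move=> /(_ sm2) H; apply: (le_trans H).
have -> : (expR 1)^-1 ^+ 2 = expR (- 2) :> R by rewrite -expRN -expRM_natl mulrN1.
lra.
Qed.

(** * The recursion for the effective fields *)

Section Fixpoints.
Context (R : realType).
Implicit Types (F : R -> R) (x u e : R).

Lemma iter_decreasing F x0 : {homo F : x y / x <= y} -> F x0 <= x0 ->
  forall j k, iter (j + k) F x0 <= iter k F x0.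
Proof.
move=> Fm F0.
have step k : iter k.+1 F x0 <= iter k F x0 by elim: k => [//|k IH]; exact: Fm.
by elim=> [//|j IH] k; rewrite addSn; apply: le_trans (step _) (IH k).
Qed.

(** The iterates decrease; the Lipschitz bound makes their infimum a fixed point, and monotonicity
    keeps every [u <= F u] that starts below [x0] below all of them. *)
Lemma monotone_iter_limit F (L B x0 : R) : {homo F : x y / x <= y} ->
  (forall x y, x <= y -> F y - F x <= L * (y - x)) -> 0 <= L ->
  F x0 <= x0 -> (forall x, B <= F x) -> B <= x0 ->
  exists l, [/\ F l = l, forall u, u <= F u -> u <= x0 -> u <= l &
    forall e, 0 < e -> exists k0, forall k, (k0 <= k)%N -> l <= iter k F x0 < l + e].
Proof.
move=> Fm FL L0 F0 FB Bx.
pose S := [set iter k F x0 | k in setT]%classic.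
have hB : lbound S B by move=> _ [[|k] _ <-] //=; exact: FB.
have hS : has_inf S by split; [exists x0; exists 0%N|exists B].
set l := inf S.
have lle k : l <= iter k F x0 by apply: ge_inf; [exists B|exists k].
have near e : 0 < e -> exists k0, forall k, (k0 <= k)%N -> l <= iter k F x0 < l + e.
  move=> e0; have [_ [k0 _ <-] hk0] := inf_adherent e0 hS.
  exists k0 => k hk; rewrite lle /=; apply: le_lt_trans hk0.
  by rewrite -(subnK hk); exact: iter_decreasing.
have Fl : F l = l.
  apply/eqP; rewrite eq_le; apply/andP; split.
    apply: lb_le_inf; first by exists x0; exists 0%N.
    move=> _ [k _ <-]; apply: (@le_trans _ _ (iter k.+1 F x0)); first exact: (Fm _ _ (lle k)).
    exact: (iter_decreasing Fm F0 1).
  rewrite leNgt; apply/negP => hl.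
  have e0 : 0 < (l - F l) / (L + 1) by rewrite divr_gt0; lra.
  have [k0 /(_ k0 (leqnn _)) /andP[h1 h2]] := near _ e0.
  have h3 := FL _ _ h1; have h4 : l <= F (iter k0 F x0) by exact: (lle k0.+1).
  have : (L + 1) * (iter k0 F x0 - l) < l - F l by rewrite mulrC -ltr_pdivlMr; lra.
  rewrite mulrDl; lra.
exists l; split => // u uF ux.
apply: lb_le_inf; first by exists x0; exists 0%N.
move=> _ [k _ <-]; elim: k => [//|k IH] /=; apply: le_trans uF _; exact: Fm.
Qed.

Lemma logis_continuous : continuous (@logis R).
Proof.
move=> x; apply: cvgV; first by rewrite gt_eqF // addr_gt0 // expR_gt0.
apply: cvgD; first exact: cvg_cst.
apply: (@continuous_comp _ _ _ (fun y : R => - y) (@expR R)); last exact: continuous_expR.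
by apply: cvgN; exact: cvg_id.
Qed.

Lemma kap_continuous (beta : R) : continuous (kap beta).
Proof.
move=> x; apply: cvgB.
  apply: (@continuous_comp _ _ _ (fun y : R => y + 2 * beta) (@logis R)); last exact: logis_continuous.
  by apply: cvgD; [exact: cvg_id|exact: cvg_cst].
apply: (@continuous_comp _ _ _ (fun y : R => y - 2 * beta) (@logis R)); last exact: logis_continuous.
by apply: cvgB; [exact: cvg_id|exact: cvg_cst].
Qed.

Lemma kap_near (beta u0 e : R) : 0 < e ->
  exists2 d, 0 < d & forall u, `|u - u0| < d -> `|kap beta u - kap beta u0| < e.
Proof.
move=> e0; have /cvgrPdist_lt /(_ e e0) /nbhs_ballP[d d0 hd] := @kap_continuous beta u0.
exists d => // u hu; rewrite distrC; apply: hd; rewrite /ball /= distrC //.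
Qed.

(** The factor [theta < 1] is the slack: at [u0] the product is at most [theta], and continuity of
    [kap] keeps it below the midpoint of [theta] and 1 nearby. *)
Lemma contraction_near (beta u0 : R) (b : nat) : 0 <= beta -> b%:R * kap beta u0 <= 1 ->
  exists rho, [/\ 0 <= rho, rho < 1 & exists2 d, 0 < d &
    forall u, `|u - u0| < d -> b%:R * theta beta * kap beta u <= rho].
Proof.
move=> b0 hk; have t0 := theta_ge0 b0; have t1 := theta_lt1 beta.
have bb : 0 <= b%:R :> R by [].
exists ((1 + theta beta) / 2); split; [lra|lra|].
have e0 : 0 < (1 - theta beta) / 2 / (b%:R + 1) by rewrite divr_gt0; lra.
have [d d0 hd] := kap_near beta u0 e0; exists d => // u /hd /ltr_normlW h.
have h1 : (b%:R + 1) * (kap beta u - kap beta u0) < (1 - theta beta) / 2 by rewrite mulrC -ltr_pdivlMr //; lra.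
have h2 : b%:R * kap beta u <= 1 + (1 - theta beta) / 2.
  case: (lerP (kap beta u) (kap beta u0)) => hc.
    by have := ler_wpM2l bb hc; lra.
  by move: h1; rewrite mulrDl mulrBr; lra.
have -> : b%:R * theta beta * kap beta u = theta beta * (b%:R * kap beta u) by ring.
apply: le_trans (ler_wpM2l t0 h2) _.
have : 0 <= theta beta * (1 - theta beta) by rewrite mulr_ge0; lra.
have : 0 <= (1 - theta beta) * (1 - theta beta) by rewrite mulr_ge0; lra.
by lra.
Qed.

End Fixpoints.

Section Recursion.
Context (R : realType) (b : nat) (beta h : R).
Hypothesis beta_ge0 : 0 <= beta.

(* The recursion for the effective field when it is constant on each level. *)
Definition field_map u : R := 2 * beta * h + b%:R * gfun beta u.

Lemma field_map_mono : {homo field_map : x y / x <= y}.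
Proof. by move=> x y xy; rewrite lerD2l ler_wpM2l // gfun_le. Qed.

Lemma field_map_lip x y : x <= y -> field_map y - field_map x <= b%:R * theta beta * (y - x).
Proof.
move=> xy; have -> : field_map y - field_map x = b%:R * (gfun beta y - gfun beta x) by rewrite /field_map; ring.
by rewrite -mulrA ler_wpM2l // gfun_lip_le.
Qed.

Lemma field_map_bound u : 2 * beta * h - b%:R * (2 * beta) <= field_map u <= 2 * beta * h + b%:R * (2 * beta).
Proof.
have /ler_normlP[h1 h2] := gfun_bound u beta_ge0; have bb : 0 <= b%:R :> R by [].
by have := ler_wpM2l bb h1; have := ler_wpM2l bb h2; rewrite mulrN /field_map => *; apply/andP; split; lra.
Qed.

(** The effective field of a leaf under the plus boundary, and an upper bound for all values of
    [field_map]; [field_bot] is the same for minus. *)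
Definition field_top : R := 2 * beta * h + b%:R * (2 * beta).
Definition field_bot : R := 2 * beta * h - b%:R * (2 * beta).

Lemma field_top_limit : exists l, [/\ field_map l = l,
  forall u, u <= field_map u -> u <= field_top -> u <= l &
  forall e, 0 < e -> exists k0, forall k, (k0 <= k)%N -> l <= iter k field_map field_top < l + e].
Proof.
have bb : 0 <= b%:R * (2 * beta) by rewrite !mulr_ge0.
apply: (@monotone_iter_limit R field_map (b%:R * theta beta) field_bot).
- exact: field_map_mono.
- exact: field_map_lip.
- by rewrite mulr_ge0 // theta_ge0.
- by have /andP[] := field_map_bound field_top.
- by move=> u; have /andP[] := field_map_bound u.
by rewrite /field_bot /field_top; lra.
Qed.

(** Applies [monotone_iter_limit] to the reflected map [G], whose iterates descend. *)
Lemma field_bot_limit : exists2 l, field_map l = l &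
  forall e, 0 < e -> exists k0, forall k, (k0 <= k)%N -> l - e < iter k field_map field_bot <= l.
Proof.
have bb : 0 <= b%:R * (2 * beta) by rewrite !mulr_ge0.
pose G u := - field_map (- u).
have iterG k : iter k G (- field_bot) = - iter k field_map field_bot.
  by elim: k => [//|k IH] /=; rewrite IH /G opprK.
have [||||||l [Gl _ hl]] := @monotone_iter_limit R G (b%:R * theta beta) (- field_top) (- field_bot).
- by move=> x y xy; rewrite lerN2 field_map_mono // lerN2.
- move=> x y xy; have := @field_map_lip (- y) (- x); rewrite lerN2 => /(_ xy).
  by rewrite /G; lra.
- by rewrite mulr_ge0 // theta_ge0.
- by rewrite /G opprK lerN2; have /andP[] := field_map_bound field_bot.
- by move=> u; rewrite lerN2; have /andP[] := field_map_bound (- u).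
- by rewrite lerN2 /field_bot /field_top; lra.
exists (- l); first by rewrite -[in RHS]Gl /G opprK.
move=> e e0; have [k0 hk0] := hl e e0; exists k0 => k /hk0; rewrite iterG => /andP[h1 h2].
by apply/andP; split; lra.
Qed.

(** Monotonicity of [gfun] propagates upwards the comparison of an arbitrary boundary with the
    all-minus and all-plus ones. *)
Lemma efield_bounds (tau : config b) k (x : vertex b) :
  iter k field_map field_bot <= efield beta h tau k x <= iter k field_map field_top.
Proof.
elim: k x => [|k IH] x /=.
  have hs (i : 'I_b) : - (2 * beta) <= 2 * beta * spin R (tau (i :: x)) <= 2 * beta.
    by have bb := beta_ge0; rewrite /spin; case: ifP => _; rewrite ?mulr1 ?mulrN1; apply/andP; split; lra.
  have cst c : \sum_(i < b) c = b%:R * c :> R by rewrite sumr_const card_ord mulr_natl.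
  rewrite /field_bot /field_top -mulrN !lerD2l -!cst; apply/andP; split; apply: ler_sum => i _;
    by have /andP[] := hs i.
have cst c : \sum_(i < b) c = b%:R * c :> R by rewrite sumr_const card_ord mulr_natl.
rewrite /field_map !lerD2l -!cst; apply/andP; split; apply: ler_sum => i _; apply: gfun_le => //;
  by have /andP[] := IH (i :: x).
Qed.

Lemma efield_plus (tau : config b) k (x : vertex b) : (forall v, tau v = true) ->
  efield beta h tau k x = iter k field_map field_top.
Proof.
move=> tp; have cst c : \sum_(i < b) c = b%:R * c :> R by rewrite sumr_const card_ord mulr_natl.
elim: k x => [|k IH] x /=.
  by rewrite /field_top -cst; congr (_ + _); apply: eq_bigr => i _; rewrite tp mulr1.
by rewrite /field_map -cst; congr (_ + _); apply: eq_bigr => i _; rewrite IH.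
Qed.

(* A slope above 1 at the limit l of the iterates from the top would give u > l with u <= field_map u, and such a u stays below all the iterates. *)
Lemma top_limit_slope l : field_map l = l ->
  (forall u, u <= field_map u -> u <= field_top -> u <= l) -> b%:R * kap beta l <= 1.
Proof.
move=> Fl hmax; rewrite leNgt; apply/negP => hk.
have bb : 0 <= b%:R :> R by [].
have b1 : 0 < b%:R + 1 :> R by lra.
have e0 : 0 < (b%:R * kap beta l - 1) / (b%:R + 1) by rewrite divr_gt0 // subr_gt0.
have [d d0 hd] := kap_near beta l e0.
set u := l + d / 2.
have [c /andP[c1 c2] E] := @gfun_is_derive_MVT R beta l u (ltac:(rewrite /u; lra)).
have /hd /ltr_normlP[h1 _] : `|c - l| < d by rewrite ger0_norm; move: c2; rewrite /u; lra.
have h2 : b%:R * (kap beta l - kap beta c) <= b%:R * kap beta l - 1.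
  apply: (@le_trans _ _ (b%:R * ((b%:R * kap beta l - 1) / (b%:R + 1)))).
    by apply: ler_wpM2l => //; lra.
  rewrite mulrA ler_pdivrMr // mulrC ler_pM2l ?subr_gt0 //; lra.
have Fu : u <= field_map u.
  have : field_map u - field_map l = b%:R * kap beta c * (u - l) by rewrite -[RHS]mulrA -E /field_map; ring.
  have ul : 0 <= u - l by rewrite /u; lra.
  have : 1 * (u - l) <= b%:R * kap beta c * (u - l) by apply: ler_wpM2r => //; lra.
  by rewrite Fl; lra.
have ut : u <= field_top by apply: le_trans Fu _; have /andP[] := field_map_bound u.
by have := hmax u Fu ut; rewrite /u; lra.
Qed.

Lemma contraction_of_limit (tau : config b) u0 : b%:R * kap beta u0 <= 1 ->
  (forall e, 0 < e -> exists k0, forall k x, (k0 <= k)%N -> `|efield beta h tau k x - u0| < e) ->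
  exists rho k0, [/\ 0 <= rho, rho < 1, (0 < k0)%N &
    forall r m v, v \in complete_subtree r m -> (size v + k0 <= size r + m)%N ->
     b%:R * theta beta * kap beta (fld beta h tau r m v) <= rho].
Proof.
move=> hk hlim; have [rho [r0 r1 [d d0 hd]]] := contraction_near beta_ge0 hk.
have [k0 hk0] := hlim d d0; exists rho, k0.+1; split => // r m v _ hv.
by apply: hd; apply: hk0; apply: leq_trans (leq_sub2r (size v) hv); rewrite addnC addnK.
Qed.

Lemma contraction_plus (tau : config b) : (forall v, tau v = true) ->
  exists rho k0, [/\ 0 <= rho, rho < 1, (0 < k0)%N &
    forall r m v, v \in complete_subtree r m -> (size v + k0 <= size r + m)%N ->
     b%:R * theta beta * kap beta (fld beta h tau r m v) <= rho].
Proof.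
move=> tp; have [l [Fl hmax hl]] := field_top_limit.
apply: (contraction_of_limit (top_limit_slope Fl hmax)) => e e0.
have [k0 hk0] := hl e e0; exists k0 => k x /hk0; rewrite efield_plus // => /andP[h1 h2].
by rewrite ger0_norm; lra.
Qed.

(** The fields are squeezed between the iterates from the two extremes, which share their limit
    because the fixed point is unique. *)
Lemma contraction_unique (tau : config b) : (forall u u', field_map u = u -> field_map u' = u' -> u = u') ->
  exists rho k0, [/\ 0 <= rho, rho < 1, (0 < k0)%N &
    forall r m v, v \in complete_subtree r m -> (size v + k0 <= size r + m)%N ->
     b%:R * theta beta * kap beta (fld beta h tau r m v) <= rho].
Proof.
move=> uniq_fix; have [l [Fl hmax hl]] := field_top_limit.
have [l' Fl' hl'] := field_bot_limit.
have E := uniq_fix _ _ Fl' Fl; rewrite {l'}E in Fl' hl' *.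
apply: (contraction_of_limit (top_limit_slope Fl hmax)) => e e0.
have [k0 hk0] := hl e e0; have [k1 hk1] := hl' e e0.
exists (maxn k0 k1) => k x; rewrite geq_max => /andP[/hk0 /andP[h1 h2] /hk1 /andP[h3 h4]].
have /andP[h5 h6] := efield_bounds tau k x.
by rewrite ltr_norml; apply/andP; split; lra.
Qed.

(** [beta < beta1] means that [theta] times the root of [b] is below 1, and [kap <= theta] holds at
    every field, so no convergence is required. *)
Lemma contraction_subcritical (tau : config b) : (2 <= b)%N -> beta < beta1 R b ->
  exists rho k0, [/\ 0 <= rho, rho < 1, (0 < k0)%N &
    forall r m v, v \in complete_subtree r m -> (size v + k0 <= size r + m)%N ->
     b%:R * theta beta * kap beta (fld beta h tau r m v) <= rho].
Proof.
move=> b2 hb; have t0 := theta_ge0 beta_ge0.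
set s := Num.sqrt (b%:R : R).
have sE : s ^+ 2 = b%:R by rewrite sqr_sqrtr.
have s1 : 1 < s by rewrite -[ltLHS]sqrtr1 ltr_sqrt ?ltr1n // ltr0n; apply: leq_trans b2.
have st : s * theta beta < 1.
  have h1 : expR (2 * beta) < (s + 1) / (s - 1).
    rewrite -[ltRHS]lnK ?posrE ?divr_gt0 ?subr_gt0 //; last lra.
    by rewrite ltr_expR; move: hb; rewrite /beta1 -/s; lra.
  move: h1; rewrite ltr_pdivlMr ?subr_gt0 // /theta.
  have := expR_gt0 (2 * beta); move: (expR _) => e e0 h1.
  by rewrite mulrA ltr_pdivrMr; lra.
exists (b%:R * theta beta ^+ 2), 1%N; split => //.
- by rewrite mulr_ge0 // sqr_ge0.
- rewrite -sE -exprMn; apply: exprn_ilt1 => //; rewrite mulr_ge0 //; lra.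
by move=> r m v _ _; rewrite expr2 mulrA; apply: ler_wpM2l; [rewrite mulr_ge0|exact: kap_le_theta].
Qed.

End Recursion.

(** * Infinite-volume Gibbs measures from fixed points *)

Section Levels.
Context (b : nat).

Definition level k : seq (vertex b) := [seq val t | t <- enum {: k.-tuple 'I_b}].

Fixpoint levels N : seq (vertex b) := if N is N'.+1 then levels N' ++ level N'.+1 else level 0.

Lemma mem_level k v : (v \in level k) = (size v == k).
Proof.
apply/mapP/eqP => [[t _ ->]|E]; first by rewrite size_tuple.
exists (tcast E (in_tuple v)); first by rewrite mem_enum.
exact: (esym (val_tcast E (in_tuple v))).
Qed.

Lemma mem_levels N v : (v \in levels N) = (size v <= N)%N.
Proof.
elim: N => [|N IH]; first by rewrite mem_level leqn0.
by rewrite /= mem_cat IH mem_level [RHS]leq_eqVlt ltnS orbC.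
Qed.

Lemma level_uniq k : uniq (level k).
Proof. by rewrite map_inj_uniq ?enum_uniq //; exact: val_inj. Qed.

Lemma levels_uniq N : uniq (levels N).
Proof.
elim: N => [|N IH]; first exact: level_uniq.
rewrite /= cat_uniq IH level_uniq andbT /=; apply/hasPn => v; rewrite mem_level mem_levels => /eqP ->.
by rewrite ltnn.
Qed.

Lemma levels_sorted N : level_sorted (levels N).
Proof.
have one k : level_sorted (level k).
  apply: (@sub_in_pairwise _ (fun v => size v == k) (fun _ _ => true)).
  - by move=> v w /eqP vk /eqP wk _; rewrite vk wk.
  - by apply/allP => v; rewrite mem_level.
  by elim: (level k) => //= v l ->; rewrite andbT; apply/allP.
elim: N => [|N IH]; first exact: one.
rewrite /level_sorted pairwise_cat; apply/and3P; split; [|exact: IH|exact: one].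
apply/allrelP => v w; rewrite mem_levels mem_level => h /eqP ->; exact: leqW.
Qed.

Lemma levels_topo N : topo (levels N).
Proof. exact/level_sorted_topo/levels_sorted. Qed.

Lemma mem_root_subtree N (v : vertex b) : (v \in complete_subtree [::] N) = (size v <= N)%N.
Proof. by rewrite mem_complete_subtree suffix0s. Qed.

Lemma perm_levels N : perm_eq (levels N) (complete_subtree ([::] : vertex b) N).
Proof.
apply: uniq_perm; [exact: levels_uniq|exact: fset_uniq|] => v.
by rewrite mem_levels mem_root_subtree.
Qed.

End Levels.

(** * DLR equations for the homogeneous chain on finite trees *)

Section FiniteDLR.
Context (R : realType) (b : nat) (beta h u : R).
Hypothesis u_fix : field_map b beta h u = u.
Implicit Types (s t : config b) (A : {fset vertex b}).

Local Notation sp := (spin R).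
Local Notation K := (chain_kernel beta (fun=> u) ([::] : vertex b)).
Local Notation Hrec := (Hrec beta h (fun=> u)).

Definition subtree_sum k (x : vertex b) s : R :=
  \sum_(v <- complete_subtree x k) (h * sp (s v) + \sum_(i < b) sp (s v) * sp (s (i :: v))).

(** Each side is the sum of the half fields [u * s / 2] over the leaves at depth [k.+1]; all other
    terms cancel. *)
Lemma Hrec_leaves k x s t : (forall v, size v = (size x + k.+1)%N -> s v = t v) ->
  Hrec k.+1 x s - beta * subtree_sum k x s = Hrec k.+1 x t - beta * subtree_sum k x t.
Proof.
elim: k x => [|k IH] x st.
  have E a : Hrec 1 x a - beta * subtree_sum 0 x a = \sum_(i < b) u * sp (a (i :: x)) / 2.
    by rewrite /subtree_sum big_complete_subtree0 /= big_split /= mulrDr mulr_sumr; ring.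
  by rewrite !E; apply: eq_bigr => i _; rewrite st //= addn1.
have E a : Hrec k.+2 x a - beta * subtree_sum k.+1 x a =
    \sum_(i < b) (Hrec k.+1 (i :: x) a - beta * subtree_sum k (i :: x) a).
  rewrite [Hrec k.+2 x a]/= {1}/subtree_sum big_complete_subtreeS big_split /= sumrB !mulrDr !mulr_sumr.
  by ring.
rewrite !E; apply: eq_bigr => i _; apply: IH => v hv; apply: st.
by rewrite hv /= addSnnS.
Qed.

Definition chain_weight N s : R := \prod_(v <- complete_subtree ([::] : vertex b) N) K v (par s v) (s v).

(** The chain runs one level below the depth [M] that contains [A], so its leaves, where its weight
    departs from the Gibbs weight, keep their spins. The fixed-point equation supplies the field
    recursion. *)
Lemma chain_weight_ratio A M s t : (A `<=` complete_subtree [::] M)%fset ->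
  (forall v, v \notin A -> s v = t v) ->
  chain_weight M.+1 s * expR (beta * energy predT h A t) = chain_weight M.+1 t * expR (beta * energy predT h A s).
Proof.
move=> AM st.
have [C C0 hC] := @Hrec_chain R b beta h (fun=> u) [::] M.+1 (fun v _ _ => ltac:(
  by rewrite sumr_const card_ord -[gfun _ _ *+ _]mulr_natl; exact: (esym u_fix))).
have E : Hrec M.+1 [::] s - Hrec M.+1 [::] t = beta * (energy predT h A s - energy predT h A t).
  rewrite -(@energy_diff R b predT h A (complete_subtree [::] M)) //.
  have es a : energy predT h (complete_subtree [::] M) a = subtree_sum M [::] a.
    by apply: energy_subtree => // v; rewrite /isparent; case: v.
  rewrite !es; have := @Hrec_leaves M [::] s t.
  have H v : size v = (size ([::] : vertex b) + M.+1)%N -> s v = t v.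
    move=> hv; apply: st; apply: contraT; rewrite negbK => /(fsubsetP AM).
    by rewrite mem_root_subtree hv add0n ltnn.
  by move=> /(_ H); lra.
apply: (@mulfI _ C); first by rewrite gt_eqF.
rewrite !mulrA -!hC -!expRD; congr expR; lra.
Qed.

Lemma glue_glue A s (xi zeta : {ffun A -> bool}) : glue (glue s xi) zeta = glue s zeta.
Proof.
apply/funext => v; rewrite [LHS]/Defs.glue [RHS]/Defs.glue; case: insubP => [//|/= vA].
by rewrite glue_out.
Qed.

Definition gibbs_average A (f : config b -> R) s : R :=
  \sum_(xi : {ffun A -> bool}) gibbs predT beta h A s (glue s xi) * f (glue s xi).

Definition partition_function A s : R := \sum_(xi : {ffun A -> bool}) expR (beta * energy predT h A (glue s xi)).

Lemma partition_function_gt0 A s : 0 < partition_function A s.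
Proof.
rewrite /partition_function (bigD1 [ffun=> true]) //= ltr_pwDl ?expR_gt0 //.
by apply: sumr_ge0 => xi _; exact: expR_ge0.
Qed.

Lemma partition_function_glue A s (xi : {ffun A -> bool}) : partition_function A (glue s xi) = partition_function A s.
Proof. by rewrite /partition_function; apply: eq_bigr => zeta _; rewrite glue_glue. Qed.

Lemma gibbs_glue A s (xi : {ffun A -> bool}) : gibbs predT beta h A s (glue s xi) =
  expR (beta * energy predT h A (glue s xi)) / partition_function A s.
Proof. by rewrite /gibbs ifT //; apply/asboolP => v vA; rewrite glue_out. Qed.

(* Exchanging the spins on A with an independent copy drawn from the Gibbs
   specification is an involution that preserves the joint weight. *)
Lemma finite_dlr A M f s0 : (A `<=` complete_subtree [::] M)%fset ->
  Qs K (levels b M.+1) (gibbs_average A f) s0 = Qs K (levels b M.+1) f s0.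
Proof.
move=> AM; set T : {fset vertex b} := complete_subtree [::] M.+1.
have AT v : v \in A -> v \in T.
  by move=> /(fsubsetP AM); rewrite !mem_root_subtree; exact: leqW.
have K_gt0 v p a : 0 < K v p a by rewrite /chain_kernel; case: ifP => _; exact: logis_gt0.
rewrite !(Qs_expand K_gt0 _ _ (perm_levels b M.+1) (levels_topo b M.+1)).
have wtE t : \prod_(v <- levels b M.+1) K v (par t v) (t v) = chain_weight M.+1 t.
  by apply: perm_big; exact: perm_levels.
under eq_bigr do rewrite wtE.
under [RHS]eq_bigr do rewrite wtE.
pose e t := expR (beta * energy predT h A t).
pose S (x : {ffun T -> bool}) := glue s0 x.
pose P := ({ffun T -> bool} * {ffun A -> bool})%type.
pose H (p : P) := chain_weight M.+1 (glue (S p.1) p.2) * e (S p.1) / partition_function A (S p.1) * f (glue (S p.1) p.2).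
pose swap (p : P) : P := ([ffun v : T => glue (S p.1) p.2 (val v)], [ffun a : A => S p.1 (val a)]).
have S1 p : S (swap p).1 = glue (S p.1) p.2.
  apply: glue_restrict => v vT; rewrite glue_out; first by rewrite /S glue_out.
  by apply: contra vT; exact: AT.
have S2 p : glue (glue (S p.1) p.2) (swap p).2 = S p.1.
  by rewrite glue_glue; apply: glue_restrict.
have swapK : involutive swap.
  move=> p; rewrite [RHS]surjective_pairing; congr pair.
    by apply/ffunP => v; rewrite ffunE S1 S2 /S; exact: glue_in.
  by apply/ffunP => a; rewrite ffunE S1; exact: glue_in.
have ZE (p : P) : partition_function A (glue (S p.1) p.2) = partition_function A (S p.1).
  exact: partition_function_glue.
transitivity (\sum_p H p).
  rewrite -(pair_big xpredT xpredT (fun x y => H (x, y))) /=; apply: eq_bigr => x _.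
  rewrite /gibbs_average mulr_sumr; apply: eq_bigr => xi _; rewrite gibbs_glue /H /=.
  have := @chain_weight_ratio A M (S x) (glue (S x) xi) AM (fun v vA => esym (glue_out (S x) xi vA)).
  by rewrite /e => E; rewrite -E /S; ring.
rewrite (reindex_inj (inv_inj swapK)) -(pair_big xpredT xpredT (fun x y => H (swap (x, y)))) /=.
apply: eq_bigr => x _.
have HE y : H (swap (x, y)) = chain_weight M.+1 (S x) * f (S x) * (e (glue (S x) y) / partition_function A (S x)).
  by rewrite /H S1 S2 ZE /=; ring.
under eq_bigr do rewrite HE.
by rewrite -mulr_sumr -mulr_suml divff ?mulr1 // gt_eqF // partition_function_gt0.
Qed.

End FiniteDLR.

(** * Realising the chain from a uniform variable *)

Section Coding.
Local Open Scope classical_set_scope.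
Context (R : realType) (b : nat) (K : vertex b -> bool -> bool -> R).
Hypothesis K_gt0 : forall v p a, 0 < K v p a.
Hypothesis K_sum : forall v p, K v p true + K v p false = 1.
Implicit Types (s : config b) (F : config b -> R) (E : set (config b)).

(* Samples the spins along l from a uniform point w of [lo, lo + len[ by subdividing the interval according to K. *)
Fixpoint code l (lo len : R) s (w : R) : config b :=
  if l is v :: l' then
    if w < lo + len * K v (par s v) true
    then code l' lo (len * K v (par s v) true) (upd s v true) w
    else code l' (lo + len * K v (par s v) true) (len * K v (par s v) false) (upd s v false) w
  else s.

Lemma code_measurable l lo len s E : measurable [set w : R | E (code l lo len s w)].
Proof.
elim: l lo len s => [|v l IH] lo len s /=.
  case: (pselect (E s)) => h.
    by rewrite (_ : [set w | _] = setT) //; apply/seteqP; split.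
  by rewrite (_ : [set w | _] = set0) //; apply/seteqP; split.
set mid := lo + _.
rewrite (_ : [set w | _] = (`]-oo, mid[ `&` [set w | E (code l lo (len * K v (par s v) true) (upd s v true) w)]) `|`
   (`[mid, +oo[ `&` [set w | E (code l mid (len * K v (par s v) false) (upd s v false) w)])).
  by apply: measurableU; apply: measurableI => //.
apply/seteqP; split => w /=; rewrite !in_itv /= ?andbT.
  by case: ltP => h; [left|right].
by case=> -[h]; [rewrite h|rewrite ltNge h].
Qed.

Lemma measurable_code_fun l lo len s F : measurable_fun setT (fun w : R => (F (code l lo len s w))%:E).
Proof.
apply/measurable_EFinP => _ B mB; rewrite setTI.
exact: (code_measurable l lo len s (F @^-1` B)).
Qed.

(** Induction along [l]: the interval is cut at [mid] in the proportion of the kernel, and both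
    pieces are of the same kind. The flag [x] tells whether the right end is open or closed, since
    inner pieces are half-open whereas the uniform law is integrated over a closed interval. *)
Lemma code_integral l (lo len : R) (x : bool) s F : 0 < len -> (forall s, 0 <= F s) ->
  (\int[lebesgue_measure]_(w in [set` Interval (BLeft lo) (BSide x (lo + len)%R)]) (F (code l lo len s w))%:E)%E
  = (len * Qs K l F s)%:E.
Proof.
move=> + F0; elim: l lo len x s => [|v l IH] lo len x s len0.
  rewrite /= (@integral_cst _ _ _ _ _ _ (F s)%:E) //= lebesgue_measure_itv /= lte_fin ltrDl len0.
  by rewrite -EFinB -EFinM mulrC; congr (_ * _)%:E; rewrite addrAC subrr add0r.
set q := K v (par s v) true; set q' := K v (par s v) false; set mid := lo + len * q.
have q0 : 0 < len * q by exact: mulr_gt0 len0 (K_gt0 _ _ _).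
have q'0 : 0 < len * q' by exact: mulr_gt0 len0 (K_gt0 _ _ _).
have midE : lo + len = mid + len * q' by rewrite /mid -addrA -mulrDr K_sum mulr1.
have lomid : lo < mid by rewrite /mid ltrDl.
have midhi : mid < lo + len by rewrite midE ltrDl.
have E1 : (\int[lebesgue_measure]_(w in [set` Interval (BLeft lo) (BLeft mid)]) (F (code (v :: l) lo len s w))%:E)%E =
    (len * q * Qs K l F (upd s v true))%:E.
  rewrite -(IH lo (len * q) true) //; apply: eq_integral => w; rewrite inE /= in_itv /= => /andP[_ h].
  by rewrite -/q -/mid h.
have E2 : (\int[lebesgue_measure]_(w in [set` Interval (BLeft mid) (BSide x (lo + len)%R)]) (F (code (v :: l) lo len s w))%:E)%E =
    (len * q' * Qs K l F (upd s v false))%:E.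
  rewrite midE -(IH mid (len * q') x) //; apply: eq_integral => w; rewrite inE /= in_itv /= => /andP[h _].
  by rewrite -/q -/mid ltNge h.
rewrite (@itv_bndbnd_setU _ _ _ (BLeft mid)); last 2 first.
- by rewrite bnd_simp ltW.
- by case: (x); rewrite bnd_simp // ltW.
rewrite ge0_integral_setU //; last 3 first.
- by apply: measurable_funTS; exact: (measurable_code_fun (v :: l) lo len s F).
- by move=> w _; rewrite lee_fin.
- apply/eqP; apply/seteqP; split => w //= [].
  by rewrite !in_itv /= => /andP[_ h1] /andP[h2 _]; move: h1; rewrite ltNge h2.
rewrite E1 E2 -EFinD; congr EFin.
by rewrite /= /Q -/q -/q'; ring.
Qed.

Lemma code_notin l lo len s w v : v \notin l -> code l lo len s w v = s v.
Proof.
elim: l lo len s => [//|x l IH] lo len s; rewrite inE negb_or => /andP[vx vl] /=.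
by case: ifP => _; rewrite IH // upd_other.
Qed.

Lemma code_cat_notin l l' lo len s w v : v \notin l' ->
  code (l ++ l') lo len s w v = code l lo len s w v.
Proof.
move=> vl'; elim: l lo len s => [|x l IH] lo len s /=; first exact: code_notin.
by case: ifP => _; exact: IH.
Qed.

(** Stopping at the level of [v] loses nothing: deeper levels are coded afterwards and leave the
    earlier spins as they are ([sample_levels]). *)
Definition sample (w : R) : config b := fun v => code (levels b (size v)) 0 1 (fun=> false) w v.

Lemma sample_levels N w v : (size v <= N)%N -> sample w v = code (levels b N) 0 1 (fun=> false) w v.
Proof.
move=> vN; rewrite -(subnK vN) addnC; move: (N - size v)%N => j; elim: j => [|j IH]; first by rewrite addn0.
by rewrite addnS /= code_cat_notin // mem_level neq_ltn ltnS leq_addr.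
Qed.

Definition finite_dim N (T : Type) (F : config b -> T) :=
  forall s t, (forall v, (size v <= N)%N -> s v = t v) -> F s = F t.

(** An event that reads finitely many spins is assembled from cylinders by fixing these spins one at
    a time. *)
Lemma finite_dim_measurable (F : config b -> R) N : finite_dim N F ->
  measurable_fun setT (F : config_space b -> R).
Proof.
move=> FN _ B mB; rewrite setTI.
have : forall s t, (forall v, v \in levels b N -> s v = t v) -> (F @^-1` B) s = (F @^-1` B) t.
  by move=> s t st; rewrite /preimage /= (FN s t) // => v hv; apply: st; rewrite mem_levels.
move: (F @^-1` B) => {FN F B mB} E; elim: (levels b N) E => [|v l IH] E hE.
  case: (pselect (E (fun=> false))) => h.
    by rewrite (_ : E = setT); [exact: measurableT|apply/seteqP; split => // s _; rewrite (hE s (fun=> false))].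
  by rewrite (_ : E = set0); [exact: measurable0|apply/seteqP; split => // s; rewrite (hE s (fun=> false))].
have cyl a : measurable ([set s : config_space b | s v = a]).
  by apply: sub_sigma_algebra; exists v, a.
have part a : measurable ([set s : config_space b | E (upd s v a)]).
  apply: IH => s t st; rewrite /= (hE (upd s v a) (upd t v a)) // => x.
  by rewrite inE /upd; case: eqVneq => //= _; exact: st.
rewrite (_ : E = ([set s | s v = true] `&` [set s | E (upd s v true)]) `|`
                ([set s | s v = false] `&` [set s | E (upd s v false)])).
  by apply: measurableU; apply: measurableI.
have updE s : upd s v (s v) = s by apply/funext => x; rewrite /upd; case: eqVneq => [->|].
apply/seteqP; split => s /=.
  by move=> Es; case E' : (s v); [left|right]; rewrite -E' updE.
by case=> -[<-]; rewrite updE.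
Qed.

Lemma sample_measurable : measurable_fun setT (sample : R -> config_space b).
Proof.
apply: (@measurability _ _ R (config_space b) setT sample (@cylinders b)) => // _ [_ [v [a ->]] <-].
rewrite setTI; exact: (code_measurable (levels b (size v)) 0 1 (fun=> false) [set s | s v = a]).
Qed.

Definition sample_mfun : {mfun measurableTypeR R >-> config_space b} :=
  let mf := isMeasurableFun.Build _ _ (measurableTypeR R) (config_space b) sample sample_measurable in
  HB.pack (sample : measurableTypeR R -> config_space b) mf.

Definition chain_law : probability (config_space b) R := distribution (uniform_prob (@ltr01 R)) sample_mfun.

Lemma chain_law_integral N F : finite_dim N F -> (forall s, 0 <= F s) ->
  (\int[chain_law]_s (F s)%:E)%E = (Qs K (levels b N) F (fun=> false))%:E.
Proof.
move=> FN F0; have mF := finite_dim_measurable FN.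
rewrite ge0_integral_distribution; last 2 first.
- exact/measurable_EFinP.
- by move=> s; rewrite lee_fin.
have E w : F (sample w) = F (code (levels b N) 0 1 (fun=> false) w) by apply: FN => v; exact: sample_levels.
transitivity (\int[uniform_prob (@ltr01 R)]_w (F (code (levels b N) 0 1 (fun=> false) w))%:E)%E.
  by apply: eq_integral => w _; rewrite /= E.
rewrite integral_uniform; last 2 first.
- exact: measurable_code_fun.
- by move=> w; rewrite lee_fin.
have := @code_integral (levels b N) 0 1 false (fun=> false) F ltr01 F0.
by rewrite add0r => ->; rewrite subr0 invr1 mul1e mul1r.
Qed.

Lemma finite_dim_indic N (E : set (config b)) : finite_dim N E -> finite_dim N (\1_E : config b -> R).
Proof.
move=> EN s t st; rewrite !indicE; congr (nat_of_bool _)%:R; apply/idP/idP; rewrite !inE (EN s t st) //.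
Qed.

Lemma finite_dim_set_measurable N (E : set (config_space b)) : finite_dim N E -> measurable E.
Proof.
move=> /finite_dim_indic IN.
have := finite_dim_measurable IN (measurableT) (measurable_set1 1).
rewrite setTI; congr measurable; apply/seteqP; split => s /=; rewrite indicE.
  by case: (boolP (s \in E)) => [/set_mem //|_ /= /eqP]; rewrite eq_sym oner_eq0.
by move=> Es; rewrite mem_set.
Qed.

Lemma chain_law_set N (E : set (config_space b)) : finite_dim N E ->
  chain_law E = (Qs K (levels b N) (\1_E) (fun=> false))%:E.
Proof.
move=> EN; rewrite -(chain_law_integral (finite_dim_indic EN)) // integral_indic ?setIT //.
exact: finite_dim_set_measurable EN.
Qed.

End Coding.

(** * DLR equations for the chain on the infinite tree *)

Section InfiniteDLR.
Local Open Scope classical_set_scope.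
Context (R : realType) (b : nat) (beta h u : R).
Hypothesis u_fix : field_map b beta h u = u.
Implicit Types (s t : config b) (A : {fset vertex b}) (E : set (config_space b)).

Local Notation K := (chain_kernel beta (fun=> u) ([::] : vertex b)).
Local Notation P := (chain_law K).

Let K_gt0 v p a : 0 < K v p a.
Proof. by rewrite /chain_kernel; case: ifP => _; exact: logis_gt0. Qed.

Let K_sum v p : K v p true + K v p false = 1.
Proof. by rewrite /chain_kernel /spin; case: ifP => _; rewrite !mul1r !mulN1r logis_sum. Qed.

Lemma finite_dim_leq (T : Type) (F : config b -> T) N N' : (N <= N')%N -> finite_dim N F -> finite_dim N' F.
Proof. by move=> NN FN s t st; apply: FN => v hv; apply: st; apply: leq_trans NN. Qed.

Lemma fset_sub_subtree A : exists M, (A `<=` complete_subtree ([::] : vertex b) M)%fset.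
Proof.
exists (\max_(v <- A) size v); apply/fsubsetP => v vA; rewrite mem_root_subtree.
exact: leq_bigmax_seq.
Qed.

Lemma energy_finite_dim A M : (A `<=` complete_subtree ([::] : vertex b) M)%fset ->
  finite_dim M.+1 (energy predT h A).
Proof.
move=> AM s t st; rewrite /energy.
have sA v : v \in A -> s v = t v.
  by move=> /(fsubsetP AM); rewrite mem_root_subtree => hv; apply: st; exact: leqW.
have sB v : v \in (A `|` bdry predT A)%fset -> s v = t v.
  rewrite in_fsetU => /orP[|/in_bdry[[a aA av] _]]; first exact: sA.
  have := fsubsetP AM _ aA; rewrite mem_root_subtree => ha; apply: st.
  by case/orP: av => /childP[i E]; [rewrite E|rewrite E /= in ha; apply: leqW; apply: ltnW].
congr (_ + _ * _); last by apply: eq_big_seq => v vA; rewrite sA.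
apply: eq_big_seq => x xB; rewrite big_seq_cond [RHS]big_seq_cond; apply: eq_bigr => y /andP[yB _].
by rewrite (sB x) // (sB y).
Qed.

Lemma glue_eq_on N A (xi : {ffun A -> bool}) s t : (forall v, (size v <= N)%N -> s v = t v) ->
  forall v, (size v <= N)%N -> glue s xi v = glue t xi v.
Proof. by move=> st v hv; rewrite /Defs.glue st. Qed.

Lemma gibbs_finite_dim A M (xi : {ffun A -> bool}) : (A `<=` complete_subtree ([::] : vertex b) M)%fset ->
  finite_dim M.+1 (fun s => gibbs predT beta h A s (glue s xi)).
Proof.
move=> AM s t st; have en (zeta : {ffun A -> bool}) : energy predT h A (glue s zeta) = energy predT h A (glue t zeta).
  by apply: (energy_finite_dim AM); exact: glue_eq_on.
rewrite !gibbs_glue en; congr (_ / _); apply: eq_bigr => zeta _; by rewrite en.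
Qed.

Lemma gibbs_ge0 A (eta s : config b) : 0 <= gibbs predT beta h A eta s.
Proof.
rewrite /gibbs; case: ifP => // _; rewrite divr_ge0 ?expR_ge0 //.
by apply: sumr_ge0 => xi _; exact: expR_ge0.
Qed.

Lemma gibbs_sum A s : \sum_(xi : {ffun A -> bool}) gibbs predT beta h A s (glue s xi) = 1.
Proof.
under eq_bigr do rewrite gibbs_glue.
by rewrite -mulr_suml divff // gt_eqF // partition_function_gt0.
Qed.

Lemma glue_measurable A (xi : {ffun A -> bool}) :
  measurable_fun setT (fun s : config_space b => glue s xi : config_space b).
Proof.
apply: (@measurability _ _ (config_space b) (config_space b) setT _ (@cylinders b)) => // _ [_ [v [a ->]] <-].
rewrite setTI; apply: (@finite_dim_set_measurable R b (size v)) => s t st.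
by rewrite /preimage /= (glue_eq_on xi st).
Qed.

Lemma gibbs_average_integral A (E : set (config_space b)) : measurable E ->
  (\int[P]_s (gibbs_average beta h A (\1_E) s)%:E =
   \sum_(xi : {ffun A -> bool}) \int[P]_(s in (fun s => glue s xi) @^-1` E) (gibbs predT beta h A s (glue s xi))%:E)%E.
Proof.
move=> mE; have [M AM] := fset_sub_subtree A.
have mg (xi : {ffun A -> bool}) : measurable_fun setT (fun s : config_space b => gibbs predT beta h A s (glue s xi)).
  exact: (finite_dim_measurable (gibbs_finite_dim xi AM)).
have mpre (xi : {ffun A -> bool}) : measurable ((fun s : config_space b => glue s xi) @^-1` E).
  by have := glue_measurable xi measurableT mE; rewrite setTI.
under eq_integral do rewrite /gibbs_average -sumEFin.
rewrite ge0_integral_sum //; last 2 first.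
- move=> xi; apply/measurable_EFinP; apply: measurable_funM; first exact: mg.
  by apply: (measurableT_comp (measurable_indic mE)); exact: glue_measurable.
- by move=> xi s _; rewrite lee_fin mulr_ge0 ?gibbs_ge0.
apply: eq_bigr => xi _; rewrite [RHS]integral_mkcond; apply: eq_integral => s _.
rewrite patchE indicE; have -> : (s \in (fun s => glue s xi) @^-1` E) = (glue s xi \in E).
  by apply/idP/idP; rewrite !inE.
by case: ifP => _; rewrite ?mulr1 ?mulr0.
Qed.

(** For events of finitely many levels this is [finite_dlr] in a volume that contains [A] and these
    levels. Such events are closed under intersection and generate the sigma-algebra, so Dynkin's
    lemma extends the equation. *)
Lemma chain_law_gibbs : is_gibbs beta h P.
Proof.
move=> A E mE; have [M AM] := fset_sub_subtree A.
pose gen : set (set (config_space b)) := [set E | exists N, finite_dim N E].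
have genE : @measurable _ (config_space b) = <<s gen >>.
  apply/seteqP; split.
    apply: sub_sigma_algebra2 => _ [v [a ->]]; exists (size v) => s t st.
    by rewrite /= st.
  apply: smallest_sub; first exact: sigma_algebra_measurable.
  by move=> F [N FN]; exact: (@finite_dim_set_measurable R b N).
have genI : setI_closed gen.
  move=> F F' [N FN] [N' FN']; exists (maxn N N') => s t st; rewrite /setI /mkset.
  by rewrite (finite_dim_leq (leq_maxl N N') FN st) (finite_dim_leq (leq_maxr N N') FN' st).
have gen_eq F : gen F -> P F = (\int[P]_s (gibbs_average beta h A (\1_F) s)%:E)%E.
  move=> [N FN]; have FN' := finite_dim_leq (leq_maxl N M) FN.
  have FN'' := finite_dim_leq (leqnSn _) FN'.
  rewrite (chain_law_set K_gt0 K_sum FN'') (@chain_law_integral R b K K_gt0 K_sum (maxn N M).+1).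
  - congr EFin; symmetry; apply: finite_dlr => //.
    apply/fsubsetP => v /(fsubsetP AM); rewrite !mem_root_subtree => hv.
    by apply: leq_trans hv _; exact: leq_maxr.
  - move=> s t st; apply: eq_bigr => xi _.
    rewrite (finite_dim_leq _ (gibbs_finite_dim xi AM) st) ?ltnS ?leq_maxr //; congr (_ * _).
    by exact: (@finite_dim_indic R b _ F FN'' _ _ (glue_eq_on xi st)).
  - by move=> s; apply: sumr_ge0 => xi _; rewrite mulr_ge0 ?gibbs_ge0.
rewrite -[RHS]/(\int[P]_s (gibbs_average beta h A (\1_E) s)%:E)%E.
have sE : <<s gen >> E by rewrite -genE.
apply: (@dynkin_induction _ (config_space b) gen (fun F => P F = (\int[P]_s (gibbs_average beta h A (\1_F) s)%:E)%E) genE genI) => //.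
- by apply: gen_eq; exists 0%N.
(* Complements: the Gibbs averages of an event and of its complement add up to 1. *)
- move=> F mF HF.
  have tot : (\int[P]_s (gibbs_average beta h A (\1_F) s)%:E + \int[P]_s (gibbs_average beta h A (\1_(~` F)) s)%:E = 1)%E.
    have mga (G : set (config_space b)) : measurable G -> measurable_fun setT (fun s : config_space b => (gibbs_average beta h A (\1_G) s)%:E).
      move=> mG; apply/measurable_EFinP; apply: measurable_sum => xi; apply: measurable_funM.
        exact: (finite_dim_measurable (gibbs_finite_dim xi AM)).
      by apply: (measurableT_comp (measurable_indic mG)); exact: glue_measurable.
    have g0 (G : set (config_space b)) s : (0 <= (gibbs_average beta h A (\1_G) s)%:E)%E.
      by rewrite lee_fin; apply: sumr_ge0 => xi _; rewrite mulr_ge0 ?gibbs_ge0.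
    rewrite -ge0_integralD //; [|exact: mga|by apply: mga; exact: measurableC].
    rewrite (eq_integral (cst 1%E)); first by rewrite integral_cst // mul1e; exact: probability_setT.
    move=> s _; rewrite -EFinD; congr EFin; rewrite -big_split /= -(gibbs_sum A s); apply: eq_bigr => xi _.
    rewrite -mulrDr !indicE in_setC; case: (_ \in F); rewrite ?addr0 ?add0r mulr1 //.
  rewrite probability_setC // HF -tot addeC addeK //.
  by rewrite -HF; exact: fin_num_measure.
(* Disjoint unions: for each of the finitely many [xi] the preimages under gluing remain disjoint,
   so each integral is countably additive, and the finite sum is exchanged with the series. *)
move=> F mF tF HF; rewrite measure_bigcup //.
rewrite gibbs_average_integral; last exact: bigcup_measurable.
rewrite (eq_eseriesr (g := fun k => (\sum_(xi : {ffun A -> bool}) \int[P]_(s in (fun s => glue s xi) @^-1` F k) (gibbs predT beta h A s (glue s xi))%:E)%E)); last first.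
  by move=> k _; exact: (etrans (HF k) (gibbs_average_integral A (mF k))).
rewrite (@eq_eseriesl _ _ xpredT); last by move=> k; rewrite in_setT.
rewrite nneseries_sum; last by move=> xi k _; apply: integral_ge0 => s _; rewrite lee_fin gibbs_ge0.
apply: eq_bigr => xi _; rewrite preimage_bigcup ge0_integral_bigcup //.
- by move=> k; have := glue_measurable xi measurableT (mF k); rewrite setTI.
- apply: measurable_funTS; apply/measurable_EFinP; exact: (finite_dim_measurable (gibbs_finite_dim xi AM)).
- by move=> s _; rewrite lee_fin gibbs_ge0.
apply/trivIsetP => i j _ _ ij; rewrite -preimage_setI.
by move/trivIsetP : tF => /(_ i j I I ij) ->; rewrite preimage_set0.
Qed.

Lemma levels0 : levels b 0 = [:: [::]].
Proof.
apply: perm_small_eq => //; apply: uniq_perm => //; first exact: levels_uniq.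
by move=> v; rewrite mem_levels leqn0 size_eq0 inE.
Qed.

Lemma chain_law_root : P [set s | s [::] = true] = (logis u)%:E.
Proof.
have E0 : finite_dim 0 ([set s | s [::] = true] : set (config b)) by move=> s t st; rewrite /= st.
rewrite (chain_law_set K_gt0 K_sum E0) levels0 /= /Q /chain_kernel eqxx; congr EFin.
rewrite !indicE mem_set /=; last by rewrite upd_same.
rewrite memNset /=; last by rewrite upd_same.
by rewrite /spin mul1r mulr1 mulr0 addr0.
Qed.

End InfiniteDLR.

(** The two chains are Gibbs measures that give a plus at the root the probabilities [logis u] and
    [logis u'], and [logis] is injective. *)
Lemma gibbs_unique_fixed_point (R : realType) (b : nat) (beta h u u' : R) : gibbs_unique b beta h ->
  field_map b beta h u = u -> field_map b beta h u' = u' -> u = u'.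
Proof.
move=> [P [_ hP]] Fu Fu'.
have mE : measurable ([set s | s [::] = true]%classic : set (config_space b)).
  by apply: (@finite_dim_set_measurable R b 0) => s t st; rewrite /= st.
have := hP _ (chain_law_gibbs Fu) _ mE; rewrite chain_law_root => E.
have := hP _ (chain_law_gibbs Fu') _ mE; rewrite chain_law_root -E => -[].
by move=> /invr_inj /addrI /expR_inj /oppr_inj ->.
Qed.

(** With [s] the root of [b], the comparison of the two fractions reduces to
    [s^2 + 1 < (s + 1)^2]. *)
Lemma beta0_lt_beta1 (R : realType) (b : nat) : (2 <= b)%N -> beta0 R b < beta1 R b.
Proof.
move=> b2; have b1 : 1 < b%:R :> R by rewrite ltr1n.
set s := Num.sqrt (b%:R : R).
have sE : s ^+ 2 = b%:R by rewrite sqr_sqrtr.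
have s1 : 1 < s by rewrite -[ltLHS]sqrtr1 ltr_sqrt // (lt_trans _ b1).
rewrite /beta0 /beta1 -/s -sE ltr_pM2l ?invr_gt0 //.
have p : 0 < s ^+ 2 - 1 by rewrite sE subr_gt0.
have q : 0 < s - 1 by rewrite subr_gt0.
rewrite ltr_ln ?posrE ?divr_gt0 //; [|by rewrite sE; lra|by lra].
rewrite ltr_pdivrMr // mulrAC ltr_pdivlMr //.
have -> : (s + 1) * (s ^+ 2 - 1) = (s + 1) ^+ 2 * (s - 1) by ring.
rewrite ltr_pM2r //; have : 0 < s by lra.
by rewrite sqrrD1; lra.
Qed.

Theorem mainTheorem3 (R : realType) (b : nat) (hb : (2 <= b)%N)
    (beta h : R) (hbeta : 0 <= beta) (tau : config b)
    (hyp : (beta < beta1 R b \/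
            (exists2 hc : R, is_critical_field b beta hc & hc < `|h|))
           \/ (forall v : vertex b, tau v = true)) :
  exists C : R, forall (r : vertex b) (m : nat),
    let n := #|` complete_subtree r m| in
    (2 <= n)%N ->
    exists T1 T2 : R,
      [/\ is_mixing_time beta h tau r m 1 T1,
          is_mixing_time beta h tau r m 2 T2,
          T1 <= T2 & T2 <= C * ln (n%:R : R)].
Proof.
suff [rho [k0 [r0 r1 k0_gt0 contr]]] : exists rho k0, [/\ 0 <= rho, rho < 1, (0 < k0)%N &
    forall r m v, v \in complete_subtree r m -> (size v + k0 <= size r + m)%N ->
     b%:R * theta beta * kap beta (fld beta h tau r m v) <= rho].
  exact: mixing_of_contraction contr.
case: hyp => [[hb1|[hc hcrit hch]]|tau_plus]; first exact: contraction_subcritical.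
  (* For [beta <= beta0] the critical field carries no information on uniqueness, but then
     [beta < beta1] and the subcritical bound holds for every [h]. *)
  move: hcrit; rewrite /is_critical_field; case: ifP => [b_le _|_ [_ hcrit]].
    by apply: contraction_subcritical => //; exact: le_lt_trans b_le (beta0_lt_beta1 _ hb).
  apply: contraction_unique => // u u'; apply: gibbs_unique_fixed_point.
  by have [_] := hcrit h; apply.
exact: contraction_plus.
Qed.
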